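(* Let $T$ be a ring with unit and $\mathfrak C$ an $A$-coring. Suppose that functors $F:\mathcal M_T\to\mathcal M^{\mathfrak C}$ and $G:\mathcal M^{\mathfrak C}\to\mathcal M_T$ form an equivalence of categories. Put $\Sigma=F(T)$. Then the following statements hold: (i) $\Sigma$ is a finitely generated and projective right $A$-module; (ii) $F\cong-\otimes_T\Sigma$ and $G\cong-\otimes^{\mathfrak C}\Sigma^*$; (iii) there is a comatrix coring context $(T,A,\Sigma,\Sigma^*,\sigma,\tau)$, and $\mathfrak C$ is isomorphic to the comatrix coring $\Sigma^*\otimes_T\Sigma$; (iv) the map $\jmath:T\to\mathrm{End}^{\mathfrak C}(\Sigma)$, $\jmath(t)(u)=tu$, is an isomorphism. If $\mathfrak C$ is flat as a left $A$-module, then the following statements hold as well: (v) $\Sigma$ is a finitely generated and projective generator in $\mathcal M^{\mathfrak C}$; (vi) $\Sigma$ is faithfully flat as a left $T$-module. Conversely, (i), (iii) and (vi) imply that $\mathfrak C$ is flat as a left $A$-module and $(-\otimes_T\Sigma,\ \mathrm{Hom}^{\mathfrak C}(\Sigma,-))$ is a pair of inverse equivalences with $T=\mathrm{End}^{\mathfrak C}(\Sigma)$.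
   Context: $A$ is an associative unital ring; modules over unital rings are unital, and $\mathcal M_T$ is the category of unital right $T$-modules. An $A$-coring is an $A$-bimodule $\mathfrak C$ with coassociative, counital $A$-bilinear maps $\Delta:\mathfrak C\to\mathfrak C\otimes_A\mathfrak C$ and $\varepsilon_{\mathfrak C}:\mathfrak C\to A$. $\mathcal M^{\mathfrak C}$ is the category of right $\mathfrak C$-comodules (right $A$-modules $M$ with a coassociative counital right $A$-linear coaction $\rho_M(m)=m_{[0]}\otimes_Am_{[1]}\in M\otimes_A\mathfrak C$) and colinear maps; $\mathrm{Hom}^{\mathfrak C},\mathrm{End}^{\mathfrak C}$ denote colinear maps. $\Sigma=F(T)$ carries the left $T$-action $t\cdot u=F(\lambda_t)(u)$, $\lambda_t$ being left multiplication by $t$ on $T$; this makes it a right $\mathfrak C$-comodule with a left $T$-action that commutes with the $A$-action and for which the coaction is left $T$-linear. In the converse $\Sigma$ is likewise a right $\mathfrak C$-comodule with such a left $T$-action, so that the two functors (between $\mathcal M_T$ and $\mathcal M^{\mathfrak C}$) are defined. $\Sigma^*=\mathrm{Hom}_A(\Sigma,A)$ has right $T$-action $(f\cdot t)(u)=f(tu)$. A comatrix coring context (over unital rings) is a tuple $(T,A,\Sigma,\Sigma^\dagger,\eta,\varepsilon)$ where $\Sigma$ is a $T$-$A$-bimodule, $\Sigma^\dagger$ an $A$-$T$-bimodule, $\eta:T\to\Sigma\otimes_A\Sigma^\dagger$ is $T$-bilinear, $\varepsilon:\Sigma^\dagger\otimes_T\Sigma\to A$ is $A$-bilinear, and, writing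 $\eta(1)=e\otimes_Af$ (summation understood), $e\,\varepsilon(f\otimes_Tu)=u$ and $\varepsilon(\varphi\otimes_Te)f=\varphi$ for all $u\in\Sigma$, $\varphi\in\Sigma^\dagger$. The associated comatrix coring is $\Sigma^\dagger\otimes_T\Sigma$ with counit $\varepsilon$ and comultiplication $\varphi\otimes_Tu\mapsto\varphi\otimes_Te\otimes_Af\otimes_Tu$. Cotensor product. $N\otimes^{\mathfrak C}L=\ker(\rho_N\otimes_AL-N\otimes_A\rho_L)$ for a right comodule $N$ and left comodule $L$. The left $\mathfrak C$-coaction on $\Sigma^*$ is $\varphi\mapsto\varphi(e_{[0]})e_{[1]}\otimes_Af$, where $\sigma(1)=e\otimes_Af$ and $e_{[0]}\otimes_Ae_{[1]}$ is the coaction of $\mathfrak C$ on $e\in\Sigma$. A left $T$-module $\Sigma$ is faithfully flat if $-\otimes_T\Sigma$ is exact and faithful on $\mathcal M_T$. An object $X$ of an abelian category is finitely generated if for any directed family of subobjects $\{X_i\}_{i\in I}$ of $X$ with $X=\sum_{i\in I}X_i$ there is $i_0\in I$ with $X=X_{i_0}$. ($\mathcal M^{\mathfrak C}$ is a Grothendieck category when $\mathfrak C$ is flat as a left $A$-module.)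
   Formalization: In (iii) the isomorphism of 𝔠 with the comatrix coring Σ*⊗_TΣ is also required to carry the canonical coaction u ↦ e⊗(f⊗u) to the given coaction of Σ; without this the converse is false (A=k, T=k×k, Σ=k², coaction u ↦ u⊗g with g one of the two grouplikes). *)

(* Defs.v *)
From HB Require Import structures.
From mathcomp Require Import all_boot all_algebra boolp.

Set Implicit Arguments.
Unset Strict Implicit.
Unset Printing Implicit Defensive.

Import GRing.Theory.
Local Open Scope ring_scope.
Local Open Scope quotient_scope.

(* Right R-modules are left modules over the converse ring R^c, and [m *> r]
   is the right action. Rings are [pzRingType]s: associative, unital, possibly
   zero. *)
Notation rmodType R := (lmodType R^c).

Definition ract (R : pzRingType) (M : rmodType R) (m : M) (r : R) : M :=
  (r : R^c) *: m.
Notation "m *> r" := (ract m r) (at level 40, left associativity) : ring_scope.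

Section RightAction.
Variables (R : pzRingType) (M : rmodType R).
Implicit Types (m : M) (r : R).

Lemma ractA m r s : m *> r *> s = m *> (r * s).
Proof. exact: scalerA. Qed.

Lemma ract1 m : m *> 1 = m.
Proof. exact: scale1r. Qed.

Lemma ractDl m m' r : (m + m') *> r = m *> r + m' *> r.
Proof. exact: scalerDr. Qed.

Lemma ractDr m r s : m *> (r + s) = m *> r + m *> s.
Proof. exact: scalerDl. Qed.

Lemma ract_suml I (s : seq I) (F : I -> M) r :
  (\sum_(i <- s) F i) *> r = \sum_(i <- s) F i *> r.
Proof. exact: scaler_sumr. Qed.

Lemma linear_ract (N : rmodType R) (f : {linear M -> N}) m r :
  f (m *> r) = f m *> r.
Proof. exact: linearZ. Qed.

End RightAction.

Lemma linear_ext (R : pzRingType) (M N : lmodType R) (f g : {linear M -> N}) :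
  f =1 g -> f = g.
Proof.
case: f => f cf; case: g => g cg /= /funext fg; subst g; congr GRing.Linear.Pack.
case: cf cg => [[af] [sf]] [[ag] [sg]].
by rewrite (Prop_irrelevance af ag) (Prop_irrelevance sf sg).
Qed.

Definition linear_of (R : pzRingType) (U V : lmodType R) (h : U -> V)
    (hL : linear h) : {linear U -> V} :=
  HB.pack_for {linear U -> V} h (GRing.isLinear.Build R U V *:%R h hL).

Lemma morph_add_sum (V W : zmodType) (f : V -> W) (I : Type) (s : seq I)
    (F : I -> V) : {morph f : x y / x + y} ->
  f (\sum_(i <- s) F i) = \sum_(i <- s) f (F i).
Proof.
move=> fD; apply: (big_morph f fD).
by apply: (addrI (f 0)); rewrite -fD !addr0.
Qed.

Section Tensor.
Variables (R : pzRingType) (M : rmodType R) (N : lmodType R).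

Definition balanced (Z : zmodType) (f : M -> N -> Z) : Prop :=
  [/\ forall m m' n, f (m + m') n = f m n + f m' n,
      forall m n n', f m (n + n') = f m n + f m n'
    & forall m r n, f (m *> r) n = f m (r *: n)].

Definition tsum (Z : zmodType) (f : M -> N -> Z) (s : seq (M * N)) : Z :=
  \sum_(p <- s) f p.1 p.2.

(* A sequence of pairs stands for the formal sum of the corresponding pure
   tensors. Two formal sums are identified when every balanced map into an
   abelian group takes the same value on them, which is the same as being equal
   in the quotient of the free abelian group on M * N by the balancing
   relations. *)
Definition teq (s1 s2 : seq (M * N)) : bool :=
  `[< forall (Z : zmodType) (f : M -> N -> Z),
        balanced f -> tsum f s1 = tsum f s2 >].

Lemma teq_is_equiv : equiv_class_of teq.
Proof.
split=> [s|s1 s2|s2 s1 s3].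
- exact/asboolP.
- by apply: asbool_equiv_eq; split=> h Z f hf; rewrite (h Z f hf).
- by move=> /asboolP h12 /asboolP h23; apply/asboolP => Z f hf;
    rewrite (h12 Z f hf) (h23 Z f hf).
Qed.
Canonical teq_equiv := EquivRelPack teq_is_equiv.

Definition tensor : Type := {eq_quot teq}.
HB.instance Definition _ := Choice.on tensor.
HB.instance Definition _ := EqQuotient.on tensor.

Definition tens (m : M) (n : N) : tensor := \pi_tensor [:: (m, n)].

(* The map induced by f, meaningful when f is balanced. *)
Definition tlift (Z : zmodType) (f : M -> N -> Z) (x : tensor) : Z :=
  tsum f (repr x).

Lemma tlift_pi (Z : zmodType) (f : M -> N -> Z) s :
  balanced f -> tlift f (\pi_tensor s) = tsum f s.
Proof.
move=> hf; rewrite /tlift; case: piP => s' /eqmodP/asboolP h.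
by rewrite (h Z f hf).
Qed.

Let neg (s : seq (M * N)) := [seq (- p.1, p.2) | p <- s].
Definition tadd (x y : tensor) : tensor := \pi_tensor (repr x ++ repr y).
Definition topp (x : tensor) : tensor := \pi_tensor (neg (repr x)).
Definition tzero : tensor := \pi_tensor [::].

Lemma tensor_eqP (x y : tensor) :
  (forall (Z : zmodType) (f : M -> N -> Z), balanced f -> tlift f x = tlift f y) ->
  x = y.
Proof.
move=> h; rewrite -[x]reprK -[y]reprK; apply/eqmodP/asboolP => Z f hf.
exact: h.
Qed.

Section BalancedLift.
Variables (Z : zmodType) (f : M -> N -> Z) (hf : balanced f).

Lemma tlift_tadd x y : tlift f (tadd x y) = tlift f x + tlift f y.
Proof. by rewrite tlift_pi // /tsum big_cat. Qed.

Lemma balancedN m n : f (- m) n = - f m n.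
Proof.
case: hf => hD _ _; apply/eqP; rewrite -addr_eq0 -hD addNr; apply/eqP.
by apply: (addrI (f 0 n)); rewrite -hD !addr0.
Qed.

Lemma tlift_topp x : tlift f (topp x) = - tlift f x.
Proof.
rewrite tlift_pi // /tsum big_map /= -sumrN; apply: eq_bigr => p _.
exact: balancedN.
Qed.

Lemma tlift_tzero : tlift f tzero = 0.
Proof. by rewrite tlift_pi // /tsum big_nil. Qed.

End BalancedLift.

Fact taddA : associative tadd.
Proof. by move=> x y z; apply: tensor_eqP => Z f hf; rewrite !tlift_tadd // addrA. Qed.
Fact taddC : commutative tadd.
Proof. by move=> x y; apply: tensor_eqP => Z f hf; rewrite !tlift_tadd // addrC. Qed.
Fact tadd0 : left_id tzero tadd.
Proof.
by move=> x; apply: tensor_eqP => Z f hf; rewrite tlift_tadd // tlift_tzero ?add0r.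
Qed.
Fact taddN : left_inverse tzero topp tadd.
Proof.
move=> x; apply: tensor_eqP => Z f hf.
by rewrite tlift_tadd // tlift_topp // tlift_tzero // addNr.
Qed.
HB.instance Definition _ := GRing.isZmodule.Build tensor taddA taddC tadd0 taddN.

Lemma tliftE (Z : zmodType) (f : M -> N -> Z) m n :
  balanced f -> tlift f (tens m n) = f m n.
Proof. by move=> hf; rewrite tlift_pi // /tsum big_seq1. Qed.

Lemma tliftD (Z : zmodType) (f : M -> N -> Z) : balanced f ->
  {morph tlift f : x y / x + y}.
Proof. by move=> hf x y; exact: tlift_tadd. Qed.

Lemma tens_balanced : balanced tens.
Proof.
split=> *; apply: tensor_eqP => Z f hf; rewrite ?tliftD // !tliftE //;
  by case: hf.
Qed.

Lemma tensDl m m' n : tens (m + m') n = tens m n + tens m' n.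
Proof. by case: tens_balanced. Qed.
Lemma tensDr m n n' : tens m (n + n') = tens m n + tens m n'.
Proof. by case: tens_balanced. Qed.
Lemma tens_mid m r n : tens (m *> r) n = tens m (r *: n).
Proof. by case: tens_balanced. Qed.

Lemma tensorE (x : tensor) : x = \sum_(p <- repr x) tens p.1 p.2.
Proof.
rewrite -[LHS]reprK; apply: tensor_eqP => Z f hf; rewrite tlift_pi //.
elim: (repr x) => [|p s IH]; first by rewrite /tsum !big_nil tlift_tzero.
by rewrite big_cons tliftD // -IH tliftE // /tsum big_cons.
Qed.

Lemma tensor_ext (Z : zmodType) (f g : tensor -> Z) :
  {morph f : x y / x + y} -> {morph g : x y / x + y} ->
  (forall m n, f (tens m n) = g (tens m n)) -> f =1 g.
Proof.
move=> fD gD fg x; rewrite (tensorE x) !morph_add_sum //.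
by apply: eq_bigr.
Qed.

End Tensor.

Notation "m '⊗' n" := (tens m n) (at level 45, left associativity) : ring_scope.

Definition tmap (R : pzRingType) (M M' : rmodType R) (N N' : lmodType R)
  (f : M -> M') (g : N -> N') : tensor M N -> tensor M' N' :=
  tlift (fun m n => f m ⊗ g n).

Section TensorMap.
Variable R : pzRingType.

Lemma tmap_balanced (M M' : rmodType R) (N N' : lmodType R)
  (f : M -> M') (g : N -> N') :
  {morph f : x y / x + y} -> (forall m r, f (m *> r) = f m *> r) ->
  {morph g : x y / x + y} -> (forall r n, g (r *: n) = r *: g n) ->
  balanced (fun m n => f m ⊗ g n).
Proof.
move=> fD fZ gD gZ; split=> *; first by rewrite fD tensDl.
- by rewrite gD tensDr.
- by rewrite fZ gZ tens_mid.
Qed.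

Lemma linear_tmap_balanced (M M' : rmodType R) (N : lmodType R)
  (f : {linear M -> M'}) : balanced (fun m (n : N) => f m ⊗ n).
Proof.
by apply: (tmap_balanced (g := id)) => // [|m r]; [exact: linearD | exact: linear_ract].
Qed.

Lemma tmap_id (M : rmodType R) (N : lmodType R) (x : tensor M N) :
  tmap id id x = x.
Proof.
apply: (@tensor_ext _ _ _ _ (tmap id id) id) => // [|m n].
  exact: (tliftD (tmap_balanced _ _ _ _)).
by rewrite /tmap tliftE //; exact: tens_balanced.
Qed.

End TensorMap.

(* An R-S-bimodule: a right S-module with a commuting left R-action. *)
Record bimod (R S : pzRingType) := Bimod {
  bimod_right :> rmodType S;
  lact : R -> bimod_right -> bimod_right;
  lactDl : forall r r' u, lact (r + r') u = lact r u + lact r' u;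
  lactDr : forall r u v, lact r (u + v) = lact r u + lact r v;
  lact1 : forall u, lact 1 u = u;
  lactA : forall r r' u, lact (r * r') u = lact r (lact r' u);
  lactC : forall r u s, lact r (u *> s) = lact r u *> s }.

Definition lside_sort (R S : pzRingType) (B : bimod R S) : Type := B.
HB.instance Definition _ (R S : pzRingType) (B : bimod R S) :=
  GRing.Zmodule.on (lside_sort B).
HB.instance Definition _ (R S : pzRingType) (B : bimod R S) :=
  @GRing.Zmodule_isLmodule.Build R (lside_sort B) (@lact R S B)
    (fun r r' u => esym (lactA r r' u)) (@lact1 R S B) (@lactDr R S B)
    (fun u r r' => lactDl r r' u).
Definition lside (R S : pzRingType) (B : bimod R S) : lmodType R := lside_sort B.

Definition bimap (R S : pzRingType) (B B' : bimod R S) (f : B -> B') : Prop :=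
  [/\ {morph f : u v / u + v}, forall r u, f (lact r u) = lact r (f u)
    & forall u s, f (u *> s) = f u *> s].

Definition regr (R : pzRingType) : rmodType R := (R^c)^o.

Definition regb (R : pzRingType) : bimod R R :=
  @Bimod R R (regr R) (fun r u => (r * u : R))
    (@mulrDl R) (@mulrDr R) (@mul1r R) (fun r r' u => esym (@mulrA R r r' u))
    (@mulrA R).

Section TensorRight.
Variables (R S : pzRingType) (M : rmodType R) (B : bimod R S).

Definition tensr_sort : Type := tensor M (lside B).
HB.instance Definition _ := GRing.Zmodule.on tensr_sort.

Definition tensr_act (s : S) (x : tensr_sort) : tensr_sort :=
  tmap id (fun u : lside B => (u : B) *> s : lside B) x.

Fact tensr_act_balanced (s : S) :
  balanced (fun (m : M) (u : lside B) => m ⊗ ((u : B) *> s : lside B)).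
Proof.
apply: (tmap_balanced (f := id)) => // [u v|r u]; first exact: ractDl.
by apply/esym; exact: lactC.
Qed.

Lemma tensr_actE s m (u : lside B) :
  tensr_act s (m ⊗ u) = m ⊗ ((u : B) *> s : lside B).
Proof. exact: (tliftE _ _ (tensr_act_balanced s)). Qed.

Lemma tensr_actD s : {morph tensr_act s : x y / x + y}.
Proof. exact: (tliftD (tensr_act_balanced s)). Qed.

Fact tensr_actA (a b : S^c) x :
  tensr_act a (tensr_act b x) = tensr_act (a * b) x.
Proof.
apply: (@tensor_ext _ _ _ _ (fun x => tensr_act a (tensr_act b x))) => [y z|y z|m u].
- by rewrite !tensr_actD.
- by rewrite tensr_actD.
- by rewrite !tensr_actE ractA.
Qed.
Fact tensr_act1 : left_id (1 : S^c) tensr_act.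
Proof.
apply: (@tensor_ext _ _ _ _ (tensr_act 1) id) => // [|m u].
  exact: tensr_actD.
by rewrite tensr_actE ract1.
Qed.
Fact tensr_actDr : right_distributive (tensr_act : S^c -> _ -> _) +%R.
Proof. exact: tensr_actD. Qed.
Fact tensr_actDl x : {morph (fun s : S^c => tensr_act s x) : a b / a + b}.
Proof.
move=> a b /=.
apply: (@tensor_ext _ _ _ _ _ (fun x => tensr_act a x + tensr_act b x)) => [y z|y z|m u].
- exact: tensr_actD.
- by rewrite !tensr_actD addrACA.
- by rewrite !tensr_actE ractDr tensDr.
Qed.
HB.instance Definition _ :=
  @GRing.Zmodule_isLmodule.Build S^c tensr_sort tensr_act
    tensr_actA tensr_act1 tensr_actDr tensr_actDl.

Definition tensr : rmodType S := tensr_sort.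

Lemma tens_ract m (u : lside B) s :
  (m ⊗ u : tensr) *> s = m ⊗ ((u : B) *> s : lside B).
Proof. exact: tensr_actE. Qed.

End TensorRight.

Section TensorBimodule.
Variables (Q R S : pzRingType) (B : bimod Q R) (B' : bimod R S).

Definition tensb_act (q : Q) (x : tensr B B') : tensr B B' :=
  tmap (lact q) id x.

Fact tensb_act_balanced (q : Q) :
  balanced (fun (u : B) (v : lside B') => lact q u ⊗ v).
Proof.
apply: (tmap_balanced (g := id)) => // [u v|u r]; first exact: lactDr.
exact: lactC.
Qed.

Lemma tensb_actE q (u : B) (v : lside B') :
  tensb_act q (u ⊗ v) = lact q u ⊗ v.
Proof. exact: (tliftE _ _ (tensb_act_balanced q)). Qed.

Lemma tensb_actD q : {morph tensb_act q : x y / x + y}.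
Proof. exact: (tliftD (tensb_act_balanced q)). Qed.

Fact tensb_actDl q q' x :
  tensb_act (q + q') x = tensb_act q x + tensb_act q' x.
Proof.
apply: (@tensor_ext _ _ _ _ _ (fun x => tensb_act q x + tensb_act q' x)) => [y z|y z|m u].
- exact: tensb_actD.
- by rewrite !tensb_actD addrACA.
- by rewrite !tensb_actE lactDl tensDl.
Qed.
Fact tensb_act1 x : tensb_act 1 x = x.
Proof.
apply: (@tensor_ext _ _ _ _ (tensb_act 1) id) => // [|m u].
  exact: tensb_actD.
by rewrite tensb_actE lact1.
Qed.
Fact tensb_actA q q' x : tensb_act (q * q') x = tensb_act q (tensb_act q' x).
Proof.
apply: (@tensor_ext _ _ _ _ _ (fun x => tensb_act q (tensb_act q' x))) => [y z|y z|m u].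
- exact: tensb_actD.
- by rewrite !tensb_actD.
- by rewrite !tensb_actE lactA.
Qed.
Fact tensb_actC q x s : tensb_act q (x *> s) = tensb_act q x *> s.
Proof.
apply: (@tensor_ext _ _ _ _ (fun x : tensr B B' => tensb_act q (x *> s))
  (fun x : tensr B B' => tensb_act q x *> s)) => [y z|y z|m u].
- by rewrite -tensb_actD -ractDl.
- by rewrite -ractDl -tensb_actD.
- by rewrite tens_ract !tensb_actE tens_ract.
Qed.

Definition tensb : bimod Q S :=
  Bimod tensb_actDl tensb_actD tensb_act1 tensb_actA tensb_actC.

Lemma tens_lact q (u : B) (v : lside B') :
  lact q (u ⊗ v : tensb) = (lact q u ⊗ v : tensb).
Proof. exact: tensb_actE. Qed.

End TensorBimodule.

Section TensorMapLemmas.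
Variables R : pzRingType.

Lemma linear_tmapE (M M' : rmodType R) (N : lmodType R) (f : {linear M -> M'})
  m (n : N) : tmap f id (m ⊗ n) = f m ⊗ n.
Proof. exact: (tliftE _ _ (linear_tmap_balanced _ f)). Qed.

Lemma linear_tmapD (M M' : rmodType R) (N : lmodType R) (f : {linear M -> M'}) :
  {morph tmap f (@id N) : x y / x + y}.
Proof. exact: (tliftD (linear_tmap_balanced _ f)). Qed.

Lemma bimap_tmap_balanced (S : pzRingType) (M : rmodType R) (B B' : bimod R S)
  (g : B -> B') : bimap g ->
  balanced (fun (m : M) (u : lside B) => m ⊗ (g u : lside B')).
Proof. by case=> gD gZ _; exact: (tmap_balanced (f := id)). Qed.

Lemma bimap_tmapE (S : pzRingType) (M : rmodType R) (B B' : bimod R S)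
  (g : B -> B') (m : M) (u : lside B) : bimap g ->
  tmap id (g : lside B -> lside B') (m ⊗ u) = m ⊗ (g u : lside B').
Proof. by move=> hg; exact: (tliftE _ _ (bimap_tmap_balanced _ hg)). Qed.

Lemma bimap_tmapD (S : pzRingType) (M : rmodType R) (B B' : bimod R S)
  (g : B -> B') : bimap g ->
  {morph tmap (@id M) (g : lside B -> lside B') : x y / x + y}.
Proof. by move=> hg; exact: (tliftD (bimap_tmap_balanced _ hg)). Qed.

End TensorMapLemmas.

Section TensorLinear.
Variables (R S : pzRingType) (M : rmodType R) (B : bimod R S) (m : M).
Definition tens_at (u : B) : tensr M B := m ⊗ (u : lside B).
Fact tens_at_linear : linear tens_at.
Proof.
move=> s u v; rewrite /tens_at [X in _ ⊗ X](_ : _ = (s *: u : B) + v :> lside B) //.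
by rewrite tensDr -[s *: u]/(u *> s) -tens_ract.
Qed.
HB.instance Definition _ :=
  @GRing.isLinear.Build S^c B (tensr M B) *:%R tens_at tens_at_linear.
End TensorLinear.

(* (M ⊗_R B) ⊗_S N -> M ⊗_R (B ⊗_S N), (m ⊗ b) ⊗ n |-> m ⊗ (b ⊗ n). *)
Section Associator.
Variables (Q R S : pzRingType) (M : rmodType R) (B : bimod R S) (N : bimod S Q).

Definition tassoc : tensr (tensr M B) N -> tensr M (tensb B N) :=
  tlift (fun (x : tensr M B) (n : lside N) =>
    tlift (fun (m : M) (b : lside B) => m ⊗ ((b : B) ⊗ n : lside (tensb B N))) x).

Fact tassoc_balanced_in (n : lside N) :
  balanced (fun (m : M) (b : lside B) => m ⊗ ((b : B) ⊗ n : lside (tensb B N))).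
Proof.
split=> [m m' b|m b b'|m r b]; first exact: tensDl.
- by rewrite -tensDr; congr tens; exact: tensDl.
- by rewrite tens_mid; congr tens; exact: tens_lact.
Qed.

Fact tassoc_balanced : balanced (fun (x : tensr M B) (n : lside N) =>
    tlift (fun (m : M) (b : lside B) => m ⊗ ((b : B) ⊗ n : lside (tensb B N))) x).
Proof.
have bi := tassoc_balanced_in.
split=> [x x' n|x n n'|x s n]; first exact: (tliftD (bi n)).
- apply: (@tensor_ext _ _ _ _ _ (fun x => tlift _ x + tlift _ x)) => [y z|y z|m b].
  + exact: (tliftD (bi _)).
  + by rewrite !(tliftD (bi _)) addrACA.
  + rewrite !(tliftE _ _ (bi _)) -tensDr; congr tens; exact: tensDr.
- apply: (@tensor_ext _ _ _ _ (fun x : tensr M B => tlift _ (x *> s))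
    (fun x => tlift _ x)) => [y z|y z|m b].
  + exact: (etrans (congr1 _ (@ractDl _ (tensr M B) y z s)) (tliftD (bi _) _ _)).
  + exact: (tliftD (bi _)).
  + rewrite tens_ract !(tliftE _ _ (bi _)); congr tens; exact: tens_mid.
Qed.

Lemma tassocE m (b : lside B) (n : lside N) :
  tassoc ((m ⊗ b : tensr M B) ⊗ n) = m ⊗ ((b : B) ⊗ n : lside (tensb B N)).
Proof.
rewrite /tassoc (tliftE _ _ tassoc_balanced).
exact: (tliftE _ _ (tassoc_balanced_in n)).
Qed.

Lemma tassocD : {morph tassoc : x y / x + y}.
Proof. exact: (tliftD tassoc_balanced). Qed.

End Associator.

Record coring (A : pzRingType) := Coring {
  coring_bimod :> bimod A A;
  cop : coring_bimod -> tensb coring_bimod coring_bimod;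
  cou : coring_bimod -> A;
  cop_bimap : bimap cop;
  cou_bimap : bimap (cou : coring_bimod -> regb A);
  cop_assoc : forall c,
    tassoc (tmap cop (@id (lside coring_bimod)) (cop c)) =
    tmap (@id coring_bimod)
      (cop : lside coring_bimod -> lside (tensb coring_bimod coring_bimod)) (cop c);
  cop_counitl : forall c,
    tlift (fun (c1 : coring_bimod) (c2 : lside coring_bimod) =>
             lact (cou c1) (c2 : coring_bimod)) (cop c) = c;
  cop_counitr : forall c,
    tlift (fun (c1 : coring_bimod) (c2 : lside coring_bimod) =>
             c1 *> cou (c2 : coring_bimod)) (cop c) = c }.

Record comod (A : pzRingType) (C : coring A) := Comod {
  comod_mod :> rmodType A;
  coact : {linear comod_mod -> tensr comod_mod C};
  coact_assoc : forall m,
    tassoc (tmap coact (@id (lside C)) (coact m)) =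
    tmap (@id comod_mod) (@cop A C : lside C -> lside (tensb C C)) (coact m);
  coact_counit : forall m,
    tlift (fun (m' : comod_mod) (c : lside C) => m' *> cou (c : C)) (coact m) = m }.

Record comod_hom (A : pzRingType) (C : coring A) (M N : comod C) := ComodHom {
  comod_hom_lin :> {linear M -> N};
  comod_hom_coact : forall m,
    coact N (comod_hom_lin m) = tmap comod_hom_lin (@id (lside C)) (coact M m) }.

(* A right comodule with a left T-action for which both the A-action and the
   coaction are left T-linear. *)
Record tcomod (T A : pzRingType) (C : coring A) := TComod {
  tcomod_comod :> comod C;
  tact : T -> {linear tcomod_comod -> tcomod_comod};
  tactD : forall s t u, tact (s + t) u = tact s u + tact t u;
  tact1 : forall u, tact 1 u = u;
  tactA : forall s t u, tact (s * t) u = tact s (tact t u);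
  tact_coact : forall t u,
    coact tcomod_comod (tact t u) = tmap (tact t) (@id (lside C)) (coact tcomod_comod u) }.

Definition tcomod_bimod (T A : pzRingType) (C : coring A) (S : tcomod T C) :
    bimod T A :=
  @Bimod T A S (fun t u => tact S t u) (@tactD _ _ _ S)
    (fun t => linearD (tact S t)) (@tact1 _ _ _ S) (@tactA _ _ _ S)
    (fun t u a => linear_ract (tact S t) u a).

Record category := Category {
  ob :> Type;
  mor : ob -> ob -> Type;
  idm : forall X, mor X X;
  comp : forall X Y Z, mor Y Z -> mor X Y -> mor X Z;
  comp1m : forall X Y (f : mor X Y), comp (idm Y) f = f;
  compm1 : forall X Y (f : mor X Y), comp f (idm X) = f;
  compA : forall X Y Z W (h : mor Z W) (g : mor Y Z) (f : mor X Y),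
    comp h (comp g f) = comp (comp h g) f }.

Notation "g '∘' f" := (comp g f) (at level 40, left associativity).

Record functor (C D : category) := Functor {
  fob :> C -> D;
  fmor : forall X Y, mor X Y -> mor (fob X) (fob Y);
  fmor1 : forall X, fmor (idm X) = idm (fob X);
  fmorM : forall X Y Z (g : mor Y Z) (f : mor X Y),
    fmor (g ∘ f) = fmor g ∘ fmor f }.

Definition functor_id (C : category) : functor C C :=
  @Functor C C id (fun _ _ f => f) (fun _ => erefl) (fun _ _ _ _ _ => erefl).

Definition functor_comp (C D E : category) (G : functor D E) (F : functor C D) :
    functor C E :=
  @Functor C E (fun X => G (F X)) (fun _ _ f => fmor G (fmor F f))
    (fun X => etrans (congr1 (@fmor _ _ G _ _) (fmor1 F X)) (fmor1 G (F X)))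
    (fun _ _ _ g f => etrans (congr1 (@fmor _ _ G _ _) (fmorM F g f))
                             (fmorM G (fmor F g) (fmor F f))).

Section CategoryNotions.
Variable C : category.

Definition is_iso (X Y : C) (f : mor X Y) : Prop :=
  exists g : mor Y X, g ∘ f = idm X /\ f ∘ g = idm Y.

Definition mono (X Y : C) (f : mor X Y) : Prop :=
  forall Z (g h : mor Z X), f ∘ g = f ∘ h -> g = h.

Definition epi (X Y : C) (f : mor X Y) : Prop :=
  forall Z (g h : mor Y Z), g ∘ f = h ∘ f -> g = h.

Definition projective_object (P : C) : Prop :=
  forall (X Y : C) (p : mor X Y) (f : mor P Y), epi p ->
    exists g : mor P X, p ∘ g = f.

Definition generator (P : C) : Prop :=
  forall (X Y : C) (f g : mor X Y),
    (forall h : mor P X, f ∘ h = g ∘ h) -> f = g.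

(* Inclusion of subobjects of X, given by monomorphisms into X. *)
Definition sub_le (X Y Z : C) (y : mor Y X) (z : mor Z X) : Prop :=
  exists h : mor Y Z, z ∘ h = y.

Definition directed_family (X : C) (I : Type) (Y : I -> C)
    (y : forall i, mor (Y i) X) : Prop :=
  [/\ forall i, mono (y i), inhabited I
    & forall i j, exists k, sub_le (y i) (y k) /\ sub_le (y j) (y k)].

(* The sum of a family of subobjects is the least subobject containing all of
   them; this says that it is X. *)
Definition sum_is_total (X : C) (I : Type) (Y : I -> C)
    (y : forall i, mor (Y i) X) : Prop :=
  forall (Z : C) (z : mor Z X), mono z -> (forall i, sub_le (y i) z) -> is_iso z.

Definition finitely_generated_object (X : C) : Prop :=
  forall (I : Type) (Y : I -> C) (y : forall i, mor (Y i) X),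
    directed_family y -> sum_is_total y -> exists i, is_iso (y i).

End CategoryNotions.

Definition nat_iso (C D : category) (F G : functor C D) : Prop :=
  exists a : forall X, mor (F X) (G X),
    (forall X Y (f : mor X Y), a Y ∘ fmor F f = fmor G f ∘ a X) /\
    (forall X, is_iso (a X)).

Definition inverse_equivalences (C D : category) (F : functor C D)
    (G : functor D C) : Prop :=
  nat_iso (functor_comp G F) (functor_id C) /\
  nat_iso (functor_comp F G) (functor_id D).

Definition lin_id (R : pzRingType) (M : lmodType R) : {linear M -> M} := idfun.
Definition lin_comp (R : pzRingType) (M N P : lmodType R) (g : {linear N -> P})
  (f : {linear M -> N}) : {linear M -> P} := g \o f.

Definition rmod_cat (T : pzRingType) : category :=
  @Category (rmodType T) (fun M N => {linear M -> N}) (@lin_id T^c)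
    (@lin_comp T^c)
    (fun _ _ f => @linear_ext _ _ _ (lin_comp (lin_id _) f) f (frefl _))
    (fun _ _ f => @linear_ext _ _ _ (lin_comp f (lin_id _)) f (frefl _))
    (fun _ _ _ _ h g f =>
       @linear_ext _ _ _ (lin_comp h (lin_comp g f)) (lin_comp (lin_comp h g) f)
         (frefl _)).

Section ComoduleCategory.
Variables (A : pzRingType) (C : coring A).

Lemma comod_hom_ext (M N : comod C) (f g : comod_hom M N) : f =1 g -> f = g.
Proof.
case: f g => f hf [g hg] /= /linear_ext fg; subst g.
by rewrite (Prop_irrelevance hf hg).
Qed.

Fact comod_id_coact (M : comod C) m :
  coact M (lin_id M m) = tmap (lin_id M) (@id (lside C)) (coact M m).
Proof. by rewrite tmap_id. Qed.
Definition comod_id (M : comod C) : comod_hom M M :=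
  ComodHom (@comod_id_coact M).

Lemma linear_tmap_comp (M N P : rmodType A) (L : lmodType A)
  (g : {linear N -> P}) (f : {linear M -> N}) (x : tensor M L) :
  tmap (g \o f) (@id L) x = tmap g id (tmap f id x).
Proof.
apply: (@tensor_ext _ _ _ _ _ (fun x => tmap g id (tmap f id x))) => [y z|y z|m n].
- exact: (@linear_tmapD _ _ _ _ (lin_comp g f)).
- by rewrite !linear_tmapD.
- by rewrite !linear_tmapE.
Qed.

Fact comod_comp_coact (M N P : comod C) (g : comod_hom N P) (f : comod_hom M N) m :
  coact P (lin_comp g f m) = tmap (lin_comp g f) (@id (lside C)) (coact M m).
Proof. by rewrite linear_tmap_comp -!comod_hom_coact. Qed.
Definition comod_comp (M N P : comod C) (g : comod_hom N P) (f : comod_hom M N) :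
  comod_hom M P := ComodHom (comod_comp_coact g f).

Definition comod_cat : category :=
  @Category (comod C) (@comod_hom A C) comod_id comod_comp
    (fun _ _ f => @comod_hom_ext _ _ (comod_comp (comod_id _) f) f (frefl _))
    (fun _ _ f => @comod_hom_ext _ _ (comod_comp f (comod_id _)) f (frefl _))
    (fun _ _ _ _ h g f =>
       @comod_hom_ext _ _ (comod_comp h (comod_comp g f))
         (comod_comp (comod_comp h g) f) (frefl _)).

End ComoduleCategory.

Section RightTensor.
Variables (R S : pzRingType) (M M' : rmodType R) (B : bimod R S).
Variable f : {linear M -> M'}.

Definition rtens (x : tensr M B) : tensr M' B := tmap f (@id (lside B)) x.

Fact rtens_linear : linear rtens.
Proof.
have fD := @linear_tmapD _ _ _ (lside B) f.
move=> a x y; rewrite /rtens fD; congr (_ + _).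
apply: (@tensor_ext _ _ _ _ (fun x : tensr M B => rtens (x *> a))
  (fun x : tensr M B => rtens x *> a)) => [y' z|y' z|m u].
- exact: (etrans (congr1 _ (@ractDl _ (tensr M B) y' z a)) (fD _ _)).
- exact: (etrans (congr1 (fun w : tensr M' B => w *> a) (fD _ _))
    (@ractDl _ (tensr M' B) _ _ a)).
- by rewrite tens_ract /rtens !linear_tmapE tens_ract.
Qed.
HB.instance Definition _ := @GRing.isLinear.Build S^c (tensr M B) (tensr M' B)
  *:%R rtens rtens_linear.

Lemma tassoc_rtens (Q : pzRingType) (N : bimod S Q) (z : tensr (tensr M B) N) :
  tassoc (tmap rtens (@id (lside N)) z) =
  tmap f (@id (lside (tensb B N))) (tassoc z).
Proof.
move: z; apply: tensor_ext => [x y|x y|x n].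
- by rewrite linear_tmapD tassocD.
- by rewrite tassocD linear_tmapD.
- rewrite linear_tmapE; move: x.
  apply: (@tensor_ext _ _ _ _ (fun x : tensr M B => tassoc (rtens x ⊗ n))
    (fun x : tensr M B => tmap _ _ (tassoc (x ⊗ n)))) => [x y|x y|m u].
  + by rewrite linearD tensDl tassocD.
  + by rewrite (@tensDl _ (tensr M B)) tassocD linear_tmapD.
  + by rewrite /rtens linear_tmapE !tassocE linear_tmapE.
Qed.

Lemma tmap_exchange (B' : bimod R S) (g : B -> B') (x : tensr M B) : bimap g ->
  tmap f (@id (lside B')) (tmap (@id M) (g : lside B -> lside B') x) =
  tmap (@id M') (g : lside B -> lside B') (tmap f (@id (lside B)) x).
Proof.
move=> hg; move: x; apply: tensor_ext => [x y|x y|m u].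
- by rewrite bimap_tmapD // linear_tmapD.
- by rewrite linear_tmapD bimap_tmapD.
- by rewrite bimap_tmapE // !linear_tmapE bimap_tmapE.
Qed.

End RightTensor.
Arguments rtens {R S M M'} B f x.

Lemma cou_balanced (A : pzRingType) (C : coring A) (M : rmodType A) :
  balanced (fun (m : M) (c : lside C) => m *> cou (c : C)).
Proof.
have [cD cZ _] := cou_bimap C.
split=> [m m' c|m c c'|m r c]; first exact: ractDl.
- by rewrite (cD c c') ractDr.
- by rewrite (cZ r c) ractA.
Qed.

(* The functor - ⊗_T Sigma from right T-modules to right comodules; the coaction
   on N ⊗_T Sigma is n ⊗ u |-> (n ⊗ u_[0]) ⊗ u_[1]. *)
Section TensorFunctor.
Variables (T A : pzRingType) (C : coring A) (S : tcomod T C).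
Let B := tcomod_bimod S.

Section Object.
Variable N : rmodType T.

Definition tensf_coact (x : tensr N B) : tensr (tensr N B) C :=
  tlift (fun (n : N) (u : lside B) =>
    tmap (tens_at n : B -> tensr N B) (@id (lside C)) (coact S u)) x.

Fact tensf_balanced : balanced (fun (n : N) (u : lside B) =>
  tmap (tens_at n : B -> tensr N B) (@id (lside C)) (coact S u)).
Proof.
have tE (n : N) (v : B) (c : lside C) :
  tmap (tens_at n : B -> tensr N B) (@id (lside C)) (v ⊗ c) =
  (n ⊗ (v : lside B) : tensr N B) ⊗ c.
  exact: (@linear_tmapE _ _ _ _ (@tens_at _ _ N B n)).
have tD (n : N) := @linear_tmapD _ _ _ (lside C) (@tens_at _ _ N B n).
split=> [n n' u|n u u'|n t u].
- apply: (@tensor_ext _ _ _ _ _ (fun y : tensor B _ => tmap _ _ y + tmap _ _ y))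
    => [y z|y z|v c].
  + exact: tD.
  + by rewrite !tD addrACA.
  + rewrite !tE -(@tensDl _ (tensr N B)); congr tens; exact: tensDl.
- by rewrite (linearD (coact S)) tD.
- rewrite -[coact S (t *: u)]/(coact S (tact S t u)) tact_coact.
  apply: (@tensor_ext _ _ _ _ _ (fun y : tensor B _ => tmap _ _ (tmap _ _ y)))
    => [y z|y z|v c].
  + exact: tD.
  + by rewrite linear_tmapD tD.
  + rewrite (linear_tmapE (tact S t)) !tE; congr tens; exact: tens_mid.
Qed.

Lemma tensf_coactE n (u : lside B) :
  tensf_coact (n ⊗ u) =
  tmap (tens_at n : B -> tensr N B) (@id (lside C)) (coact S u).
Proof. exact: (tliftE _ _ tensf_balanced). Qed.

Fact tensf_coact_linear : linear tensf_coact.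
Proof.
have cD := tliftD tensf_balanced.
move=> a x y; rewrite /tensf_coact cD; congr (_ + _).
apply: (@tensor_ext _ _ _ _ (fun x : tensr N B => tensf_coact (x *> a))
  (fun x : tensr N B => tensf_coact x *> a)) => [y' z|y' z|n u].
- exact: (etrans (congr1 _ (@ractDl _ (tensr N B) y' z a)) (cD _ _)).
- exact: (etrans (congr1 (fun w : tensr (tensr N B) C => w *> a) (cD _ _))
    (@ractDl _ (tensr (tensr N B) C) _ _ a)).
- rewrite tens_ract !tensf_coactE (linear_ract (coact S)).
  apply: (@tensor_ext _ _ _ _ (fun y : tensr S C => tmap _ _ (y *> a))
    (fun y : tensr S C => (tmap _ _ y : tensr (tensr N B) C) *> a))
    => [w z|w z|v c].
  + rewrite -(@linear_tmapD _ _ _ (lside C) (@tens_at _ _ N B n)).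
    by congr tmap; exact: (@ractDl _ (tensr S C)).
  + rewrite -(@ractDl _ (tensr (tensr N B) C)).
    exact: (congr1 (fun w : tensr (tensr N B) C => w *> a)
      (@linear_tmapD _ _ _ (lside C) (@tens_at _ _ N B n) w z)).
  + rewrite tens_ract !(@linear_tmapE _ _ _ (lside C) (@tens_at _ _ N B n)).
    by rewrite tens_ract.
Qed.
HB.instance Definition _ := @GRing.isLinear.Build A^c (tensr N B)
  (tensr (tensr N B) C) *:%R tensf_coact tensf_coact_linear.

Fact tensf_coact_assoc x :
  tassoc (tmap tensf_coact (@id (lside C)) (tensf_coact x)) =
  tmap (@id (tensr N B)) (@cop A C : lside C -> lside (tensb C C)) (tensf_coact x).
Proof.
have hd := cop_bimap C.
move: x; apply: (@tensor_ext _ _ _ _ (fun x : tensr N B => tassoc (tmap _ _ (tensf_coact x)))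
  (fun x : tensr N B => tmap _ _ (tensf_coact x))) => [x y|x y|n u].
- by rewrite (linearD tensf_coact) linear_tmapD tassocD.
- by rewrite (linearD tensf_coact) bimap_tmapD.
rewrite tensf_coactE -tmap_exchange // -coact_assoc -tassoc_rtens; congr tassoc.
move: (coact S u); apply: (@tensor_ext A S (lside C) _
  (fun x => tmap _ _ (tmap _ _ x)) (fun x => tmap _ _ (tmap _ _ x)))
  => [x y|x y|v c].
- by rewrite (linear_tmapD (tens_at (B := B) n)) (linear_tmapD tensf_coact).
- by rewrite !linear_tmapD.
- rewrite (linear_tmapE (coact S)) (linear_tmapE (tens_at (B := B) n)).
  rewrite (linear_tmapE tensf_coact) linear_tmapE; congr tens; exact: tensf_coactE.
Qed.

Fact tensf_coact_counit x :
  tlift (fun (x' : tensr N B) (c : lside C) => x' *> cou (c : C)) (tensf_coact x) = x.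
Proof.
have hc (M : rmodType A) := cou_balanced C M.
move: x; apply: (@tensor_ext _ _ _ _ (fun x : tensr N B => tlift _ (tensf_coact x))
  id) => [x y|//|n u].
  by rewrite (linearD tensf_coact) tliftD.
rewrite tensf_coactE -[in RHS](coact_counit (u : S)).
move: (coact S u); apply: (@tensor_ext A S (lside C) _
  (fun x => tlift _ (tmap _ _ x)) (fun x => n ⊗ (tlift _ x : lside B)))
  => [x y|x y|v c].
- by rewrite (linear_tmapD (tens_at (B := B) n)) tliftD.
- by rewrite tliftD // -tensDr.
- by rewrite (linear_tmapE (tens_at (B := B) n)) !tliftE // tens_ract.
Qed.

Definition tensf_ob : comod C := Comod tensf_coact_assoc tensf_coact_counit.

End Object.

Fact tensf_mor_coact (N N' : rmodType T) (f : {linear N -> N'}) x :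
  tensf_coact (rtens B f x) = tmap (rtens B f) (@id (lside C)) (tensf_coact x).
Proof.
move: x; apply: (@tensor_ext _ _ _ _ (fun x : tensr N B => tensf_coact (rtens B f x))
  (fun x : tensr N B => tmap _ _ (tensf_coact x))) => [x y|x y|n u].
- by rewrite (linearD (rtens B f)) (linearD (@tensf_coact N')).
- by rewrite (linearD (@tensf_coact N)) linear_tmapD.
rewrite /rtens linear_tmapE !tensf_coactE.
move: (coact S u); apply: (@tensor_ext A S (lside C) _
  (fun x => tmap _ _ x) (fun x => tmap _ _ (tmap _ _ x))) => [x y|x y|v c].
- exact: (linear_tmapD (tens_at (B := B) (f n))).
- by rewrite (linear_tmapD (tens_at (B := B) n)) (linear_tmapD (rtens B f)).
- rewrite !(linear_tmapE (tens_at (B := B) _)) (linear_tmapE (rtens B f)).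
  congr tens; apply: esym; exact: linear_tmapE.
Qed.

Definition tensf_mor (N N' : rmodType T) (f : {linear N -> N'}) :
    comod_hom (tensf_ob N) (tensf_ob N') :=
  @ComodHom A C (tensf_ob N) (tensf_ob N') (rtens B f) (tensf_mor_coact f).

Fact tensf_mor1 N : tensf_mor (lin_id N) = comod_id (tensf_ob N).
Proof. by apply: comod_hom_ext => x; exact: tmap_id. Qed.

Fact tensf_morM (N N' N'' : rmodType T) (g : {linear N' -> N''})
  (f : {linear N -> N'}) :
  tensf_mor (lin_comp g f) = comod_comp (tensf_mor g) (tensf_mor f).
Proof. by apply: comod_hom_ext => x; exact: linear_tmap_comp. Qed.

Definition tensor_functor : functor (rmod_cat T) (comod_cat C) :=
  @Functor (rmod_cat T) (comod_cat C) tensf_ob tensf_mor tensf_mor1 tensf_morM.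

End TensorFunctor.

Section ComodHomGroup.
Variables (A : pzRingType) (C : coring A) (M N : comod C).
Implicit Types f g : comod_hom M N.

HB.instance Definition _ := gen_eqMixin (comod_hom M N).
HB.instance Definition _ := gen_choiceMixin (comod_hom M N).

Fact comod_hom_add_coact f g m :
  coact N ((f \+ g) m) = tmap (f \+ g) (@id (lside C)) (coact M m).
Proof.
rewrite linearD !comod_hom_coact; move: (coact M m); apply/fsym.
apply: (@tensor_ext _ _ (lside C) _ _ (fun x => tmap f _ x + tmap g _ x))
  => [x y|x y|v c].
- exact: linear_tmapD.
- by rewrite !linear_tmapD addrACA.
- by rewrite !linear_tmapE; exact: (@tensDl A N).
Qed.
Fact comod_hom_opp_coact f m :
  coact N ((\- f) m) = tmap (\- f) (@id (lside C)) (coact M m).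
Proof.
rewrite linearN comod_hom_coact; move: (coact M m); apply/fsym.
apply: (@tensor_ext _ _ (lside C) _ _ (fun x => - tmap f _ x))
  => [x y|x y|v c].
- exact: linear_tmapD.
- by rewrite !linear_tmapD opprD.
- rewrite !linear_tmapE; apply/eqP; rewrite -addr_eq0.
  rewrite -(@tensDl A N _ (- f v)) addNr; apply/eqP.
  by apply: (addrI (0 ⊗ c)); rewrite -(@tensDl A N) !addr0.
Qed.
Fact comod_hom_zero_coact m :
  coact N (\0 m : N) = tmap (\0 : M -> N) (@id (lside C)) (coact M m).
Proof.
rewrite linear0; move: (coact M m); apply/fsym.
apply: (@tensor_ext _ _ (lside C) _ _ (fun x => 0)) => [x y|x y|v c].
- exact: (linear_tmapD (\0 : {linear M -> N})).
- by rewrite addr0.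
- rewrite (linear_tmapE (\0 : {linear M -> N})).
  by apply: (addrI (0 ⊗ c)); rewrite -(@tensDl A N) !addr0.
Qed.

Definition comod_hom_add f g : comod_hom M N :=
  @ComodHom A C M N (f \+ g) (comod_hom_add_coact f g).
Definition comod_hom_opp f : comod_hom M N :=
  @ComodHom A C M N (\- f) (comod_hom_opp_coact f).
Definition comod_hom_zero : comod_hom M N :=
  @ComodHom A C M N (\0) comod_hom_zero_coact.

Fact comod_hom_addA : associative comod_hom_add.
Proof. by move=> f g h; apply: comod_hom_ext => m /=; rewrite addrA. Qed.
Fact comod_hom_addC : commutative comod_hom_add.
Proof. by move=> f g; apply: comod_hom_ext => m /=; rewrite addrC. Qed.
Fact comod_hom_add0 : left_id comod_hom_zero comod_hom_add.
Proof. by move=> f; apply: comod_hom_ext => m /=; rewrite add0r. Qed.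
Fact comod_hom_addN : left_inverse comod_hom_zero comod_hom_opp comod_hom_add.
Proof. by move=> f; apply: comod_hom_ext => m /=; rewrite addNr. Qed.

HB.instance Definition _ := GRing.isZmodule.Build (comod_hom M N)
  comod_hom_addA comod_hom_addC comod_hom_add0 comod_hom_addN.

Lemma comod_hom_addE f g m : (f + g) m = f m + g m.
Proof. by []. Qed.

End ComodHomGroup.

Section ComodEnd.
Variables (A : pzRingType) (C : coring A) (M : comod C).

Definition comod_end : Type := comod_hom M M.
HB.instance Definition _ := GRing.Zmodule.on comod_end.

Fact comod_end_mulA : associative (@comod_comp A C M M M).
Proof. by move=> f g h; exact: comod_hom_ext. Qed.
Fact comod_end_mul1l : left_id (comod_id M) (@comod_comp A C M M M).
Proof. by move=> f; exact: comod_hom_ext. Qed.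
Fact comod_end_mul1r : right_id (comod_id M) (@comod_comp A C M M M).
Proof. by move=> f; exact: comod_hom_ext. Qed.
Fact comod_end_mulDl :
  left_distributive (@comod_comp A C M M M) (+%R : comod_end -> _ -> _).
Proof. by move=> f g h; exact: comod_hom_ext. Qed.
Fact comod_end_mulDr :
  right_distributive (@comod_comp A C M M M) (+%R : comod_end -> _ -> _).
Proof. by move=> f g h; apply: comod_hom_ext => m; exact: linearD. Qed.

HB.instance Definition _ := GRing.Zmodule_isPzRing.Build comod_end
  comod_end_mulA comod_end_mul1l comod_end_mul1r comod_end_mulDl comod_end_mulDr.

End ComodEnd.

Section TAction.
Variables (T A : pzRingType) (C : coring A) (S : tcomod T C).

Definition tcomod_j (t : T) : comod_end S := 
  ComodHom (@tact_coact T A C S t).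

Fact tcomod_j_is_additive : zmod_morphism tcomod_j.
Proof.
move=> s t; apply: comod_hom_ext => u /=; apply: (addIr (tact S t u)).
by rewrite -tactD !subrK.
Qed.
Fact tcomod_j_is_monoid : monoid_morphism tcomod_j.
Proof.
by split=> [|s t]; apply: comod_hom_ext => u; [exact: tact1 | exact: tactA].
Qed.
HB.instance Definition _ :=
  GRing.isZmodMorphism.Build T (comod_end S) tcomod_j tcomod_j_is_additive.
HB.instance Definition _ :=
  GRing.isMonoidMorphism.Build T (comod_end S) tcomod_j tcomod_j_is_monoid.

(* The functor Hom^C(Sigma, -); T acts on the right by (h t)(u) = h (t u). *)
Section Object.
Variable N : comod C.

Definition homf_sort : Type := comod_hom S N.
HB.instance Definition _ := GRing.Zmodule.on homf_sort.

Definition homf_act (t : T) (h : homf_sort) : homf_sort :=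
  comod_comp h (tcomod_j t).

Fact homf_actA (s t : T^c) h : homf_act s (homf_act t h) = homf_act (s * t) h.
Proof. by apply: comod_hom_ext => u; congr (h _); apply/esym; exact: tactA. Qed.
Fact homf_act1 : left_id (1 : T^c) homf_act.
Proof. by move=> h; apply: comod_hom_ext => u; congr (h _); exact: tact1. Qed.
Fact homf_actDr : right_distributive (homf_act : T^c -> _ -> _) +%R.
Proof. by move=> t g h; exact: comod_hom_ext. Qed.
Fact homf_actDl h : {morph (fun t : T^c => homf_act t h) : s t / s + t}.
Proof.
by move=> s t; apply: comod_hom_ext => u /=; rewrite -linearD; congr (h _); exact: tactD.
Qed.
HB.instance Definition _ := @GRing.Zmodule_isLmodule.Build T^c homf_sort homf_act
  homf_actA homf_act1 homf_actDr homf_actDl.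

Definition homf_ob : rmodType T := homf_sort.

End Object.

Definition homf_fun (N N' : comod C) (f : comod_hom N N') (h : homf_ob N) :
  homf_ob N' := comod_comp f h.

Fact homf_fun_linear (N N' : comod C) (f : comod_hom N N') : linear (homf_fun f).
Proof. by move=> t g h; apply: comod_hom_ext => u; exact: linearD. Qed.
HB.instance Definition _ (N N' : comod C) (f : comod_hom N N') :=
  @GRing.isLinear.Build T^c (homf_ob N) (homf_ob N') *:%R (homf_fun f)
    (homf_fun_linear f).

Definition homf_mor (N N' : comod C) (f : comod_hom N N') :
  {linear homf_ob N -> homf_ob N'} := homf_fun f.

Fact homf_mor1 (N : comod C) : homf_mor (comod_id N) = lin_id (homf_ob N).
Proof. by apply: linear_ext => h; exact: comod_hom_ext. Qed.
Fact homf_morM (N N' N'' : comod C) (g : comod_hom N' N'') (f : comod_hom N N') :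
  homf_mor (comod_comp g f) = lin_comp (homf_mor g) (homf_mor f).
Proof. by apply: linear_ext => h; exact: comod_hom_ext. Qed.

Definition hom_functor : functor (comod_cat C) (rmod_cat T) :=
  @Functor (comod_cat C) (rmod_cat T) homf_ob homf_mor homf_mor1 homf_morM.

End TAction.

Lemma inverse_equivalences_jointly_epi (C D : category) (F : functor C D)
  (G : functor D C) (I : Type) (P : C) (X : I -> C) (u : forall i, mor (X i) P) :
  inverse_equivalences F G ->
  (forall W (k k' : mor P W), (forall i, k ∘ u i = k' ∘ u i) -> k = k') ->
  forall Y (k k' : mor (F P) Y),
    (forall i, k ∘ fmor F (u i) = k' ∘ fmor F (u i)) -> k = k'.
Proof.
move=> [[a [a_nat a_iso]] [b [b_nat b_iso]]] u_epi Y k k' kk'.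
have cancel_iso (E : category) (U V W : E) (f : mor U V) (g g' : mor V W) :
    is_iso f -> g ∘ f = g' ∘ f -> g = g'.
  by case=> f' [_ ff'] gg'; rewrite -[g]compm1 -[g']compm1 -ff' !compA gg'.
suff Gkk' : fmor G k = fmor G k'.
  apply: (cancel_iso _ _ _ _ (b (F P))) => //.
  by rewrite -[k ∘ _]b_nat -[k' ∘ _]b_nat /= Gkk'.
have [a' [a'a aa']] := a_iso P.
rewrite -[fmor G k]compm1 -[fmor G k']compm1 -a'a !compA; congr (_ ∘ _).
apply: u_epi => i; apply: (cancel_iso _ _ _ _ (a (X i))) => //.
have e : a' ∘ (u i ∘ a (X i)) = fmor G (fmor F (u i)).
  by rewrite -[u i ∘ _]a_nat compA a'a comp1m.
rewrite -!compA e.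
by apply: (etrans (esym (fmorM G _ _))); rewrite kk' -(fmorM G).
Qed.

Section LeftMultiplication.
Variables (T : pzRingType) (t : T).
Definition lmul_fun (x : regr T) : regr T := (t * x : T).
Fact lmul_linear : linear lmul_fun.
Proof.
move=> a x y; apply: (etrans (@mulrDr T _ _ _)); congr (_ + _).
exact: (@mulrA T).
Qed.
HB.instance Definition _ :=
  @GRing.isLinear.Build T^c (regr T) (regr T) *:%R lmul_fun lmul_linear.
Definition lmul : {linear regr T -> regr T} := lmul_fun.
End LeftMultiplication.

Section EquivalenceImage.
Variables (T A : pzRingType) (C : coring A).
Variables (F : functor (rmod_cat T) (comod_cat C)).
Variables (G : functor (comod_cat C) (rmod_cat T)).
Hypothesis FG : inverse_equivalences F G.

Let Fm (M N : rmodType T) (f : {linear M -> N}) : comod_hom (F M) (F N) :=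
  @fmor _ _ F M N f.

Let FmM (M N P : rmodType T) (g : {linear N -> P}) (f : {linear M -> N}) :
  Fm (lin_comp g f) = comod_comp (Fm g) (Fm f).
Proof. exact: (fmorM F). Qed.

Let Fm0 (M N : rmodType T) : Fm (\0 : {linear M -> N}) = 0.
Proof.
pose Z : rmodType T := 'rV[T^c]_0.
have Z0 : Fm (\0 : {linear Z -> N}) = 0.
  apply: (@inverse_equivalences_jointly_epi (rmod_cat T) (comod_cat C) F G void Z
    (fun _ => Z) (fun i => match i with end) FG) => [W k k' _|[]].
  by apply: linear_ext => z; rewrite [z]thinmx0 !linear0.
have -> : (\0 : {linear M -> N}) =
    lin_comp (\0 : {linear Z -> N}) (\0 : {linear M -> Z}).
  exact: linear_ext.
by rewrite FmM Z0; exact: comod_hom_ext.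
Qed.

Lemma equivalence_additive (M N : rmodType T) (f g : {linear M -> N}) :
  Fm (f \+ g) = Fm f + Fm g.
Proof.
pose P : rmodType T := (M * M)%type.
have i1L : linear ((fun m => (m, 0)) : M -> P).
  by move=> a m m'; apply: injective_projections => //=; rewrite scaler0 addr0.
have i2L : linear ((fun m => (0, m)) : M -> P).
  by move=> a m m'; apply: injective_projections => //=; rewrite scaler0 addr0.
have p1L : linear (fst : P -> M) by [].
have p2L : linear (snd : P -> M) by [].
have dL : linear ((fun m => (m, m)) : M -> P) by [].
have hL : linear ((fun x => f x.1 + g x.2) : P -> N).
  by move=> a x y /=; rewrite !linearP scalerDr addrACA.
pose i1 := linear_of i1L; pose i2 := linear_of i2L; pose p1 := linear_of p1L.
pose p2 := linear_of p2L; pose d := linear_of dL; pose h := linear_of hL.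
have FE (U V W : rmodType T) (k : {linear V -> W}) (l : {linear U -> V}) x :
  Fm k (Fm l x) = Fm (lin_comp k l) x by rewrite FmM.
have F1 (U : rmodType T) x : Fm (lin_id U) x = x.
  by rewrite /Fm -[lin_id U]/(@idm (rmod_cat T) U) (fmor1 F).
have sE x : (comod_comp (Fm i1) (Fm p1) + comod_comp (Fm i2) (Fm p2)) x =
    Fm i1 (Fm p1 x) + Fm i2 (Fm p2 x) by [].
have split1 : Fm (lin_comp i1 p1) + Fm (lin_comp i2 p2) = Fm (lin_id P).
  apply: (@inverse_equivalences_jointly_epi (rmod_cat T) (comod_cat C) F G bool P
    (fun _ => M) (fun b => if b then i1 else i2) FG) => [W k k' kk'|].
    apply: linear_ext => -[x y].
    have -> : (x, y) = i1 x + i2 y :> P.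
      by apply: injective_projections; rewrite /= ?addr0 ?add0r.
    rewrite !linearD; congr (_ + _).
      by have := congr1 (fun l : {linear M -> W} => l x) (kk' true).
    by have := congr1 (fun l : {linear M -> W} => l y) (kk' false).
  have c12 x : Fm p1 (Fm i2 x) = 0.
    by rewrite FE (_ : lin_comp p1 i2 = \0) ?Fm0 //; exact: linear_ext.
  have c21 x : Fm p2 (Fm i1 x) = 0.
    by rewrite FE (_ : lin_comp p2 i1 = \0) ?Fm0 //; exact: linear_ext.
  have c11 x : Fm p1 (Fm i1 x) = x.
    by rewrite FE (_ : lin_comp p1 i1 = lin_id M) ?F1 //; exact: linear_ext.
  have c22 x : Fm p2 (Fm i2 x) = x.
    by rewrite FE (_ : lin_comp p2 i2 = lin_id M) ?F1 //; exact: linear_ext.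
  case; apply: comod_hom_ext => x; rewrite !FmM [RHS]F1.
    by apply: (etrans (sE (Fm i1 x))); rewrite c11 c21 linear0 addr0.
  by apply: (etrans (sE (Fm i2 x))); rewrite c12 c22 linear0 add0r.
have -> : Fm (f \+ g) = comod_comp (Fm h) (comod_comp (Fm (lin_id P)) (Fm d)).
  apply: comod_hom_ext => x /=; rewrite F1 FE.
  by congr (Fm _ x); exact: linear_ext.
rewrite -split1 !FmM; apply: comod_hom_ext => x.
apply: (etrans (congr1 (Fm h) (sE (Fm d x)))); rewrite linearD !FE.
congr (_ + _); congr (Fm _ x); apply: linear_ext => m /=.
  by rewrite linear0 addr0.
by rewrite linear0 add0r.
Qed.

(* F(T), with the left T-action t u = F(lambda_t)(u) where lambda_t is the left
   multiplication by t on T. *)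
Definition equivalence_image_act (t : T) : comod_hom (F (regr T)) (F (regr T)) :=
  @fmor _ _ F (regr T) (regr T) (lmul t).

Fact equivalence_image_actD s t u :
  equivalence_image_act (s + t) u =
  equivalence_image_act s u + equivalence_image_act t u.
Proof.
rewrite /equivalence_image_act.
have -> : lmul (s + t) = lmul s \+ lmul t.
  by apply: linear_ext => x; exact: (@mulrDl T).
exact: (congr1 (fun f : comod_hom _ _ => f u) (equivalence_additive _ _)).
Qed.
Fact equivalence_image_act1 u : equivalence_image_act 1 u = u.
Proof.
rewrite /equivalence_image_act.
have -> : lmul 1 = @idm (rmod_cat T) (regr T).
  by apply: linear_ext => x; exact: (@mul1r T).
by rewrite (fmor1 F).
Qed.
Fact equivalence_image_actA s t u :
  equivalence_image_act (s * t) u =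
  equivalence_image_act s (equivalence_image_act t u).
Proof.
rewrite /equivalence_image_act.
have -> : lmul (s * t) = @comp (rmod_cat T) _ _ _ (lmul s) (lmul t).
  by apply: linear_ext => x; apply/esym; exact: (@mulrA T).
by rewrite (fmorM F).
Qed.

Definition equivalence_image : tcomod T C :=
  @TComod T A C (F (regr T)) equivalence_image_act equivalence_image_actD
    equivalence_image_act1 equivalence_image_actA
    (fun t u => comod_hom_coact (equivalence_image_act t) u).

End EquivalenceImage.

(* Sigma^* = Hom_A(Sigma, A), with (a f)(u) = a f(u) and (f t)(u) = f(t u). *)
Section Dual.
Variables (T A : pzRingType) (B : bimod T A).

Definition dual_sort : Type := {linear B -> regr A}.
Implicit Types f g : dual_sort.
HB.instance Definition _ := gen_eqMixin dual_sort.
HB.instance Definition _ := gen_choiceMixin dual_sort.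

Definition dual_fun f : B -> A := (f : {linear B -> regr A}).

Lemma dual_ext f g : dual_fun f =1 dual_fun g -> f = g.
Proof. exact: (@linear_ext A^c B (regr A) f g). Qed.

Definition dual_add f g : dual_sort :=
  (f : {linear B -> regr A}) \+ (g : {linear B -> regr A}).
Definition dual_opp f : dual_sort := \- (f : {linear B -> regr A}).
Definition dual_zero : dual_sort := \0 : {linear B -> regr A}.

Fact dual_addA : associative dual_add.
Proof. by move=> f g h; apply: dual_ext => u; exact: (@addrA A). Qed.
Fact dual_addC : commutative dual_add.
Proof. by move=> f g; apply: dual_ext => u; exact: (@addrC A). Qed.
Fact dual_add0 : left_id dual_zero dual_add.
Proof. by move=> f; apply: dual_ext => u; exact: (@add0r A). Qed.
Fact dual_addN : left_inverse dual_zero dual_opp dual_add.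
Proof. by move=> f; apply: dual_ext => u; exact: (@addNr A). Qed.
HB.instance Definition _ := GRing.isZmodule.Build dual_sort
  dual_addA dual_addC dual_add0 dual_addN.

Definition dual_ract_fun (t : T) f (u : B) : regr A := dual_fun f (lact t u).
Fact dual_ract_linear t f : linear (dual_ract_fun t f).
Proof.
move=> a u v; rewrite /dual_ract_fun lactDr -[a *: u]/(u *> a) lactC.
exact: (linearP (f : {linear B -> regr A})).
Qed.
HB.instance Definition _ t f := @GRing.isLinear.Build A^c B (regr A) *:%R
  (dual_ract_fun t f) (dual_ract_linear t f).
Definition dual_ract (t : T) f : dual_sort :=
  (dual_ract_fun t f : {linear B -> regr A}).

Fact dual_ractA (s t : T^c) f : dual_ract s (dual_ract t f) = dual_ract (s * t) f.
Proof. by apply: dual_ext => u; congr (f _); apply/esym; exact: lactA. Qed.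
Fact dual_ract1 : left_id (1 : T^c) dual_ract.
Proof. by move=> f; apply: dual_ext => u; congr (f _); exact: lact1. Qed.
Fact dual_ractDr : right_distributive (dual_ract : T^c -> _ -> _) +%R.
Proof. by move=> t f g; exact: dual_ext. Qed.
Fact dual_ractDl f : {morph (fun t : T^c => dual_ract t f) : s t / s + t}.
Proof.
move=> s t; apply: dual_ext => u.
transitivity (dual_fun f (lact (s : T) u + lact (t : T) u)).
  congr (dual_fun f _); exact: (@lactDl T A B).
exact: (linearD (f : {linear B -> regr A})).
Qed.
HB.instance Definition _ := @GRing.Zmodule_isLmodule.Build T^c dual_sort dual_ract
  dual_ractA dual_ract1 dual_ractDr dual_ractDl.

Definition dual_lact_fun (a : A) f (u : B) : regr A := a * dual_fun f u.
Fact dual_lact_linear a f : linear (dual_lact_fun a f).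
Proof.
move=> b u v; rewrite /dual_lact_fun /dual_fun.
rewrite (linearP (f : {linear B -> regr A})).
apply: (etrans (@mulrDr A _ _ _)); congr (_ + _); exact: (@mulrA A).
Qed.
HB.instance Definition _ a f := @GRing.isLinear.Build A^c B (regr A) *:%R
  (dual_lact_fun a f) (dual_lact_linear a f).
Definition dual_lact (a : A) f : dual_sort :=
  (dual_lact_fun a f : {linear B -> regr A}).

Fact dual_lactDl a b f : dual_lact (a + b) f = dual_lact a f + dual_lact b f.
Proof. by apply: dual_ext => u; exact: (@mulrDl A). Qed.
Fact dual_lactDr a f g : dual_lact a (f + g) = dual_lact a f + dual_lact a g.
Proof. by apply: dual_ext => u; exact: (@mulrDr A). Qed.
Fact dual_lact1 f : dual_lact 1 f = f.
Proof. by apply: dual_ext => u; exact: (@mul1r A). Qed.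
Fact dual_lactA a b f : dual_lact (a * b) f = dual_lact a (dual_lact b f).
Proof. by apply: dual_ext => u; apply/esym; exact: (@mulrA A). Qed.
Fact dual_lactC a f t : dual_lact a (t *: f : dual_sort) = t *: dual_lact a f.
Proof. exact: dual_ext. Qed.

Definition dual : bimod A T :=
  @Bimod A T (dual_sort : rmodType T) dual_lact dual_lactDl dual_lactDr dual_lact1
    dual_lactA (fun a f t => dual_lactC a f t).

End Dual.

Record comatrix_context (T A : pzRingType) (S : bimod T A) (S' : bimod A T) :=
  ComatrixContext {
    cc_eta : T -> tensb S S';
    cc_eps : tensb S' S -> A;
    cc_eta_bimap : bimap (cc_eta : regb T -> tensb S S');
    cc_eps_bimap : bimap (cc_eps : tensb S' S -> regb A);
    cc_triangle : forall u : S,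
      tlift (fun (e : S) (f : lside S') =>
               e *> cc_eps ((f : S') ⊗ (u : lside S))) (cc_eta 1) = u;
    cc_triangle' : forall phi : S',
      tlift (fun (e : S) (f : lside S') =>
               lact (cc_eps (phi ⊗ (e : lside S))) (f : S')) (cc_eta 1) = phi }.

Lemma tens_suml (R : pzRingType) (M : rmodType R) (N : lmodType R) (I : Type)
  (s : seq I) (F : I -> M) (n : N) :
  (\sum_(i <- s) F i) ⊗ n = \sum_(i <- s) (F i ⊗ n).
Proof. by apply: (morph_add_sum (f := fun m => m ⊗ n)) => x y; exact: tensDl. Qed.

Lemma tens_sumr (R : pzRingType) (M : rmodType R) (N : lmodType R) (I : Type)
  (s : seq I) (F : I -> N) (m : M) :
  m ⊗ (\sum_(i <- s) F i) = \sum_(i <- s) (m ⊗ F i).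
Proof. by apply: (morph_add_sum (f := tens m)) => x y; exact: tensDr. Qed.

Section ComatrixCoring.
Variables (T A : pzRingType) (S : bimod T A) (S' : bimod A T).
Variable ctx : comatrix_context S S'.

Let P : bimod A A := tensb S' S.

Let ins (phi : S') (u : lside S) (z : tensor S (lside S')) : tensb P P :=
  tlift (fun (e : S) (f : lside S') =>
    (phi ⊗ (e : lside S) : P) ⊗ ((f : S') ⊗ u : lside P)) z.

(* phi ⊗ u |-> (phi ⊗ e) ⊗ (f ⊗ u), where e ⊗ f = eta(1). *)
Definition comatrix_cop (x : P) : tensb P P :=
  tlift (fun (phi : S') (u : lside S) => ins phi u (cc_eta ctx 1)) x.

Let ins_balanced (phi : S') (u : lside S) :
  balanced (fun (e : S) (f : lside S') =>
    (phi ⊗ (e : lside S) : P) ⊗ ((f : S') ⊗ u : lside P)).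
Proof.
split=> [e e' f|e f f'|e a f].
- rewrite -(@tensDl _ P); congr tens; exact: tensDr.
- rewrite -tensDr; congr tens; exact: tensDl.
- have -> : phi ⊗ (e *> a : lside S) = (phi ⊗ (e : lside S) : P) *> a :> P.
    by apply/esym; exact: tens_ract.
  rewrite tens_mid; congr tens; exact: tens_lact.
Qed.

Let insE phi u e f :
  ins phi u (e ⊗ f) = (phi ⊗ (e : lside S) : P) ⊗ ((f : S') ⊗ u : lside P).
Proof. exact: (tliftE _ _ (ins_balanced phi u)). Qed.
Let insD phi u : {morph ins phi u : x y / x + y}.
Proof. exact: (tliftD (ins_balanced phi u)). Qed.

Let eta_central t :
  lact t (cc_eta ctx 1) = cc_eta ctx 1 *> t :> tensb S S'.
Proof.
have [_ hl hr] := cc_eta_bimap ctx.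
rewrite -[LHS]hl -[RHS]hr; congr (cc_eta ctx _).
by apply: (etrans (mulr1 t)); exact: esym (mul1r t).
Qed.

Let cop_balanced :
  balanced (fun (phi : S') (u : lside S) => ins phi u (cc_eta ctx 1)).
Proof.
split=> [phi phi' u|phi u u'|phi t u].
- move: (cc_eta ctx 1).
  apply: (@tensor_ext _ _ _ _ _ (fun z => ins phi u z + ins phi' u z))
    => [y z|y z|e f].
  + exact: insD.
  + by rewrite !insD addrACA.
  + rewrite !insE -(@tensDl _ P); congr tens; exact: tensDl.
- move: (cc_eta ctx 1).
  apply: (@tensor_ext _ _ _ _ _ (fun z => ins phi u z + ins phi u' z))
    => [y z|y z|e f].
  + exact: insD.
  + by rewrite !insD addrACA.
  + rewrite !insE -tensDr; congr tens; exact: tensDr.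
- transitivity (ins phi u (lact t (cc_eta ctx 1))).
    move: (cc_eta ctx 1).
    apply: (@tensor_ext _ _ _ _ _ (fun z : tensb S S' => ins phi u (lact t z)))
      => [y z|y z|e f].
    + exact: insD.
    + by rewrite -insD; congr ins; exact: (@lactDr _ _ (tensb S S')).
    + by rewrite tens_lact !insE tens_mid.
  rewrite eta_central; move: (cc_eta ctx 1).
  apply: (@tensor_ext _ _ _ _ (fun z : tensb S S' => ins phi u (z *> t)))
    => [y z|y z|e f].
  + by rewrite -insD; congr ins; exact: (@ractDl _ (tensb S S')).
  + exact: insD.
  + by rewrite tens_ract !insE tens_mid.
Qed.

Let copE phi u : comatrix_cop (phi ⊗ u) = ins phi u (cc_eta ctx 1).
Proof. exact: (tliftE _ _ cop_balanced). Qed.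
Let copD : {morph comatrix_cop : x y / x + y}.
Proof. exact: (tliftD cop_balanced). Qed.

Fact comatrix_cop_bimap : bimap comatrix_cop.
Proof.
split=> [|a x|x a]; first exact: copD.
- move: x; apply: (@tensor_ext _ _ _ _ (fun x : P => comatrix_cop (lact a x))
    (fun x : P => lact a (comatrix_cop x))) => [x y|x y|phi u].
  + by rewrite -copD; congr comatrix_cop; exact: (@lactDr _ _ P).
  + by rewrite copD; exact: (@lactDr _ _ (tensb P P)).
  rewrite tens_lact !copE; move: (cc_eta ctx 1).
  apply: (@tensor_ext _ _ _ _ _ (fun z => lact a (ins phi u z)))
    => [x y|x y|e f]; first exact: insD.
  + by rewrite insD; exact: (@lactDr _ _ (tensb P P)).
  + by rewrite !insE tens_lact; congr tens; apply/esym; exact: tens_lact.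
- move: x; apply: (@tensor_ext _ _ _ _ (fun x : P => comatrix_cop (x *> a))
    (fun x : P => comatrix_cop x *> a)) => [x y|x y|phi u].
  + by rewrite -copD; congr comatrix_cop; exact: (@ractDl _ P).
  + by rewrite copD; exact: (@ractDl _ (tensb P P)).
  rewrite tens_ract !copE; move: (cc_eta ctx 1).
  apply: (@tensor_ext _ _ _ _ _ (fun z => ins phi u z *> a))
    => [x y|x y|e f]; first exact: insD.
  + by rewrite insD; exact: (@ractDl _ (tensb P P)).
  + by rewrite !insE tens_ract; congr tens; apply/esym; exact: tens_ract.
Qed.

Let s := repr (cc_eta ctx 1).

Let copS (phi : S') (u : lside S) : comatrix_cop (phi ⊗ u) =
  \sum_(p <- s) ((phi ⊗ (p.1 : lside S) : P) ⊗ ((p.2 : S') ⊗ u : lside P)).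
Proof. exact: copE. Qed.

Fact comatrix_cop_assoc x :
  tassoc (tmap comatrix_cop (@id (lside P)) (comatrix_cop x)) =
  tmap (@id P) (comatrix_cop : lside P -> lside (tensb P P)) (comatrix_cop x).
Proof.
have cb := comatrix_cop_bimap.
have cl : balanced (fun (m : P) (n : lside P) => comatrix_cop m ⊗ n).
  by apply: (tmap_balanced (g := id)) => //; case: cb.
have tD : {morph tmap comatrix_cop (@id (lside P)) : x y / x + y}.
  exact: tliftD.
move: x; apply: (@tensor_ext _ _ _ _ (fun x : P => tassoc (tmap _ _ (comatrix_cop x)))
  (fun x : P => tmap _ _ (comatrix_cop x))) => [x y|x y|phi u].
- by rewrite copD tD tassocD.
- by rewrite copD bimap_tmapD.
rewrite copS (morph_add_sum _ _ tD) (morph_add_sum _ _ (@tassocD _ _ _ _ _ _)).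
rewrite (morph_add_sum _ _ (bimap_tmapD cb)).
transitivity (\sum_(p <- s) \sum_(q <- s)
  ((phi ⊗ (q.1 : lside S) : P) ⊗
    (((q.2 : S') ⊗ (p.1 : lside S) : P) ⊗ ((p.2 : S') ⊗ u : lside P)
       : lside (tensb P P)))).
  apply: eq_bigr => p _; rewrite /tmap tliftE // copS.
  rewrite (@tens_suml _ (tensb P P)) (morph_add_sum _ _ (@tassocD _ _ _ _ _ _)).
  by apply: eq_bigr => q _; rewrite tassocE.
rewrite exchange_big; apply: eq_bigr => q _ /=.
rewrite bimap_tmapE // -tens_sumr; congr tens; exact/esym/copS.
Qed.

Let epsD : {morph cc_eps ctx : x y / x + y}.
Proof. by case: (cc_eps_bimap ctx). Qed.

Fact comatrix_counitl x :
  tlift (fun (x1 : P) (x2 : lside P) => lact (cc_eps ctx x1) (x2 : P))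
    (comatrix_cop x) = x.
Proof.
have [_ epsl epsr] := cc_eps_bimap ctx.
have cb : balanced (fun (x1 : P) (x2 : lside P) => lact (cc_eps ctx x1) (x2 : P)).
  split=> [y y' z|y z z'|y a z].
  - by rewrite epsD lactDl.
  - exact: (@lactDr _ _ P).
  - by rewrite (epsr y a) (@lactA _ _ P).
move: x; apply: (@tensor_ext _ _ _ _ (fun x : P => tlift _ (comatrix_cop x)) id)
  => [x y|//|phi u]; first by rewrite copD tliftD.
rewrite -[in RHS](cc_triangle' ctx phi) copS (morph_add_sum _ _ (tliftD cb)).
rewrite [in RHS]/tlift /tsum tens_suml; apply: eq_bigr => p _.
by rewrite tliftE // tens_lact.
Qed.

Fact comatrix_counitr x :
  tlift (fun (x1 : P) (x2 : lside P) => x1 *> cc_eps ctx (x2 : P))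
    (comatrix_cop x) = x.
Proof.
have [_ epsl epsr] := cc_eps_bimap ctx.
have cb : balanced (fun (x1 : P) (x2 : lside P) => x1 *> cc_eps ctx (x2 : P)).
  split=> [y y' z|y z z'|y a z].
  - exact: ractDl.
  - by rewrite (epsD z z') ractDr.
  - by rewrite (epsl a z) ractA.
move: x; apply: (@tensor_ext _ _ _ _ (fun x : P => tlift _ (comatrix_cop x)) id)
  => [x y|//|phi u]; first by rewrite copD tliftD.
rewrite -[in RHS](cc_triangle ctx u) copS (morph_add_sum _ _ (tliftD cb)).
rewrite [in RHS]/tlift /tsum tens_sumr; apply: eq_bigr => p _.
by rewrite tliftE // tens_ract.
Qed.

Definition comatrix_coring : coring A :=
  @Coring A P comatrix_cop (cc_eps ctx) comatrix_cop_bimap (cc_eps_bimap ctx)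
    comatrix_cop_assoc comatrix_counitl comatrix_counitr.

End ComatrixCoring.

Lemma tassoc_linear (Q R S : pzRingType) (M : rmodType R) (B : bimod R S)
  (N : bimod S Q) : linear (@tassoc Q R S M B N).
Proof.
move=> a x y; rewrite tassocD; congr (_ + _); move: x.
apply: (@tensor_ext _ _ _ _
  (fun x : tensr (tensr M B) N => tassoc (x *> a))
  (fun x : tensr (tensr M B) N => tassoc x *> a)) => [x z|x z|x n].
- rewrite -tassocD; congr tassoc; exact: (@ractDl _ (tensr (tensr M B) N)).
- rewrite tassocD; exact: (@ractDl _ (tensr M (tensb B N))).
rewrite tens_ract; move: x.
apply: (@tensor_ext _ _ _ _
  (fun x : tensr M B => tassoc (x ⊗ ((n : N) *> a : lside N)))
  (fun x : tensr M B => tassoc (x ⊗ n) *> a))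
  => [x z|x z|m b].
- by rewrite (@tensDl _ (tensr M B)) tassocD.
- rewrite (@tensDl _ (tensr M B)) tassocD.
  exact: (@ractDl _ (tensr M (tensb B N))).
- by rewrite !tassocE tens_ract; congr tens; apply/esym; exact: tens_ract.
Qed.

Lemma bimap_tmap_linear (R S : pzRingType) (M : rmodType R) (B B' : bimod R S)
  (g : B -> B') : bimap g ->
  linear (tmap (@id M) (g : lside B -> lside B') : tensr M B -> tensr M B').
Proof.
move=> hg a x y; rewrite bimap_tmapD //; congr (_ + _); move: x.
apply: (@tensor_ext _ _ _ _ (fun x : tensr M B => tmap _ _ (x *> a))
  (fun x : tensr M B => (tmap (@id M) (g : lside B -> lside B') x : tensr M B') *> a))
  => [x z|x z|m b].
- rewrite -bimap_tmapD //; congr tmap; exact: (@ractDl _ (tensr M B)).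
- rewrite bimap_tmapD //; exact: (@ractDl _ (tensr M B')).
- rewrite tens_ract !bimap_tmapE // tens_ract; congr tens.
  by case: hg.
Qed.

(* The axioms of a left coaction on an A-T-bimodule; bilinearity says that the
   coaction is a map of left A-modules and of right T-modules. *)
Definition is_left_coaction (T A : pzRingType) (C : coring A) (L : bimod A T)
    (l : L -> tensb C L) : Prop :=
  [/\ bimap l,
      forall x, tassoc (tmap (@cop A C) (@id (lside L)) (l x)) =
                tmap (@id C) (l : lside L -> lside (tensb C L)) (l x)
    & forall x, tlift (fun (c : C) (y : lside L) => lact (cou c) (y : L)) (l x) = x].

(* Left comodules with a right T-action that commutes with the A-action and for
   which the coaction is right T-linear. *)
Record lcomod (T A : pzRingType) (C : coring A) := LComod {
  lcomod_bimod :> bimod A T;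
  lcoact : lcomod_bimod -> tensb C lcomod_bimod;
  lcoactP : is_left_coaction lcoact }.

Section Cotensor.
Variables (T A : pzRingType) (C : coring A) (L : lcomod T C).

Section Object.
Variable N : comod C.

Definition cotensor_pred : {pred tensr N L} := fun x =>
  `[< tassoc (tmap (coact N) (@id (lside L)) x) =
      tmap (@id N) (@lcoact _ _ _ L : lside L -> lside (tensb C L)) x >].

Fact cotensor_submod_closed : subsemimod_closed cotensor_pred.
Proof.
have [hl _ _] := lcoactP L.
pose f : {linear tensr N L -> tensr N (tensb C L)} :=
  lin_comp (linear_of (@tassoc_linear _ _ _ N C L)) (rtens L (coact N)).
pose g : {linear tensr N L -> tensr N (tensb C L)} :=
  linear_of (bimap_tmap_linear (M := N) hl).
split; [split=> [|x y /asboolP hx /asboolP hy]|move=> a x /asboolP hx];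
  apply/asboolP.
- exact: (etrans (linear0 f) (esym (linear0 g))).
- apply: (etrans (linearD f x y)); apply/esym.
  by apply: (etrans (linearD g x y)); congr (_ + _).
- apply: (etrans (linearZ_LR f a x)); apply/esym.
  by apply: (etrans (linearZ_LR g a x)); congr (_ *: _).
Qed.
HB.instance Definition _ := GRing.isSubmodClosed.Build T^c (tensr N L)
  cotensor_pred cotensor_submod_closed.

Record cotensor_sort : Type := Cotensor {
  cotensor_val :> tensr N L;
  _ : cotensor_val \in cotensor_pred }.
HB.instance Definition _ := [isSub for cotensor_val].
HB.instance Definition _ := [Choice of cotensor_sort by <:].
HB.instance Definition _ := [SubChoice_isSubLmodule of cotensor_sort by <:].

Definition cotensor_ob : rmodType T := cotensor_sort.

End Object.

Fact cotensor_fun_subproof (N N' : comod C) (f : comod_hom N N')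
  (x : cotensor_ob N) : rtens L f (cotensor_val x) \in @cotensor_pred N'.
Proof.
have [hl _ _] := lcoactP L; case: x => x /= /asboolP hx; apply/asboolP.
rewrite /rtens -tmap_exchange // -hx -tassoc_rtens -!linear_tmap_comp.
congr (tassoc (tmap _ _ x)); apply: funext => m; exact: comod_hom_coact.
Qed.

Definition cotensor_fun (N N' : comod C) (f : comod_hom N N')
  (x : cotensor_ob N) : cotensor_ob N' := Cotensor (cotensor_fun_subproof f x).

Fact cotensor_fun_linear (N N' : comod C) (f : comod_hom N N') :
  linear (cotensor_fun f).
Proof. by move=> a x y; apply: val_inj; exact: (linearP (rtens L f)). Qed.
HB.instance Definition _ (N N' : comod C) (f : comod_hom N N') :=
  @GRing.isLinear.Build T^c (cotensor_ob N) (cotensor_ob N') *:%R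
    (cotensor_fun f) (cotensor_fun_linear f).

Definition cotensor_mor (N N' : comod C) (f : comod_hom N N') :
  {linear cotensor_ob N -> cotensor_ob N'} := cotensor_fun f.

Fact cotensor_mor1 (N : comod C) :
  cotensor_mor (comod_id N) = lin_id (cotensor_ob N).
Proof. by apply: linear_ext => x; apply: val_inj; exact: tmap_id. Qed.
Fact cotensor_morM (N N' N'' : comod C) (g : comod_hom N' N'')
  (f : comod_hom N N') :
  cotensor_mor (comod_comp g f) = lin_comp (cotensor_mor g) (cotensor_mor f).
Proof.
by apply: linear_ext => x; apply: val_inj; exact: linear_tmap_comp.
Qed.

Definition cotensor_functor : functor (comod_cat C) (rmod_cat T) :=
  @Functor (comod_cat C) (rmod_cat T) cotensor_ob cotensor_mor cotensor_mor1
    cotensor_morM.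

End Cotensor.

Section ModuleProperties.
Variable R : pzRingType.

Definition finitely_generated (M : rmodType R) : Prop :=
  exists (n : nat) (x : 'I_n -> M),
    forall m, exists a : 'I_n -> R, m = \sum_(i < n) x i *> a i.

Definition projective (M : rmodType R) : Prop :=
  forall (N P : rmodType R) (p : {linear N -> P}) (f : {linear M -> P}),
    (forall y, exists x, p x = y) ->
    exists g : {linear M -> N}, forall m, p (g m) = f m.

Definition exact_at (U V W : zmodType) (f : U -> V) (g : V -> W) : Prop :=
  forall y, g y = 0 <-> exists x, f x = y.

Definition flat (N : lmodType R) : Prop :=
  forall (M1 M2 M3 : rmodType R) (f : {linear M1 -> M2}) (g : {linear M2 -> M3}),
    exact_at f g -> exact_at (tmap f (@id N)) (tmap g (@id N)).

Definition faithfully_flat (N : lmodType R) : Prop :=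
  flat N /\
  forall (M1 M2 : rmodType R) (f g : {linear M1 -> M2}),
    tmap f (@id N) =1 tmap g (@id N) -> f =1 g.

End ModuleProperties.

Definition coring_iso (A : pzRingType) (C D : coring A) (chi : C -> D) : Prop :=
  [/\ bimap chi, bijective chi,
      forall c, cop (chi c) = tmap chi (chi : lside C -> lside D) (cop c)
    & forall c, cou (chi c) = cou c].

Section GaloisData.
Variables (T A : pzRingType) (C : coring A) (S : tcomod T C).
Let B := tcomod_bimod S.
Variable ctx : comatrix_context B (dual B).

(* C is isomorphic to the comatrix coring Sigma^* ⊗_T Sigma, the right coaction
   of C on Sigma being, through this isomorphism, the canonical coaction
   u |-> e ⊗ (f ⊗ u) of the comatrix coring, where e ⊗ f = sigma(1). A bare
   isomorphism of corings would leave the given coaction on Sigma unconstrained: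
   for A = k, T = k * k and Sigma = k^2, the coring Sigma^* ⊗_T Sigma is spanned
   by two grouplikes, and u |-> u ⊗ g for one of them is a T-linear coaction
   whose colinear endomorphisms are all of M_2(k). *)
Definition comatrix_presentation : Prop :=
  exists chi : comatrix_coring ctx -> C,
    coring_iso chi /\
    forall u : S, coact S u =
      tlift (fun (e : B) (f : lside (dual B)) =>
               (e : S) ⊗ (chi ((f : dual B) ⊗ (u : lside B)) : lside C))
        (cc_eta ctx 1).

(* phi |-> phi(e_[0]) e_[1] ⊗ f, where e ⊗ f = sigma(1). *)
Definition dual_coaction (phi : dual B) : tensb C (dual B) :=
  tlift (fun (e : B) (f : lside (dual B)) =>
           tlift (fun (u : S) (c : lside C) => lact (dual_fun phi u) (c : C))
             (coact S e) ⊗ f)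
    (cc_eta ctx 1).

End GaloisData.

(* Main.v *)
(* Let unit_M : M -> Hom^C(S, M ⊗_T S) and counit_N : Hom^C(S, N) ⊗_T S -> N be
   the unit and counit of the adjunction defined by a comodule S with a left
   T-action. Everything goes through the condition that all of them are
   bijective.

   For an equivalence F, G with S = F(T), the map m ⊗ u |-> F(t |-> m t)(u) from
   M ⊗_T S to F(M) is an isomorphism because, by full faithfulness, both sides
   corepresent the same functor; hence F and G are isomorphic to - ⊗_T S and
   Hom^C(S, -), and all units and counits are bijective.

   If they are bijective, then applying this to the comodule S ⊗_A C shows that
   the coaction of S is a finite sum of maps u |-> n ⊗ f(u) with f : S -> C
   colinear; composing with the counit of C gives a finite dual basis of S over
   A. The counit at C, transported along S^* = Hom^C(S, C), is the isomorphism
   S^* ⊗_T S -> C, phi ⊗ u |-> phi(u_[0]) u_[1].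

   Conversely, Hom^C(S, N) is the equalizer of two maps from N ⊗_A S^* to
   (N ⊗_A C) ⊗_A S^*; since S is flat over T and S^* ⊗_T S is isomorphic to C,
   tensoring with S turns it into the equalizer of the coaction and the
   comultiplication, which is N. So the counits are bijective, and then so are
   the units because S is faithfully flat. *)
From HB Require Import structures.
From mathcomp Require Import all_boot all_algebra boolp.
Require Import Defs.
Set Implicit Arguments.
Unset Strict Implicit.
Unset Printing Implicit Defensive.
Import GRing.Theory.
Local Open Scope ring_scope.
Local Open Scope quotient_scope.

(** * Submodules and quotient modules *)

Record submodule (R : pzRingType) (P : lmodType R) := Submodule {
  submod_mem :> P -> Prop;
  submod_mem0 : submod_mem 0;
  submod_memD : forall x y, submod_mem x -> submod_mem y -> submod_mem (x + y);
  submod_memZ : forall a x, submod_mem x -> submod_mem (a *: x) }.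

Section Submodule.
Variables (R : pzRingType) (P : lmodType R) (U : submodule P).

Definition submod_pred : {pred P} := fun x => `[< U x >].

Fact submod_pred_zmod_closed : zmod_closed submod_pred.
Proof.
split=> [|x y /asboolP hx /asboolP hy]; apply/asboolP; first exact: submod_mem0.
by apply: submod_memD => //; rewrite -scaleN1r; exact: submod_memZ.
Qed.
Fact submod_pred_submod_closed : subsemimod_closed submod_pred.
Proof.
split; [split=> [|x y /asboolP hx /asboolP hy]|move=> a x /asboolP hx];
  apply/asboolP; [exact: submod_mem0|exact: submod_memD|exact: submod_memZ].
Qed.
HB.instance Definition _ := GRing.isZmodClosed.Build P submod_pred
  submod_pred_zmod_closed.
HB.instance Definition _ := GRing.isSubmodClosed.Build R P submod_pred
  submod_pred_submod_closed.

Record submod_sort : Type := SubmodSort {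
  submod_val :> P;
  _ : submod_val \in submod_pred }.
HB.instance Definition _ := [isSub for submod_val].
HB.instance Definition _ := [Choice of submod_sort by <:].
HB.instance Definition _ := [SubChoice_isSubLmodule of submod_sort by <:].

Definition submod_type : lmodType R := submod_sort.
Definition submod_incl : {linear submod_type -> P} := (val : submod_sort -> P).

Lemma submod_incl_inj : injective submod_incl.
Proof. exact: val_inj. Qed.
Lemma submod_inclP (x : submod_type) : U (submod_incl x).
Proof. by case: x => x /= /asboolP. Qed.
Lemma submod_inclE x : U x -> exists y : submod_type, submod_incl y = x.
Proof. by move=> /asboolP hx; exists (SubmodSort hx). Qed.

Definition submod_quot_sort : Type := Quotient.quot submod_pred.
HB.instance Definition _ := GRing.Zmodule.on submod_quot_sort.
Definition submod_pi (x : P) : submod_quot_sort :=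
  \pi_(Quotient.quot submod_pred) x.

Lemma submod_piD : {morph submod_pi : x y / x + y}.
Proof. by move=> x y; rewrite /submod_pi Quotient.pi_add. Qed.

Lemma submod_pi0 : submod_pi 0 = 0.
Proof. by apply: (addrI (submod_pi 0)); rewrite -submod_piD !addr0. Qed.

Lemma submod_pi_eq0 x : submod_pi x = 0 <-> U x.
Proof.
rewrite -submod_pi0 /submod_pi; split=> [/eqP|hx].
  by rewrite -Quotient.idealrBE subr0 => /asboolP.
by apply/eqP; rewrite -Quotient.idealrBE subr0; apply/asboolP.
Qed.

Lemma submod_piB x y : U (x - y) -> submod_pi x = submod_pi y.
Proof. by move=> h; apply/eqP; rewrite -Quotient.idealrBE; apply/asboolP. Qed.

Definition submod_quot_scale (a : R) (x : submod_quot_sort) : submod_quot_sort :=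
  submod_pi (a *: repr x).

(** The chosen representative differs from [x] by an element of [U], and [U] is stable under
    scaling. *)
Lemma submod_piZ a x : submod_quot_scale a (submod_pi x) = submod_pi (a *: x).
Proof.
apply: submod_piB; rewrite -scalerBr; apply: submod_memZ; apply/submod_pi_eq0.
have piN y : submod_pi (- y) = - submod_pi y.
  by apply/eqP; rewrite -addr_eq0 -submod_piD addNr submod_pi0.
by rewrite submod_piD piN /submod_pi reprK subrr.
Qed.

Lemma submod_quot_ind (K : submod_quot_sort -> Prop) :
  (forall x, K (submod_pi x)) -> forall y, K y.
Proof. by move=> h y; rewrite -[y]reprK; exact: h. Qed.

Fact submod_quot_scaleA a b x :
  submod_quot_scale a (submod_quot_scale b x) = submod_quot_scale (a * b) x.
Proof. by elim/submod_quot_ind: x => x; rewrite !submod_piZ scalerA. Qed.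
Fact submod_quot_scale1 : left_id 1 submod_quot_scale.
Proof. by elim/submod_quot_ind => x; rewrite submod_piZ scale1r. Qed.
Fact submod_quot_scaleDr : right_distributive submod_quot_scale +%R.
Proof.
move=> a; elim/submod_quot_ind => x; elim/submod_quot_ind => y.
by rewrite -submod_piD !submod_piZ scalerDr submod_piD.
Qed.
Fact submod_quot_scaleDl x : {morph submod_quot_scale^~ x : a b / a + b}.
Proof.
move=> a b; elim/submod_quot_ind: x => x.
by rewrite !submod_piZ scalerDl submod_piD.
Qed.
HB.instance Definition _ := @GRing.Zmodule_isLmodule.Build R submod_quot_sort
  submod_quot_scale submod_quot_scaleA submod_quot_scale1 submod_quot_scaleDr
  submod_quot_scaleDl.
Definition submod_quot : lmodType R := submod_quot_sort.

Fact submod_pi_linear : linear (submod_pi : P -> submod_quot).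
Proof. by move=> a x y; rewrite submod_piD -submod_piZ. Qed.

(** The projection onto the quotient by [U] kills [U], hence is zero, while its kernel is [U]. *)
Lemma submod_full : (forall (Q : lmodType R) (q : {linear P -> Q}),
    (forall x, U x -> q x = 0) -> forall x, q x = 0) -> forall x, U x.
Proof.
move=> h x; apply/submod_pi_eq0.
by apply: (h submod_quot (linear_of submod_pi_linear)) => y /submod_pi_eq0.
Qed.

End Submodule.

(** * Images, kernels and a test for surjectivity *)

Section LinearImage.
Variables (R : pzRingType) (M N : lmodType R) (f : {linear M -> N}).

Definition image_submod : submodule N.
Proof.
apply: (@Submodule R N (fun y => exists x, f x = y)).
- by exists 0; exact: linear0.
- by move=> _ _ [x <-] [y <-]; exists (x + y); exact: linearD.
- by move=> a _ [x <-]; exists (a *: x); exact: linearZ.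
Defined.

Definition kernel_submod : submodule M.
Proof.
apply: (@Submodule R M (fun x => f x = 0)).
- exact: linear0.
- by move=> x y hx hy; rewrite linearD hx hy addr0.
- by move=> a x hx; rewrite linearZ hx /= scaler0.
Defined.

(** The previous test, applied to the image of [f]. It is meant for maps into T-modules of colinear
    maps, where a test map [q] can be tensored with S. *)
Lemma epi_surjective : (forall (Q : lmodType R) (q : {linear N -> Q}),
    (forall x, q (f x) = 0) -> forall y, q y = 0) ->
  forall y, exists x, f x = y.
Proof.
move=> h; apply: (submod_full (U := image_submod)) => Q q hq; apply: h => x.
by apply: hq; exists x.
Qed.

End LinearImage.

Lemma bij_of_inj_surj (X Y : Type) (f : X -> Y) :
  injective f -> (forall y, exists x, f x = y) -> bijective f.
Proof.
move=> fI /choice[g fg]; exists g => // x; apply: fI; exact: fg.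
Qed.

Lemma bij_surj (X Y : Type) (f : X -> Y) y : bijective f -> exists x, f x = y.
Proof. by case=> g _ gK; exists (g y). Qed.

Section TensorExtra.
Variables (R : pzRingType) (M : rmodType R) (N : lmodType R).

Lemma tensor_ind (P : tensor M N -> Prop) : P 0 ->
  (forall x y, P x -> P y -> P (x + y)) -> (forall m n, P (m ⊗ n)) ->
  forall x, P x.
Proof. by move=> P0 PD Pt x; rewrite (tensorE x); apply: big_ind => // p _. Qed.

Lemma tens0l (n : N) : (0 : M) ⊗ n = 0.
Proof. by apply: (addrI ((0 : M) ⊗ n)); rewrite -tensDl !addr0. Qed.

End TensorExtra.

Lemma morph_add0 (V W : zmodType) (f : V -> W) :
  {morph f : x y / x + y} -> f 0 = 0.
Proof. by move=> fD; apply: (addrI (f 0)); rewrite -fD !addr0. Qed.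

(** * The adjunction between tensoring and colinear maps *)

Lemma tlift_linear (R S : pzRingType) (M : rmodType R) (B : bimod R S)
  (W : rmodType S) (f : M -> lside B -> W) : balanced f ->
  (forall m (u : B) s, f m (u *> s) = f m u *> s) ->
  linear (tlift f : tensr M B -> W).
Proof.
move=> fb fS a x y; rewrite tliftD //; congr (_ + _).
apply: (@tensor_ext _ _ _ _ (fun x : tensr M B => tlift f (x *> a))
  (fun x : tensr M B => tlift f x *> a)) => [z w|z w|m u].
- by rewrite (@ractDl _ (tensr M B)) tliftD.
- by rewrite tliftD // ractDl.
- by rewrite tens_ract !tliftE // fS.
Qed.

Section AssociatorInverse.
Variables (Q R S : pzRingType) (M : rmodType R) (B : bimod R S) (N : bimod S Q).

Definition tassoc_inv : tensr M (tensb B N) -> tensr (tensr M B) N :=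
  tlift (fun (m : M) (y : lside (tensb B N)) =>
    tmap (tens_at (B := B) m) (@id (lside N)) y).

Fact tassoc_inv_balanced : balanced (fun (m : M) (y : lside (tensb B N)) =>
    tmap (tens_at (B := B) m) (@id (lside N)) y : tensr (tensr M B) N).
Proof.
have tD m := @linear_tmapD _ _ _ (lside N) (tens_at (B := B) m).
have tE m := @linear_tmapE _ _ _ (lside N) (tens_at (B := B) m).
split=> [m m' y|m y y'|m r y].
- move: y; apply: (@tensor_ext _ _ _ _ _ (fun y => tmap _ _ y + tmap _ _ y))
    => [y z|y z|b n]; [exact: tD|by rewrite !tD addrACA|].
  by rewrite !tE -(@tensDl _ (tensr M B)); congr tens; exact: tensDl.
- exact: tD.
- move: y; apply: (@tensor_ext _ _ _ _ _
    (fun y : tensb B N => tmap _ _ (lact r y))) => [y z|y z|b n]; first exact: tD.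
    by rewrite lactDr tD.
  by rewrite tens_lact !tE; congr tens; exact: tens_mid.
Qed.

Lemma tassoc_invE m (b : lside B) (n : lside N) :
  tassoc_inv (m ⊗ ((b : B) ⊗ n : lside (tensb B N))) = (m ⊗ b : tensr M B) ⊗ n.
Proof.
apply: (etrans (tliftE _ _ tassoc_inv_balanced)).
exact: (linear_tmapE (tens_at (B := B) m)).
Qed.

Lemma tassoc_invD : {morph tassoc_inv : x y / x + y}.
Proof. exact: (tliftD tassoc_inv_balanced). Qed.

Lemma tassocK : cancel (@tassoc Q R S M B N) tassoc_inv.
Proof.
apply: (@tensor_ext _ _ _ _ (fun x => tassoc_inv (tassoc x)) id) => [x y|//|x n].
  by rewrite tassocD tassoc_invD.
move: x => /=.
apply: (@tensor_ext _ _ _ _ (fun x : tensr M B => tassoc_inv (tassoc (x ⊗ n)))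
  (fun x : tensr M B => x ⊗ n : tensr (tensr M B) N)) => [x y|x y|m b].
- by rewrite (@tensDl _ (tensr M B)) tassocD tassoc_invD.
- exact: (@tensDl _ (tensr M B)).
- by rewrite tassocE tassoc_invE.
Qed.

Lemma tassoc_invK : cancel tassoc_inv (@tassoc Q R S M B N).
Proof.
apply: (@tensor_ext _ _ _ _ (fun x => tassoc (tassoc_inv x)) id) => [x y|//|m y].
  by rewrite tassoc_invD tassocD.
move: y => /=.
apply: (@tensor_ext _ _ _ _
  (fun y : tensb B N => tassoc (tassoc_inv (m ⊗ (y : lside (tensb B N)))))
  (fun y : tensb B N => m ⊗ (y : lside (tensb B N)) : tensr M (tensb B N)))
  => [x y|x y|b n].
- by rewrite tensDr tassoc_invD tassocD.
- exact: tensDr.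
- by rewrite tassoc_invE tassocE.
Qed.

Lemma tassoc_bij : bijective (@tassoc Q R S M B N).
Proof. exact: (Bijective tassocK tassoc_invK). Qed.

End AssociatorInverse.

Lemma comod_hom_inv (A : pzRingType) (C : coring A) (M N : comod C)
  (f : comod_hom M N) : bijective f ->
  exists g : comod_hom N M, cancel f g /\ cancel g f.
Proof.
case=> g fK gK.
have gL : linear (g : N -> M).
  by move=> a x y; apply: (can_inj fK); rewrite gK linearP !gK.
have gC n : coact M (linear_of gL n) = tmap (linear_of gL) (@id (lside C)) (coact N n).
  rewrite -{2}[n]gK comod_hom_coact -linear_tmap_comp -[LHS]tmap_id.
  by congr (tmap _ _ _); apply: funext => x /=; rewrite fK.
by exists (ComodHom gC).
Qed.

Lemma comod_is_iso (A : pzRingType) (C : coring A) (M N : comod C)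
  (f : comod_hom M N) : bijective f -> @is_iso (comod_cat C) M N f.
Proof.
by case/comod_hom_inv=> g [fK gK]; exists g; split; apply: comod_hom_ext.
Qed.

Lemma rmod_is_iso (T : pzRingType) (M N : rmodType T)
  (f : {linear M -> N}) : bijective f -> @is_iso (rmod_cat T) M N f.
Proof.
case=> g fK gK.
have gL : linear (g : N -> M).
  by move=> a x y; apply: (can_inj fK); rewrite gK linearP !gK.
by exists (linear_of gL); split; apply: linear_ext.
Qed.

(** * Unit and counit of the adjunction *)

Section UnitCounit.
Variables (T A : pzRingType) (C : coring A) (S : tcomod T C).
Let B := tcomod_bimod S.

Definition tens_hom (M : rmodType T) (m : M) : comod_hom S (tensf_ob S M) :=
  @ComodHom A C S (tensf_ob S M) (tens_at m : {linear B -> tensr M B})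
    (tensf_coactE (S := S) m).

Definition unit_fun (M : rmodType T) : M -> homf_ob S (tensf_ob S M) := @tens_hom M.

Fact unit_linear (M : rmodType T) : linear (@unit_fun M).
Proof.
move=> t m m'; apply: comod_hom_ext => u; apply: (etrans (tensDl _ _ _)).
by congr (_ + _); exact: tens_mid.
Qed.
Definition unit_map (M : rmodType T) : {linear M -> homf_ob S (tensf_ob S M)} :=
  linear_of (@unit_linear M).

Lemma unit_mapE (M : rmodType T) (m : M) (u : S) :
  (unit_map M m : comod_hom _ _) u = m ⊗ (u : lside B).
Proof. by []. Qed.

Variable N : comod C.
Let H := homf_ob S N.

Fact counit_balanced :
  balanced (fun (h : H) (u : lside B) => (h : comod_hom S N) u).
Proof. by split=> // h u v; exact: (linearD (h : comod_hom S N)). Qed.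

Fact counit_linear : linear (tlift (fun (h : H) (u : lside B) =>
  (h : comod_hom S N) u) : tensr H B -> N).
Proof.
apply: (tlift_linear counit_balanced) => h u s;
  exact: (linear_ract (h : comod_hom S N)).
Qed.
Let counit_lin : {linear tensr H B -> N} := linear_of counit_linear.

Let counit_linE h (u : lside B) : counit_lin (h ⊗ u) = (h : comod_hom S N) u.
Proof. exact: (tliftE _ _ counit_balanced). Qed.

Fact counit_coact (x : tensf_ob S H) :
  coact N (counit_lin x) = tmap counit_lin (@id (lside C)) (coact (tensf_ob S H) x).
Proof.
move: x; apply: (@tensor_ext _ _ _ _ (fun x : tensr H B => coact N (counit_lin x))
  (fun x : tensr H B => tmap counit_lin (@id (lside C)) (coact (tensf_ob S H) x))) =>
    [x y|x y|h u].
- by rewrite !linearD.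
- by rewrite linearD (linear_tmapD counit_lin).
rewrite counit_linE comod_hom_coact [coact (tensf_ob S H) _](tensf_coactE (S := S)).
rewrite -(linear_tmap_comp counit_lin (tens_at (B := B) h)).
by congr (tmap _ _ _); apply: funext => v; apply/esym; exact: counit_linE.
Qed.

Definition counit_map : comod_hom (tensf_ob S H) N := ComodHom counit_coact.

Lemma counit_mapE (h : H) (u : lside B) : counit_map (h ⊗ u) = (h : comod_hom S N) u.
Proof. exact: counit_linE. Qed.

End UnitCounit.
Arguments unit_map {T A C} S M.
Arguments counit_map {T A C} S N.

(** * The coring as a comodule over itself *)

Section RegularComodule.
Variables (A : pzRingType) (C : coring A).

Fact cop_linear : linear (@cop A C : C -> tensr C C).
Proof. by have [cD _ cZ] := cop_bimap C; move=> a x y; rewrite cD (cZ x a). Qed.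

Definition regular_comod : comod C :=
  @Comod A C C (linear_of cop_linear) (@cop_assoc A C) (@cop_counitr A C).

Fact lact_linear (a : A) : linear (lact a : C -> C).
Proof. by move=> b x y; rewrite lactDr; congr (_ + _); exact: lactC. Qed.

Fact lact_coact (a : A) (c : regular_comod) : coact regular_comod
  (linear_of (lact_linear a) c) =
  tmap (linear_of (lact_linear a)) (@id (lside C)) (coact regular_comod c).
Proof. by have [_ cZ _] := cop_bimap C; exact: cZ. Qed.

(** With this left A-action the tensor functor on right A-modules yields the cofree comodules N ⊗
    C. *)
Definition regular_tcomod : tcomod A C :=
  @TComod A A C regular_comod (fun a => linear_of (lact_linear a))
    (@lactDl _ _ C) (@lact1 _ _ C) (@lactA _ _ C) lact_coact.

End RegularComodule.

(** * Equivalences *)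

Lemma is_iso_cancel (C : category) (X Y : C) (f : mor X Y) : is_iso f ->
  forall Z (g h : mor Y Z), g ∘ f = h ∘ f -> g = h.
Proof. by case=> f' [_ ff'] Z g h gh; rewrite -[g]compm1 -[h]compm1 -ff' !compA gh. Qed.

Lemma is_iso_cancel_l (C : category) (X Y : C) (f : mor X Y) : is_iso f ->
  forall Z (g h : mor Z X), f ∘ g = f ∘ h -> g = h.
Proof. by case=> f' [f'f _] Z g h gh;
  rewrite -[g]comp1m -[h]comp1m -f'f -!compA gh. Qed.

Lemma nat_iso_sym (C D : category) (F G : functor C D) : nat_iso F G -> nat_iso G F.
Proof.
case=> a [a_nat a_iso]; pose b X := projT1 (cid (a_iso X)).
have bP X : b X ∘ a X = idm _ /\ a X ∘ b X = idm _ by exact: projT2 (cid (a_iso X)).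
exists b; split=> [X Y f|X]; last by exists (a X); have [] := bP X.
apply: (is_iso_cancel (a_iso X)); rewrite -[RHS]compA (proj1 (bP X)) compm1.
by rewrite -compA -a_nat compA (proj1 (bP Y)) comp1m.
Qed.

Lemma is_iso_comp (C : category) (X Y Z : C) (g : mor Y Z) (f : mor X Y) :
  is_iso g -> is_iso f -> is_iso (g ∘ f).
Proof.
case=> g' [g'g gg'] [f' [f'f ff']]; exists (f' ∘ g'); split.
  by rewrite -compA [g' ∘ _]compA g'g comp1m.
by rewrite -compA [f ∘ _]compA ff' comp1m.
Qed.

Lemma nat_iso_trans (C D : category) (F G H : functor C D) :
  nat_iso F G -> nat_iso G H -> nat_iso F H.
Proof.
case=> a [a_nat a_iso] [b [b_nat b_iso]]; exists (fun X => b X ∘ a X).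
by split=> [X Y f|X]; [rewrite -compA a_nat !compA b_nat|exact: is_iso_comp].
Qed.

Section EquivalenceFullFaithful.
Variables (C D : category) (F : functor C D) (G : functor D C).

Lemma left_iso_faithful : nat_iso (functor_comp G F) (functor_id C) ->
  forall X Y (f g : mor X Y), fmor F f = fmor F g -> f = g.
Proof.
case=> a [a_nat a_iso] X Y f g fg; apply: (is_iso_cancel (a_iso X)).
by rewrite -[f ∘ _]a_nat -[g ∘ _]a_nat /= fg.
Qed.
End EquivalenceFullFaithful.

Lemma equivalence_full (C D : category) (F : functor C D) (G : functor D C) :
  inverse_equivalences F G ->
  forall X Y (h : mor (F X) (F Y)), exists f, fmor F f = h.
Proof.
case=> [[a [a_nat a_iso]] GF] X Y h; have [a' [a'a aa']] := a_iso X.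
(* The preimage is [fmor G h] conjugated by the isomorphism of GF with the identity. As G is
   faithful, it is enough to compare after G. *)
exists (a Y ∘ fmor G h ∘ a'); apply: (left_iso_faithful GF).
apply: (is_iso_cancel_l (a_iso Y)); apply: (etrans (a_nat X Y _)).
by rewrite /= -!compA a'a compm1.
Qed.

Lemma comod_iso_bij (A : pzRingType) (C : coring A) (M N : comod C)
  (f : comod_hom M N) : @is_iso (comod_cat C) M N f ->
  exists g : comod_hom N M, cancel f g /\ cancel g f.
Proof.
case=> g [gf fg]; exists g; split=> x.
  exact: (congr1 (fun h : comod_hom _ _ => h x) gf).
exact: (congr1 (fun h : comod_hom _ _ => h x) fg).
Qed.

(** * From an equivalence to bijective units and counits *)

Section Galois.
Variables (T A : pzRingType) (C : coring A).

Definition unit_counit_bijective (S : tcomod T C) : Prop :=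
  (forall M, bijective (unit_map S M)) /\ (forall N, bijective (counit_map S N)).

Variables (F : functor (rmod_cat T) (comod_cat C)).
Variables (G : functor (comod_cat C) (rmod_cat T)).
Hypothesis FG : inverse_equivalences F G.
Let S := equivalence_image FG.
Let B := tcomod_bimod S.

Let Fm (M N : rmodType T) (f : {linear M -> N}) : comod_hom (F M) (F N) :=
  @fmor _ _ F M N f.
Let FmM (M N P : rmodType T) (g : {linear N -> P}) (f : {linear M -> N}) :
  Fm (lin_comp g f) = comod_comp (Fm g) (Fm f).
Proof. exact: (fmorM F). Qed.
Let Fm_inj (M N : rmodType T) (f g : {linear M -> N}) : Fm f = Fm g -> f = g.
Proof. by case: FG => h _; exact: (left_iso_faithful h). Qed.
Let Fm_full (M N : rmodType T) (h : comod_hom (F M) (F N)) : exists f, Fm f = h.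
Proof. exact: (equivalence_full FG). Qed.

Fact point_linear (M : rmodType T) (m : M) :
  linear ((fun t => m *> t) : regr T -> M).
Proof.
by move=> a x y; rewrite ractDr; congr (_ + _); apply/esym; exact: (ractA m x a).
Qed.
(** Elements of M become linear maps out of T, to which F can be applied. *)
Definition point (M : rmodType T) (m : M) : {linear regr T -> M} :=
  linear_of (point_linear m).

Lemma pointE (M : rmodType T) (f : {linear regr T -> M}) :
  f = point (f (1 : T)).
Proof.
apply: linear_ext => t; rewrite /= -linear_ract; congr (f _).
by apply/esym; exact: (@mul1r T t).
Qed.
Lemma point_inj (M : rmodType T) : injective (@point M).
Proof.
move=> m m' e; rewrite -(ract1 m) -(ract1 m').
exact: (congr1 (fun f : {linear regr T -> M} => f (1 : T)) e).
Qed.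
Lemma point_comp (M N : rmodType T) (f : {linear M -> N}) m :
  lin_comp f (point m) = point (f m).
Proof. by apply: linear_ext => t; exact: linear_ract. Qed.
Lemma pointD (M : rmodType T) (m m' : M) : point (m + m') = point m \+ point m'.
Proof. by apply: linear_ext => t; exact: ractDl. Qed.
Lemma point_act (M : rmodType T) (m : M) t :
  point (m *> t) = lin_comp (point m) (lmul t).
Proof. by apply: linear_ext => x; exact: ractA. Qed.

Section Object.
Variable M : rmodType T.

Let theta_fun (m : M) (u : lside B) : F M := Fm (point m) u.

Let theta_balanced : balanced theta_fun.
Proof.
split=> [m m' u|m u v|m t u].
- rewrite /theta_fun pointD;
    apply: (congr1 (fun f : comod_hom _ _ => f u) (equivalence_additive FG _ _)).
- exact: linearD.
- by rewrite /theta_fun point_act FmM.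
Qed.

Fact theta_linear : linear (tlift theta_fun : tensr M B -> F M).
Proof.
apply: (tlift_linear theta_balanced) => m u a; exact: (linear_ract (Fm (point m))).
Qed.
Let theta_lin : {linear tensr M B -> F M} := linear_of theta_linear.

Let theta_linE m (u : lside B) : theta_lin (m ⊗ u) = Fm (point m) u.
Proof. exact: (tliftE _ _ theta_balanced). Qed.

Fact theta_coact (x : tensf_ob S M) :
  coact (F M) (theta_lin x) =
  tmap theta_lin (@id (lside C)) (coact (tensf_ob S M) x).
Proof.
move: x; apply: (@tensor_ext _ _ _ _ (fun x : tensr M B => coact (F M) (theta_lin x))
  (fun x : tensr M B => tmap theta_lin (@id (lside C)) (coact (tensf_ob S M) x))) =>
    [x y|x y|m u].
- by rewrite !linearD.
- by rewrite linearD (linear_tmapD theta_lin).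
rewrite theta_linE comod_hom_coact [coact (tensf_ob S M) _](tensf_coactE (S := S)).
rewrite -(linear_tmap_comp theta_lin (tens_at (B := B) m)).
by congr (tmap _ _ _); apply: funext => v; apply/esym; exact: theta_linE.
Qed.

Definition theta : comod_hom (tensf_ob S M) (F M) := ComodHom theta_coact.

Lemma thetaE m (u : lside B) : theta (m ⊗ u) = Fm (point m) u.
Proof. exact: theta_linE. Qed.

Lemma theta_tens m : comod_comp theta (tens_hom S m) = Fm (point m).
Proof. by apply: comod_hom_ext => u; exact: thetaE. Qed.

End Object.

Lemma tensf_hom_ext (M : rmodType T) (N : comod C)
  (f g : comod_hom (tensf_ob S M) N) :
  (forall m, comod_comp f (tens_hom S m) = comod_comp g (tens_hom S m)) -> f = g.
Proof.
move=> fg; apply: comod_hom_ext.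
apply: (@tensor_ext _ _ _ _ f g) => [x y|x y|m u]; [exact: linearD|exact: linearD|].
exact: (congr1 (fun h : comod_hom _ _ => h u) (fg m)).
Qed.

Lemma theta_natural (M N : rmodType T) (f : {linear M -> N}) :
  comod_comp (theta N) (tensf_mor S f) = comod_comp (Fm f) (theta M).
Proof.
apply: tensf_hom_ext => m; apply: comod_hom_ext => u.
transitivity (theta N (f m ⊗ (u : lside B))).
  by congr (theta N _); exact: linear_tmapE.
by rewrite [RHS](congr1 (Fm f) (thetaE m u)) thetaE -point_comp FmM.
Qed.

Lemma comodM (M N P Q : comod C) (h : comod_hom P Q) (g : comod_hom N P)
  (f : comod_hom M N) : comod_comp h (comod_comp g f) = comod_comp (comod_comp h g) f.
Proof. exact: comod_hom_ext. Qed.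

(* Together with theta_extend: precomposition with theta M is a bijection
   Hom(F M, F P) -> Hom(M ⊗ S, F P), as both sides are the T-linear maps
   M -> P. Every comodule being isomorphic to some F P, this makes theta M an
   isomorphism. *)
Lemma theta_epi (M : rmodType T) (P : rmodType T) (k k' : comod_hom (F M) (F P)) :
  comod_comp k (theta M) = comod_comp k' (theta M) -> k = k'.
Proof.
have [f <-] := Fm_full k; have [f' <-] := Fm_full k' => e; congr Fm.
apply: linear_ext => m; apply: point_inj; apply: Fm_inj.
by rewrite -!point_comp !FmM -theta_tens !comodM e.
Qed.

Lemma theta_extend (M P : rmodType T) (g : comod_hom (tensf_ob S M) (F P)) :
  exists k, comod_comp k (theta M) = g.
Proof.
(* By fullness every colinear map from S to F P is F of a point. Faithfulness and additivity of F
   then make this point linear in [m]. *)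
have /choice[y gy] m : exists p : P, Fm (point p) = comod_comp g (tens_hom S m).
  have [f fE] := Fm_full (comod_comp g (tens_hom S m)).
  by exists (f (1 : T)); rewrite -pointE.
have yL : linear y.
  move=> t m m'; apply: point_inj; apply: Fm_inj; rewrite gy pointD.
  rewrite [RHS](equivalence_additive FG) -/(Fm _) -/(Fm _) gy.
  rewrite -[t *: y m]/(y m *> t) point_act FmM gy.
  apply: comod_hom_ext => u.
  rewrite [LHS](congr1 g (tensDl _ _ _)) linearD; congr (_ + _).
  by congr (g _); exact: tens_mid.
exists (Fm (linear_of yL)); apply: tensf_hom_ext => m.
by rewrite -comodM theta_tens -FmM point_comp gy.
Qed.

Lemma theta_bij M : bijective (theta M).
Proof.
have [_ [b [_ b_iso]]] := FG.
have [b' [b'K bK]] := comod_iso_bij (b_iso (tensf_ob S M)).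
(* Extending [b'] along [theta M] and composing with the inverse of [b'] gives a left inverse [c] of
   [theta M]. Then [theta M] after [c] agrees with the identity on the image of [theta M], and
   [theta_epi] applies. *)
have [k kE] := theta_extend b'.
pose c := comod_comp (b (tensf_ob S M) : comod_hom _ (tensf_ob S M)) k.
have cK : cancel (theta M) c.
  move=> x; rewrite -[RHS]bK -kE //.
suff e : comod_comp (theta M) c = comod_id (F M).
  by exists c => // x; exact: (congr1 (fun f : comod_hom _ _ => f x) e).
apply: theta_epi; apply: comod_hom_ext => y.
exact: (congr1 (theta M) (cK y)).
Qed.

Lemma functor_tensor_iso : nat_iso F (tensor_functor S).
Proof.
apply: nat_iso_sym; exists (fun M => theta M); split=> [M N f|M].
  exact: theta_natural.
exact/comod_is_iso/theta_bij.
Qed.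

(** Followed by the isomorphism [theta M], the unit becomes [m] |-> F([point m]), a bijection by
    full faithfulness. *)
Lemma equivalence_unit_bij M : bijective (unit_map S M).
Proof.
apply: bij_of_inj_surj => [m m' e|h].
  by apply: point_inj; apply: Fm_inj; rewrite -!theta_tens; congr comod_comp.
have [f fE] := Fm_full (comod_comp (theta M) h); exists (f (1 : T)).
apply: comod_hom_ext => u; apply: (bij_inj (theta_bij M)).
rewrite [LHS]thetaE -pointE fE //.
Qed.

(* By transport along f, the map m ⊗ u |-> f(m ⊗ u) factors through the counit
   and the bijection M -> Hom(S, M ⊗ S) -> Hom(S, N). *)
Lemma counit_bij_of_iso (M : rmodType T) N (f : comod_hom (tensf_ob S M) N) :
  bijective f -> bijective (counit_map S N).
Proof.
move=> f_bij; have [g [fK gK]] := comod_hom_inv f_bij.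
pose phi := lin_comp (homf_mor S f) (unit_map S M).
have [phi' phiK phi'K] : bijective phi.
  apply: (bij_comp _ (equivalence_unit_bij M)).
  by exists (homf_mor S g) => h; apply: comod_hom_ext => u; rewrite /= ?fK ?gK.
have [psi psiE] : exists psi : {linear homf_ob S N -> M}, psi =1 phi'.
  have pL : linear phi' by move=> a x y; apply: (can_inj phiK);
    rewrite phi'K linearP !phi'K.
  by exists (linear_of pL).
have e x : counit_map S N (tensf_mor S phi x) = f x.
  move: x; apply: (@tensor_ext _ _ _ _ (fun x : tensf_ob S M => _) f) => [x y|x y|m u].
  - by rewrite !linearD.
  - exact: linearD.
  - by rewrite [tensf_mor S phi _]linear_tmapE counit_mapE.
have phi_bij : bijective (tensf_mor S phi).
  exists (tensf_mor S psi) => x.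
    rewrite -[LHS](linear_tmap_comp psi phi) -[RHS]tmap_id; congr (tmap _ _ _).
    by apply: funext => m; rewrite /= psiE phiK.
  rewrite -[LHS](linear_tmap_comp phi psi) -[RHS]tmap_id; congr (tmap _ _ _).
  by apply: funext => m /=; rewrite psiE; exact: phi'K.
have [q qK Kq] := phi_bij.
exists (fun n => tensf_mor S phi (g n)) => x; last by rewrite e gK.
by rewrite -[x]Kq e fK.
Qed.

Lemma equivalence_unit_counit : unit_counit_bijective S.
Proof.
split=> [|N]; first exact: equivalence_unit_bij.
have [_ [b [_ b_iso]]] := FG; have [b' [bK b'K]] := comod_iso_bij (b_iso N).
apply: (@counit_bij_of_iso (G N) N
  (comod_comp (b N : comod_hom (F (G N)) N) (theta (G N)))).
by apply: bij_comp (theta_bij _); exists b'.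
Qed.

(** This is the chain G N ≅ Hom(T, G N) ≅ Hom(F T, F G N) ≅ Hom(S, N), whose composite sends [x] to
    [bb N] after F([point x]). *)
Lemma functor_hom_iso : nat_iso G (hom_functor S).
Proof.
have [_ [b0 [b_nat b_iso]]] := FG.
pose bb N : comod_hom (F (G N)) N := b0 N.
have bbI N : injective (bb N).
  by have [c [cK _]] := comod_iso_bij (b_iso N); exact: can_inj cK.
pose gam N (x : G N) : homf_ob S N := comod_comp (bb N) (Fm (point x)).
have gL N : linear (gam N).
  move=> t x y; apply: comod_hom_ext => u.
  transitivity (bb N (Fm (point (x *> (t : T))) u + Fm (point y) u)).
    apply: (congr1 (bb N)); rewrite pointD.
    exact: (congr1 (fun f : comod_hom _ _ => f u) (equivalence_additive FG _ _)).
  by rewrite linearD point_act FmM.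
exists (fun N => linear_of (gL N)); split=> [N N' f|N].
  apply: linear_ext => x; apply: comod_hom_ext => u.
  have := congr1 (fun h : comod_hom _ _ => h (Fm (point x) u)) (b_nat N N' f).
  move=> /= <-; congr (bb N' _).
  have := congr1 (fun h : comod_hom _ _ => h u)
    (FmM (fmor G f : {linear G N -> G N'}) (point x)).
  by rewrite point_comp.
apply: rmod_is_iso; apply: bij_of_inj_surj => [x y e|h].
  apply: point_inj; apply: Fm_inj; apply: comod_hom_ext => u; apply: bbI.
  exact: (congr1 (fun h : comod_hom _ _ => h u) e).
have [c [_ bK]] := comod_iso_bij (b_iso N).
have [f fE] := Fm_full (comod_comp c h : comod_hom (F (regr T)) (F (G N))).
exists (f (1 : T)); apply: comod_hom_ext => u.
by rewrite -[RHS]bK; apply: (congr1 (bb N)); rewrite -pointE fE.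
Qed.

End Galois.

(** * Consequences of bijective units and counits *)

Section GaloisComodule.
Variables (T A : pzRingType) (C : coring A) (S : tcomod T C).
Let B := tcomod_bimod S.
Hypothesis S_galois : unit_counit_bijective S.

Let unit_inj M : injective (unit_map S M).
Proof. by case: S_galois => h _; exact: bij_inj. Qed.
Let unit_surj M h : exists m, unit_map S M m = h.
Proof. by case: S_galois => hu _; exact: bij_surj. Qed.
Let counit_surj N y : exists x, counit_map S N x = y.
Proof. by case: S_galois => _ hc; exact: bij_surj. Qed.
Let counit_inv N : exists g : comod_hom N (tensf_ob S (homf_ob S N)),
  cancel (counit_map S N) g /\ cancel g (counit_map S N).
Proof. by case: S_galois => _ hc; exact: comod_hom_inv. Qed.

(** Injectivity of the unit, read on values: equalities in a T-module can be checked after tensoring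
    with S. *)
Lemma tens_all_inj (M : rmodType T) (m m' : M) :
  (forall u : lside B, m ⊗ u = m' ⊗ u) -> m = m'.
Proof. by move=> e; apply: unit_inj; exact: comod_hom_ext. Qed.

(** Surjectivity of the counit means that the values [h u] generate N as a group. *)
Lemma comod_gen (N : comod C) (W : zmodType) (f g : N -> W) :
  {morph f : x y / x + y} -> {morph g : x y / x + y} ->
  (forall (h : comod_hom S N) u, f (h u) = g (h u)) -> f =1 g.
Proof.
move=> fD gD fg y; have [x <-] := counit_surj y.
move: x; apply: (@tensor_ext _ _ _ _ (fun x : tensf_ob S _ => f (counit_map S N x))
  (fun x : tensf_ob S _ => g (counit_map S N x))) => [x x'|x x'|h u].
- by rewrite linearD fD.
- by rewrite linearD gD.
- by rewrite counit_mapE.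
Qed.

Lemma galois_generator : generator (S : comod_cat C).
Proof.
move=> X Y f g fg; apply: comod_hom_ext.
apply: (@comod_gen X Y (f : comod_hom X Y) (g : comod_hom X Y)) => [||h u];
  try exact: linearD.
exact: (congr1 (fun k : comod_hom _ _ => k u) (fg h)).
Qed.

Lemma galois_inverse_equivalences :
  inverse_equivalences (tensor_functor S) (hom_functor S).
Proof.
case: S_galois => hu hc; split.
  apply: nat_iso_sym; exists (fun M => unit_map S M); split=> [M M' f|M].
    apply: linear_ext => m; apply: comod_hom_ext => u; apply/esym.
    exact: (linear_tmapE f m (u : lside B)).
  exact: (rmod_is_iso (hu M)).
exists (fun N => counit_map S N); split=> [N N' f|N]; last exact: (comod_is_iso (hc N)).
apply: comod_hom_ext; apply: (@tensor_ext _ _ _ _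
  (fun x : tensf_ob S (homf_ob S N) => counit_map S N' (tensf_mor S (homf_mor S f) x))
  (fun x : tensf_ob S (homf_ob S N) => (f : comod_hom N N') (counit_map S N x)))
    => [x y|x y|h u].
- by rewrite !linearD.
- by rewrite !linearD.
- by rewrite [tensf_mor _ _ _]linear_tmapE !counit_mapE.
Qed.

(** The action identifies T ⊗ S with S, and under this identification the unit at T is
    [tcomod_j]. *)
Lemma galois_j_bijective : bijective (tcomod_j S : T -> comod_end S).
Proof.
have ab : balanced (fun (t : regr T) (u : lside B) => tact S (t : T) (u : S)).
  split=> [t t' u|t u u'|t t' u]; [exact: tactD|exact: linearD|exact: tactA].
have aE (t : regr T) (u : lside B) :
  tlift (fun (t : regr T) (u : lside B) => tact S (t : T) (u : S)) (t ⊗ u) =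
    tact S (t : T) (u : S).
  exact: (tliftE _ _ ab).
pose e1 : regr T := (1 : T).
have t1 (t : regr T) (u : lside B) : t ⊗ u = e1 ⊗ (tact S (t : T) (u : S) : lside B).
  by rewrite -[tact S t u]/((t : T) *: u) -tens_mid; congr tens; apply/esym;
    exact: (@mul1r T).
apply: bij_of_inj_surj => [t t' e|h].
  apply: (@tens_all_inj (regr T)) => u; rewrite [LHS]t1 [RHS]t1; congr tens.
  exact: (congr1 (fun k : comod_hom S S => k u) e).
have [t tE] := unit_surj (comod_comp (tens_hom S e1) h).
exists t; apply: comod_hom_ext => u.
have := congr1 (fun k : comod_hom S (tensf_ob S (regr T)) =>
  tlift (fun (t : regr T) (u : lside B) => tact S (t : T) (u : S)) (k u)) tE.
by rewrite /= unit_mapE /tens_at !aE tact1.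
Qed.

(** Surjectivity of Hom(S, [p]) is tested by linear maps [q] killing its image. The inverse of the
    counit at Y followed by [q] ⊗ S is a colinear map on Y that vanishes after [p], hence is zero as
    [p] is epi. This forces [q] to vanish. *)
Lemma galois_projective_object : projective_object (S : comod_cat C).
Proof.
move=> X Y p f p_epi.
suff [h hE] : exists h : homf_ob S X, homf_mor S (p : comod_hom X Y) h = f by exists h.
move: (f : homf_ob S Y); apply: epi_surjective => Q q qp.
have [c [cK Kc]] := counit_inv Y.
have k0 : comod_comp (tensf_mor S q) c = 0 :> comod_hom Y (tensf_ob S Q).
  apply: (p_epi); apply: comod_hom_ext; apply: comod_gen => [x y|x y|h u];
    [exact: linearD|exact: linearD|].
  have e : (p : comod_hom X Y) (h u) =
      counit_map S Y ((homf_mor S (p : comod_hom X Y) h : homf_ob S Y) ⊗ (u : lside B)).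
    by rewrite counit_mapE.
  apply: (etrans (congr1 (fun y => tensf_mor S q (c y)) e)).
  rewrite cK [tensf_mor S q _]linear_tmapE qp; exact: tens0l.
move=> h; apply: tens_all_inj => u; rewrite tens0l.
have := congr1 (fun k : comod_hom _ _ => k (counit_map S Y (h ⊗ u))) k0.
by rewrite /= cK => <-; apply/esym; exact: linear_tmapE.
Qed.

(* The colinear endomorphisms of S that factor through some Y_i form a
   T-submodule U, and the subobject U ⊗ S of S contains every Y_i. So it is all
   of S, and the identity of S factors through some Y_i. *)
Lemma galois_finitely_generated_object : finitely_generated_object (S : comod_cat C).
Proof.
move=> I Y y [y_mono [i0] y_dir] y_sum.
pose le_i i (h : homf_ob S S) := exists k : comod_hom S (Y i), h = comod_comp
  (y i : comod_hom (Y i) S) k.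
have le_sub i k h : sub_le (y i) (y k) -> le_i i h -> le_i k h.
  case=> v vE [w ->]; exists (comod_comp (v : comod_hom _ _) w); rewrite -vE.
  exact: comod_hom_ext.
have U0 : exists i, le_i i 0.
  by exists i0; exists 0; apply: comod_hom_ext => u; rewrite /= linear0.
have UD h h' : (exists i, le_i i h) -> (exists i, le_i i h') -> exists i, le_i i
  (h + h').
  move=> [i hi] [k hk]; have [l [il kl]] := y_dir i k; exists l.
  have [v ->] := le_sub _ _ _ il hi; have [w ->] := le_sub _ _ _ kl hk.
  by exists (v + w); apply: comod_hom_ext => u; rewrite /= linearD.
have UZ t h : (exists i, le_i i h) -> exists i, le_i i (t *: h).
  case=> i [v ->]; exists i; exists (comod_comp v (tcomod_j S t)).
  exact: comod_hom_ext.
pose U := Submodule U0 UD UZ.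
pose z := comod_comp (counit_map S S) (tensf_mor S (submod_incl U)).
have zE (h : submod_type U) (u : lside B) : z (h ⊗ u) =
  (submod_incl U h : comod_hom S S) u.
  by rewrite /= [rtens _ _ _]linear_tmapE; exact: counit_mapE.
have z_tens (h : submod_type U) : comod_comp z (tens_hom S h) = submod_incl U h.
  by apply: comod_hom_ext => u; exact: zE.
(* S is a generator, so maps into the source of [z] are compared after maps out of S. By the unit,
   maps from S to U ⊗ S are elements of [U], and [z] turns them back into the corresponding
   endomorphisms of S. *)
have z_mono : @mono (comod_cat C) _ _ z.
  move=> Z a b ab; apply: galois_generator => h.
  have [v vE] := unit_surj (comod_comp (a : comod_hom _ _) h).
  have [w wE] := unit_surj (comod_comp (b : comod_hom _ _) h).
  have vwE : v = w.
    apply: (@submod_incl_inj _ _ U); rewrite -!z_tens.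
    rewrite -[tens_hom S v]/(unit_map S _ v : comod_hom _ _) vE.
    rewrite -[tens_hom S w]/(unit_map S _ w : comod_hom _ _) wE.
    by apply: comod_hom_ext => u; exact: (congr1 (fun k : comod_hom _ _ => k (h u)) ab).
  by rewrite -[LHS]vE -[RHS]wE vwE.
have z_iso : @is_iso (comod_cat C) _ _ z.
  apply: y_sum => // i; have [c [cK Kc]] := counit_inv (Y i).
  have pL : exists p : {linear homf_ob S (Y i) -> submod_type U},
      forall h, submod_incl U (p h) = comod_comp (y i : comod_hom _ _) h.
    have /choice[p pE] (h : homf_ob S (Y i)) : exists x, submod_incl U x = comod_comp
      (y i : comod_hom _ _) h.
      by apply: submod_inclE; exists i; exists h.
    have pL : linear p.
      move=> t h h'; apply: (@submod_incl_inj _ _ U); rewrite linearP !pE.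
      by apply: comod_hom_ext => u; rewrite /= linearD.
    by exists (linear_of pL).
  have [p pE] := pL; exists (comod_comp (tensf_mor S p) c).
  apply: comod_hom_ext; apply: comod_gen => [v w|v w|h u];
    [exact: linearD|exact: linearD|].
  rewrite -(@counit_mapE _ _ _ S (Y i) h u).
  rewrite [LHS](congr1 (fun x => z (tensf_mor S p x)) (cK _)) counit_mapE.
  by rewrite [tensf_mor S p _]linear_tmapE zE pE.
have [g [gz zg]] := z_iso.
have [h hE] := unit_surj (g : comod_hom _ _).
have [i [v vE]] := submod_inclP h.
have yv : comod_comp (y i : comod_hom _ _) v = comod_id S.
  by rewrite -vE -z_tens -[RHS]zg; congr comod_comp.
(* A monomorphism with a right inverse is an isomorphism. *)
exists i; exists v; split; last exact: yv.
apply: (y_mono i); rewrite compA [y i ∘ _]yv; exact: comod_hom_ext.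
Qed.

End GaloisComodule.

(** * Flatness and kernels of colinear maps *)

Lemma tmap0l (R : pzRingType) (M M' : rmodType R) (N : lmodType R)
  (f : {linear M -> M'}) : (forall m, f m = 0) ->
  forall x, tmap f (@id N) x = 0.
Proof.
move=> f0; apply: tensor_ind => [|x y hx hy|m n].
- exact/morph_add0/linear_tmapD.
- by rewrite linear_tmapD hx hy addr0.
- by rewrite linear_tmapE f0 tens0l.
Qed.

(** That the image lies in the kernel survives every tensor product, so only the other inclusion is
    left. *)
Lemma exact_at_tmap (R : pzRingType) (N : lmodType R) (M1 M2 M3 : rmodType R)
  (f : {linear M1 -> M2}) (g : {linear M2 -> M3}) : exact_at f g ->
  (forall y, tmap g (@id N) y = 0 -> exists x, tmap f (@id N) x = y) ->
  exact_at (tmap f (@id N)) (tmap g (@id N)).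
Proof.
move=> fg h y; split=> [/h//|[x <-]].
rewrite -(linear_tmap_comp g f); apply: (tmap0l (f := lin_comp g f)) => m.
by apply/fg; exists m.
Qed.

(** Injectivity is exactness of the zero map followed by [f], which flatness preserves. *)
Lemma flat_inj (R : pzRingType) (N : lmodType R) (M M' : rmodType R)
  (f : {linear M -> M'}) : flat N -> injective f -> injective (tmap f (@id N)).
Proof.
move=> N_flat f_inj.
have ex : exact_at (\0 : {linear M -> M}) f.
  move=> y; split=> [fy0|[x <-]]; last exact: linear0.
  by exists 0; apply: f_inj; rewrite fy0 linear0.
have tD := @linear_tmapD _ _ _ N f.
move=> x y fxy; apply/eqP; rewrite -subr_eq0; apply/eqP.
have [] := (N_flat _ _ _ _ _ ex (x - y)).
case=> [|z <- _]; last exact: (tmap0l (f := (\0 : {linear M -> M}))).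
by apply: (addIr (tmap f id y)); rewrite -tD subrK add0r.
Qed.

Section KernelComodule.
Variables (A : pzRingType) (C : coring A).
Hypothesis C_flat : flat (lside C).
Variables (N W : comod C) (p : comod_hom N W).

(* Flatness is used twice: to lift the coaction to the kernel, and, on
   (K ⊗ C) ⊗ C, for coassociativity. *)
Lemma kernel_comod : exists (K : comod C) (i : comod_hom K N), exact_at i p.
Proof.
pose U := kernel_submod p; pose K : rmodType A := submod_type U.
pose i : {linear K -> N} := submod_incl U.
have i_inj : injective i by exact: submod_incl_inj.
have ip : exact_at i p.
  move=> y; split=> [/(submod_inclE (U := U))//|[x <-]];
    exact: (submod_inclP (U := U) x).
have iC_inj : injective (rtens C i) by exact: flat_inj.
have iCC_inj : injective (rtens C (rtens C i)) by exact: flat_inj.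
have /choice[r rE] (k : K) : exists y, rtens C i y = coact N (i k).
  apply/(C_flat ip); rewrite -comod_hom_coact.
  by rewrite (proj2 (ip (i k))); [exact: linear0|exists k].
have rL : linear r.
  by move=> a x y; apply: iC_inj;
    rewrite (linearP (rtens C i)) rE (linearP i) (linearP (coact N)) -!rE.
pose rl : {linear K -> tensr K C} := linear_of rL.
have rA k : tassoc (tmap rl (@id (lside C)) (rl k)) =
    tmap (@id K) (@cop A C : lside C -> lside (tensb C C)) (rl k).
  apply: (can_inj (@tassoc_invK _ _ _ _ _ _)); rewrite tassocK.
  apply: iCC_inj; apply: (can_inj (@tassocK _ _ _ _ _ _)).
  rewrite /= [RHS]tassoc_rtens tassoc_invK.
  rewrite tmap_exchange; last exact: cop_bimap.
  rewrite -[tmap i _ (rl k)]/(rtens C i (r k)) rE -coact_assoc; congr tassoc.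
  rewrite /rtens -(linear_tmap_comp (rtens C i) rl).
  rewrite -rE /rtens -(linear_tmap_comp (coact N) i).
  by congr (tmap _ _ _); apply: funext => x; exact: rE.
have rc k : tlift (fun (m' : K) (c : lside C) => m' *> cou (c : C)) (rl k) = k.
  pose cK (m : K) (c : lside C) := m *> cou (c : C).
  pose cN (m : N) (c : lside C) := m *> cou (c : C).
  apply: i_inj; rewrite -[RHS](coact_counit (i k)) -rE -/cK -/cN.
  rewrite -[rl k]/(r k); move: (r k).
  apply: (@tensor_ext _ _ _ _ (fun x : tensr K C => i (tlift cK x))
    (fun x : tensr K C => tlift cN (rtens C i x))) => [x y|x y|m c].
  - by rewrite (tliftD (cou_balanced C K)) linearD.
  - by rewrite linearD (tliftD (cou_balanced C N)).
  - rewrite /rtens linear_tmapE (tliftE _ _ (cou_balanced C K)).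
    by rewrite (tliftE _ _ (cou_balanced C N)) linear_ract.
exists (Comod rA rc);
  have ic (k : Comod rA rc) : coact N (i k) = tmap i (@id (lside C))
    (coact (Comod rA rc) k).
  by rewrite -rE.
by exists (ComodHom ic).
Qed.

End KernelComodule.

(** * Faithful flatness over T and a finite dual basis over A *)

Section DualBasis.
Variables (T A : pzRingType) (C : coring A) (S : tcomod T C).
Let B := tcomod_bimod S.
Hypothesis S_galois : unit_counit_bijective S.

(** The kernel of [g] ⊗ S is a comodule K, generated by the values of colinear maps [h] from S. By
    the unit, [h] followed by the inclusion is [v] |-> [m] ⊗ [v] for some [m]; then [g m] = 0, so
    [m] lies in the image of [f]. Faithfulness is [tens_all_inj]. *)
Lemma galois_faithfully_flat : flat (lside C) -> faithfully_flat (lside B).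
Proof.
move=> C_flat; split=> [M1 M2 M3 f g fg|M1 M2 f g fg m]; last first.
  apply: (tens_all_inj S_galois) => u; rewrite -!linear_tmapE; exact: fg.
apply: exact_at_tmap => // y gy0.
have [K [i ig]] := kernel_comod C_flat (tensf_mor S g).
have [k <-] := proj1 (ig y) gy0.
have [z <-] := bij_surj k (proj2 S_galois K).
move: z; apply: tensor_ind => [|z w [x hx] [x' hx']|h u].
- exists 0; rewrite !linear0; exact/morph_add0/linear_tmapD.
- by exists (x + x'); rewrite linear_tmapD hx hx' !linearD.
rewrite counit_mapE.
have [m mE] := bij_surj (comod_comp i h) (proj1 S_galois M2).
have gm0 : g m = 0.
  apply: (tens_all_inj S_galois) => v; rewrite tens0l -linear_tmapE.
  rewrite -[m ⊗ v]/((unit_map S M2 m : comod_hom _ _) v) mE.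
  by apply/ig; exists ((h : comod_hom S K) v).
have [x xm] := proj1 (fg m) gm0; rewrite -{}xm in mE.
exists (x ⊗ u); rewrite linear_tmapE.
exact: (congr1 (fun k : comod_hom _ _ => k u) mE).
Qed.

Let R := regular_tcomod C.
Let C' := tcomod_bimod R.

(* C' and C have the same carrier and actions, but different proofs of the
   module laws, so that [lside C'] and [lside C] are not convertible. *)
Let id_bimap : bimap (id : C -> C'). Proof. by []. Qed.
Let id_bimap' : bimap (id : C' -> C). Proof. by []. Qed.

(** The cofree comodule S ⊗ C. By coassociativity the coaction of S is a colinear map [rho] into
    it. *)
Let K := tensf_ob R S.
Let rho_fun (u : S) : K := tmap (@id S) (id : lside C -> lside C') (coact S u).

Let rho_linear : linear rho_fun.
Proof.
by move=> a x y; rewrite /rho_fun linearP; exact: (bimap_tmap_linear id_bimap).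
Qed.

Let jl : {linear tensr S C -> tensr S C'} := linear_of
  (bimap_tmap_linear (M := S) id_bimap).

Let coact_jl (x : tensr S C) : coact K (jl x) =
  rtens C jl (tassoc_inv (tmap (@id S) (@cop A C : lside C -> lside (tensb C C)) x)).
Proof.
have cb := cop_bimap C.
move: x; apply: (@tensor_ext _ _ _ _ (fun x => coact K (jl x))
  (fun x : tensr S C => rtens C jl (tassoc_inv (tmap _ _ x)))) => [x y|x y|m c].
- by rewrite !linearD.
- by rewrite bimap_tmapD // tassoc_invD linearD.
rewrite [jl _](bimap_tmapE m c id_bimap) [coact K _](tensf_coactE (S := R)).
rewrite bimap_tmapE // [tassoc_inv _](tliftE _ _ (@tassoc_inv_balanced _ _ _ _ _ _)).
rewrite /rtens -(linear_tmap_comp jl (tens_at (B := C) m)).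
by congr (tmap _ _ _); apply: funext => x; apply/esym;
  exact: (@bimap_tmapE _ _ _ C C' _ m x id_bimap).
Qed.

Let rho_coact u : coact K (linear_of rho_linear u) =
  tmap (linear_of rho_linear) (@id (lside C)) (coact S u).
Proof.
rewrite [LHS]coact_jl -coact_assoc tassocK /rtens.
by rewrite -(linear_tmap_comp jl (coact S)).
Qed.
Let rho : comod_hom S K := ComodHom rho_coact.

(* The maps u |-> \sum_i n_i ⊗ f_i(u) form a submodule of Hom^C(S, S ⊗ C). A
   linear map q killing it corresponds to a colinear map k on S ⊗ C with
   k(h(u)) = q(h) ⊗ u; it kills all n ⊗ f(u), hence all n ⊗ c, hence q = 0. *)
Lemma galois_coact_sum : exists s : seq (S * comod_hom S R),
  forall u, coact S u = \sum_(p <- s) (p.1 ⊗ (p.2 u : lside C)).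
Proof.
pose U (h : homf_ob S K) := exists s : seq (S * comod_hom S R),
  forall u, (h : comod_hom S K) u = \sum_(p <- s) (p.1 ⊗ (p.2 u : lside C')).
suff [s sE] : U rho.
  exists s => u.
  have jK : cancel jl (tmap (@id S) (id : lside C' -> lside C)).
    apply: (@tensor_ext _ _ _ _
      (fun x => tmap (@id S) (id : lside C' -> lside C) (jl x)) id)
      => [x y|//|m c].
      by rewrite linearD (bimap_tmapD id_bimap').
    by rewrite [jl _](bimap_tmapE m c id_bimap) (bimap_tmapE _ _ id_bimap').
  rewrite -[LHS]jK [jl _]sE (morph_add_sum _ _ (bimap_tmapD id_bimap')).
  by apply: eq_bigr => q _; rewrite (bimap_tmapE _ _ id_bimap').
have U0 : U 0 by exists [::] => u; rewrite big_nil.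
have UD h h' : U h -> U h' -> U (h + h').
  move=> [s sE] [s' sE']; exists (s ++ s') => u.
  by rewrite big_cat -sE -sE'.
have UZ t h : U h -> U (t *: h).
  case=> s sE; exists [seq (q.1, comod_comp q.2 (tcomod_j S t)) | q <- s] => u.
  by rewrite big_map /=; exact: sE.
apply: (@submod_full _ _ (Submodule U0 UD UZ)) => Q q qU h.
have [c [cK Kc]] := comod_hom_inv (proj2 S_galois K).
pose k := comod_comp (tensf_mor S q) c.
have kE h' u : k ((h' : comod_hom S K) u) = (q h' ⊗ (u : lside B)).
  by rewrite -(counit_mapE (h' : homf_ob S K)) /= cK; exact: linear_tmapE.
apply: (tens_all_inj S_galois) => u; rewrite tens0l -kE.
move: (h u); apply: (@tensor_ext _ _ _ _ k (fun => 0)) => [x y|x y|m x].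
- exact: linearD.
- by rewrite addr0.
move: x; apply: (@comod_gen _ _ _ S S_galois R _ (fun x => k (m ⊗ (x : lside C')))
  (fun => 0)) => [x y|x y|h' v].
- by rewrite -linearD; congr (k _); exact: tensDr.
- by rewrite addr0.
have -> : m ⊗ (h' v : lside C') = (comod_comp (tens_hom R m) h' : comod_hom S K) v by
  [].
rewrite kE qU ?tens0l //; exists [:: (m, h')] => w; by rewrite big_seq1.
Qed.

Lemma galois_dual_basis : exists s : seq (B * dual B),
  forall u : B, \sum_(p <- s) p.1 *> dual_fun p.2 u = u.
Proof.
have [s sE] := galois_coact_sum.
have cL (h : comod_hom S R) : linear ((fun u => cou (h u : C)) : B -> regr A).
  have [cD _ cZ] := cou_bimap C.
  move=> a x y; rewrite linearP [LHS]cD; congr (_ + _); exact: cZ.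
pose d h : dual B := linear_of (cL h).
exists [seq (p.1, d p.2) | p <- s] => u.
rewrite -[RHS](coact_counit (u : S)) sE (morph_add_sum _ _ (tliftD (cou_balanced C S))).
by rewrite big_map; apply: eq_bigr => q _; rewrite (tliftE _ _ (cou_balanced C S)).
Qed.

End DualBasis.

Section DualBasisProjective.
Variables (T A : pzRingType) (B : bimod T A) (s : seq (B * dual B)).
Hypothesis sE : forall u : B, \sum_(p <- s) p.1 *> dual_fun p.2 u = u.

Lemma dual_basis_finitely_generated : finitely_generated B.
Proof.
exists (size s), (fun i => (tnth (in_tuple s) i).1) => u.
exists (fun i => dual_fun (tnth (in_tuple s) i).2 u).
by rewrite -[LHS]sE big_tnth.
Qed.

(** The lift is chosen on the finitely many generators and extended by the dual forms, which are
    linear. *)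
Lemma dual_basis_projective : projective B.
Proof.
move=> N P p f p_surj; have /choice[x xE] := fun q : B * dual B => p_surj (f q.1).
pose g (u : B) := \sum_(q <- s) x q *> dual_fun q.2 u.
have gL : linear g.
  move=> a u v; rewrite /g scaler_sumr -big_split; apply: eq_bigr => q _ /=.
  rewrite /dual_fun (linearP (q.2 : {linear B -> regr A})).
  apply: (etrans (ractDr _ _ _)); congr (_ + _); apply/esym; exact: ractA.
exists (linear_of gL) => u; rewrite /= /g linear_sum -[in RHS](sE u) linear_sum.
by apply: eq_bigr => q _; rewrite !linear_ract xE.
Qed.

End DualBasisProjective.

(** * Comatrix coring contexts *)

Section ContextSums.
Variables (T A : pzRingType) (B : bimod T A) (S' : bimod A T).
Variable ctx : comatrix_context B S'.
Let P : bimod A A := tensb S' B.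
Let s := repr (cc_eta ctx 1).
Let eps (phi : S') (u : B) : A := cc_eps ctx (phi ⊗ (u : lside B)).

(** Bilinearity of eta gives t eta(1) = eta(t) = eta(1) t; a balanced map is then applied to both
    ends. *)
Lemma context_sum_central (Z : zmodType) (g : B -> lside S' -> Z) t : balanced g ->
  \sum_(p <- s) g (lact t p.1) p.2 = \sum_(p <- s) g p.1 ((p.2 : S') *> t).
Proof.
move=> gb; have [_ hl hr] := cc_eta_bimap ctx.
have gD := tliftD gb.
transitivity (tlift g (lact t (cc_eta ctx 1))).
  rewrite [in RHS](tensorE (cc_eta ctx 1)) -/s.
  rewrite (morph_add_sum _ _ (@lactDr _ _ (tensb B S') t)) (morph_add_sum _ _ gD).
  by apply: eq_bigr => p _; rewrite tens_lact tliftE.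
have -> : lact t (cc_eta ctx 1) = (cc_eta ctx 1 : tensb B S') *> t.
  rewrite -hl -hr; congr (cc_eta ctx _).
  by apply: (etrans (mulr1 t)); exact: esym (mul1r t).
rewrite [in LHS](tensorE (cc_eta ctx 1)) -/s ract_suml (morph_add_sum _ _ gD).
by apply: eq_bigr => p _; rewrite tens_ract tliftE.
Qed.

Lemma context_sumr (u : B) : \sum_(p <- s) p.1 *> eps p.2 u = u.
Proof. exact: (cc_triangle ctx u). Qed.

Lemma context_suml (phi : S') : \sum_(p <- s) lact (eps phi p.1) (p.2 : S') = phi.
Proof. exact: (cc_triangle' ctx phi). Qed.

(** Centrality of eta(1) makes the sum balanced over T in [phi] and [u]. *)
Lemma comatrix_copE (phi : S') (u : lside B) :
  comatrix_cop ctx (phi ⊗ u) =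
  \sum_(p <- s) ((phi ⊗ (p.1 : lside B) : P) ⊗ ((p.2 : S') ⊗ u : lside P)).
Proof.
apply: (tliftE (f := fun phi u => \sum_(p <- s)
  ((phi ⊗ (p.1 : lside B) : P) ⊗ ((p.2 : S') ⊗ u : lside P)))).
split=> [f f' v|f v v'|f t v].
- rewrite -big_split; apply: eq_bigr => p _.
  by apply: (etrans _ (@tensDl _ P _ _ _ _)); congr tens; exact: tensDl.
- rewrite -big_split; apply: eq_bigr => p _.
  by apply: (etrans _ (tensDr _ _ _)); congr tens; exact: tensDr.
have gb : balanced (fun (e : B) (g : lside S') =>
    (f ⊗ (e : lside B) : P) ⊗ ((g : S') ⊗ v : lside P)).
  split=> [e e' g|e g g'|e a g].
  - by rewrite -(@tensDl _ P); congr tens; exact: tensDr.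
  - by rewrite -tensDr; congr tens; exact: tensDl.
  - rewrite -[f ⊗ (e *> a : lside B)](tens_ract f (e : lside B) a) tens_mid.
    by congr tens; exact: tens_lact.
transitivity (\sum_(p <- s)
  ((f ⊗ (lact t p.1 : lside B) : P) ⊗ ((p.2 : S') ⊗ v : lside P))).
  by apply: eq_bigr => p _; congr tens; exact: tens_mid.
rewrite (context_sum_central t gb); apply: eq_bigr => p _; congr tens; exact: tens_mid.
Qed.

Let epsDl u : {morph eps^~ u : f g / f + g}.
Proof. by have [eD _ _] := cc_eps_bimap ctx; move=> f g; rewrite /eps tensDl eD. Qed.
Let epsDr f : {morph eps f : u v / u + v}.
Proof. by have [eD _ _] := cc_eps_bimap ctx; move=> u v; rewrite /eps tensDr eD. Qed.
Let epsZl a f u : eps (lact a f) u = a * eps f u.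
Proof. by have [_ eZ _] := cc_eps_bimap ctx; rewrite /eps -tens_lact eZ. Qed.
Let epsZr a f u : eps f (u *> a) = eps f u * a.
Proof. by have [_ _ eZ] := cc_eps_bimap ctx; rewrite /eps -tens_ract eZ. Qed.

Section Evaluation.
Variable N : rmodType A.

(** The canonical map from N ⊗ S' to Hom_A(B, N). By the triangle identities it is bijective, with
    inverse [h] |-> [h](e) ⊗ f, where eta(1) = e ⊗ f. *)
Definition context_eval (x : tensr N S') (u : B) : N :=
  tlift (fun (n : N) (phi : lside S') => n *> eps phi u) x.

Fact context_eval_balanced (u : B) :
  balanced (fun (n : N) (phi : lside S') => n *> eps phi u).
Proof.
split=> [n n' f|n f f'|n a f]; first exact: ractDl.
- by rewrite epsDl ractDr.
- by rewrite epsZl ractA.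
Qed.

Lemma context_evalE n (phi : lside S') u : context_eval (n ⊗ phi) u = n *> eps phi u.
Proof. exact: (tliftE _ _ (context_eval_balanced u)). Qed.

Lemma context_evalD u : {morph context_eval^~ u : x y / x + y}.
Proof. exact: (tliftD (context_eval_balanced u)). Qed.

Lemma context_eval_linear x : linear (context_eval x).
Proof.
move=> a u v; move: x;
  apply: (@tensor_ext _ _ _ _ (fun x : tensr N S' => context_eval x _)
  (fun x : tensr N S' => a *: context_eval x u + context_eval x v)) => [x y|x y|n f].
- exact: context_evalD.
- by rewrite !context_evalD scalerDr addrACA.
- rewrite !context_evalE epsDr ractDr; congr (_ + _).
  by rewrite -[a *: u]/(u *> a) epsZr -ractA.
Qed.

Definition context_coeval (h : B -> N) : tensr N S' := \sum_(p <- s)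
  (h p.1 ⊗ (p.2 : lside S')).

Lemma context_evalK x : context_coeval (context_eval x) = x.
Proof.
move: x; apply: (@tensor_ext _ _ _ _
  (fun x : tensr N S' => context_coeval (context_eval x)) id) => [x y|//|n f].
  by rewrite -big_split; apply: eq_bigr => p _; rewrite context_evalD tensDl.
rewrite -[in RHS](context_suml f) tens_sumr; apply: eq_bigr => p _.
by rewrite context_evalE tens_mid.
Qed.

Lemma context_coevalK (h : {linear B -> N}) u : context_eval (context_coeval h) u = h u.
Proof.
rewrite (morph_add_sum _ _ (context_evalD u)) -[in RHS](context_sumr u) linear_sum.
by apply: eq_bigr => p _; rewrite context_evalE linear_ract.
Qed.

Lemma context_eval_inj x y : context_eval x =1 context_eval y -> x = y.
Proof. by move=> /funext xy; rewrite -(context_evalK x) xy context_evalK. Qed.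

End Evaluation.

Lemma context_eval_tmap (N N' : rmodType A) (f : {linear N -> N'}) (x : tensr N S') u :
  context_eval (rtens S' f x) u = f (context_eval x u).
Proof.
move: x; apply: (@tensor_ext _ _ _ _
  (fun x : tensr N S' => context_eval (rtens S' f x) u)
  (fun x : tensr N S' => f (context_eval x u))) => [x y|x y|n phi].
- by rewrite linearD context_evalD.
- by rewrite context_evalD linearD.
- by rewrite /rtens linear_tmapE !context_evalE linear_ract.
Qed.

(** Elements of N ⊗ S' are linear maps from B to N, whose values are lifted along [f] one at a time.
    The lift need not be linear, because [context_coeval] accepts any function. *)
Lemma context_flat : flat (lside S').
Proof.
move=> N1 N2 N3 f g fg; apply: exact_at_tmap => // y gy.
have /choice[x xE] (u : B) : exists x, f x = context_eval y u.
  apply/fg; rewrite -context_eval_tmap [rtens _ _ _]gy.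
  exact: (morph_add0 (@context_evalD N3 u)).
exists (context_coeval x).
rewrite (morph_add_sum _ _ (@linear_tmapD _ _ _ _ f)) -[RHS]context_evalK.
by apply: eq_bigr => p _; rewrite linear_tmapE xE.
Qed.

End ContextSums.

(** * Colinear maps out of a comodule presented by a comatrix coring *)

Section Presentation.
Variables (T A : pzRingType) (C : coring A) (S : tcomod T C).
Let B := tcomod_bimod S.
Variables (S' : bimod A T) (ctx : comatrix_context B S').
Variable chi : comatrix_coring ctx -> C.
Hypothesis chi_iso : coring_iso chi.
Let s := repr (cc_eta ctx 1).
Hypothesis coact_chi : forall u : S, coact S u =
  \sum_(p <- s) (p.1 ⊗ (chi ((p.2 : S') ⊗ (u : lside B)) : lside C)).
Let P : bimod A A := tensb S' B.
Let eps (phi : S') (u : B) : A := cc_eps ctx (phi ⊗ (u : lside B)).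
Let chit (phi : S') (u : B) : C := chi (phi ⊗ (u : lside B)).

Let chi_bimap : bimap (chi : P -> C). Proof. by case: chi_iso. Qed.
Let chiD : {morph chi : y z / y + z}. Proof. by case: chi_bimap. Qed.

Let chitDl u : {morph chit^~ u : f g / f + g}.
Proof. by move=> f g; rewrite /chit -chiD; congr chi; exact: tensDl. Qed.
Let chitDr f : {morph chit f : u v / u + v}.
Proof. by move=> u v; rewrite /chit -chiD; congr chi; exact: tensDr. Qed.
Let chitZl a f u : chit (lact a f) u = lact a (chit f u).
Proof. by have [_ hl _] := chi_bimap; rewrite /chit -tens_lact hl. Qed.
Let chitZr a f u : chit f (u *> a) = chit f u *> a.
Proof. by have [_ _ hr] := chi_bimap; rewrite /chit -hr; congr chi; apply/esym;
  exact: tens_ract. Qed.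
Let chitT t f u : chit (f *> t) u = chit f (lact t u).
Proof. by rewrite /chit tens_mid. Qed.

Let cou_chit f u : cou (chit f u) = eps f u.
Proof. by have [_ _ _ h] := chi_iso; rewrite /chit h. Qed.

Let chi_pair_balanced : balanced
  (fun (y : P) (z : lside P) => chi y ⊗ (chi z : lside C)).
Proof. by case: chi_bimap => hD hl hr; apply: tmap_balanced. Qed.

Let cop_chit f u : cop (chit f u) = \sum_(p <- s) (chit f p.1 ⊗ (chit p.2 u : lside C)).
Proof.
have [_ _ h _] := chi_iso; rewrite /chit h [cop _]comatrix_copE.
have pD : {morph tmap (chi : P -> C) (chi : lside P -> lside C) : y z / y + z}.
  exact: (tliftD chi_pair_balanced).
rewrite (morph_add_sum _ _ pD).
by apply: eq_bigr => p _; exact: (tliftE _ _ chi_pair_balanced).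
Qed.

(* For the evaluation context of the dual, phi |-> chi(phi ⊗ e) ⊗ f is the map
   [dual_coaction]. *)
Definition context_coaction (phi : S') : tensb C S' :=
  \sum_(p <- s) (chit phi p.1 ⊗ (p.2 : lside S')).

Let lam := context_coaction.

Let pair_balanced f : balanced (fun (e : B) (g : lside S') => chit f e ⊗ g).
Proof.
split=> [e e' g|e g g'|e a g]; first by rewrite chitDr tensDl.
- exact: tensDr.
- by rewrite chitZr tens_mid.
Qed.

Fact context_coaction_bimap : bimap lam.
Proof.
split=> [f g|a f|f t].
- by rewrite -big_split; apply: eq_bigr => p _; rewrite chitDl tensDl.
- rewrite (morph_add_sum _ _ (@lactDr _ _ (tensb C S') a)); apply: eq_bigr => p _.
  by rewrite tens_lact chitZl.
- rewrite ract_suml /lam /context_coaction.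
  transitivity (\sum_(p <- s) (chit f (lact t p.1) ⊗ (p.2 : lside S'))).
    by apply: eq_bigr => p _; rewrite chitT.
  rewrite (context_sum_central ctx t (pair_balanced f)); apply: eq_bigr => p _.
  by apply/esym; exact: tens_ract.
Qed.

(** Coassociativity is the comatrix comultiplication read through [chi], and counitality is the
    second triangle identity. *)
Fact context_coaction_is_left : is_left_coaction (lam : S' -> tensb C S').
Proof.
split=> [|f|f]; first exact: context_coaction_bimap.
- have cb := cop_bimap C; have [cD cl cr] := cb.
  have cbal : balanced (fun (c : C) (g : lside S') => cop c ⊗ g).
    by apply: (tmap_balanced (g := id)).
  have pD : {morph tmap (@cop A C) (@id (lside S')) : y z / y + z}.
    exact: (tliftD cbal).
  rewrite (morph_add_sum _ _ pD) (morph_add_sum _ _ (@tassocD _ _ _ _ _ _)).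
  rewrite (morph_add_sum _ _ (bimap_tmapD context_coaction_bimap)).
  transitivity (\sum_(p <- s) \sum_(q <- s)
      (chit f q.1 ⊗ ((chit q.2 p.1 ⊗ (p.2 : lside S') : tensb C S') : lside
        (tensb C S')))).
    apply: eq_bigr => p _; rewrite /tmap (tliftE _ _ cbal) cop_chit.
    rewrite (@tens_suml _ (tensb C C)) (morph_add_sum _ _ (@tassocD _ _ _ _ _ _)).
    by apply: eq_bigr => q _; rewrite tassocE.
  rewrite exchange_big; apply: eq_bigr => q _ /=.
  by rewrite (bimap_tmapE _ _ context_coaction_bimap) -tens_sumr.
- have [cD cZ _] := cou_bimap C.
  have bal : balanced (fun (c : C) (y : lside S') => lact (cou c) (y : S')).
    split=> [c c' y|c y y'|c a y]; first by rewrite cD lactDl.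
    + exact: (@lactDr _ _ S').
    + by have [_ _ cR] := cou_bimap C; rewrite (cR c a) (@lactA _ _ S').
  rewrite (morph_add_sum _ _ (tliftD bal)) -[RHS](context_suml ctx f).
  by apply: eq_bigr => p _; rewrite (tliftE _ _ bal) cou_chit.
Qed.

Section Colinear.
Variable N : comod C.

(** On [n] ⊗ [f] both sides equal [n] ⊗ [chit f u], by one triangle identity each. Evaluation thus
    turns N ⊗ [lam] into [h] |-> ([h] ⊗ C) after the coaction of S. *)
Lemma eval_coact_lam (y : tensr N S') (u : S) :
  context_eval ctx (tassoc_inv (tmap (@id N) (lam : lside S' -> lside (tensb C S')) y))
    u =
  tmap (context_eval ctx y) (@id (lside C)) (coact S u).
Proof.
have lb := context_coaction_bimap.
have tD (z : tensr N S') := @linear_tmapD _ _ _ (lside C)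
  (linear_of (context_eval_linear ctx z)).
have tE (z : tensr N S') := @linear_tmapE _ _ _ (lside C)
  (linear_of (context_eval_linear ctx z)).
have tS (z : tensr N S') : tmap (context_eval ctx z) (@id (lside C)) (coact S u) =
    \sum_(p <- s) (context_eval ctx z p.1 ⊗ (chit p.2 u : lside C)).
  rewrite coact_chi (morph_add_sum _ _ (tD z)); apply: eq_bigr => p _; exact: tE.
rewrite tS.
move: y; apply: (@tensor_ext _ _ _ _
  (fun y : tensr N S' => context_eval ctx (tassoc_inv (tmap _ _ y)) u)
  (fun y : tensr N S' => _)) => [y z|y z|n f].
- by rewrite bimap_tmapD // tassoc_invD context_evalD.
- by rewrite -big_split; apply: eq_bigr => p _; rewrite context_evalD tensDl.
rewrite (bimap_tmapE _ _ lb) tens_sumr (morph_add_sum _ _ (@tassoc_invD _ _ _ _ _ _)).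
rewrite (morph_add_sum _ _ (context_evalD ctx u)).
transitivity (n ⊗ (chit f u : lside C)).
  rewrite -[in RHS](context_sumr ctx u) (morph_add_sum _ _ (chitDr f)) tens_sumr.
  apply: eq_bigr => p _; rewrite tassoc_invE context_evalE tens_ract.
  by congr tens; apply/esym; exact: chitZr.
rewrite -[in LHS](context_suml ctx f) (morph_add_sum _ _ (chitDl u)) tens_sumr.
by apply: eq_bigr => p _; rewrite context_evalE tens_mid chitZl.
Qed.

Lemma eval_colinearP (y : tensr N S') :
  rtens S' (coact N) y =
    tassoc_inv (tmap (@id N) (lam : lside S' -> lside (tensb C S')) y) <->
  forall u : S, coact N (context_eval ctx y u) =
    tmap (context_eval ctx y) (@id (lside C)) (coact S u).
Proof.
split=> [e u|e].
  by rewrite -eval_coact_lam -e context_eval_tmap.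
by apply: (@context_eval_inj _ _ _ _ ctx (tensr N C)) => u;
  rewrite context_eval_tmap e eval_coact_lam.
Qed.

Definition hom_tensor (h : homf_ob S N) : tensr N S' := context_coeval ctx
  (h : comod_hom S N).

Fact hom_tensor_linear : linear hom_tensor.
Proof.
move=> t h h'.
rewrite /hom_tensor /context_coeval scaler_sumr -big_split; apply/esym.
transitivity (\sum_(p <- s)
  ((h : comod_hom S N) p.1 ⊗ ((p.2 : S') *> t : lside S') + (h' : comod_hom S N) p.1 ⊗
    (p.2 : lside S'))).
  by apply: eq_bigr => p _; congr (_ + _); exact: (tens_ract _ (p.2 : lside S') t).
rewrite big_split -(context_sum_central ctx t
  (linear_tmap_balanced (lside S') (h : comod_hom S N))).
by rewrite -big_split; apply: eq_bigr => p _; exact/esym/tensDl.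
Qed.

Lemma hom_tensorK (h : homf_ob S N) u : context_eval ctx (hom_tensor h) u =
  (h : comod_hom S N) u.
Proof. exact: (context_coevalK ctx (h : comod_hom S N)). Qed.

Lemma hom_tensor_inj : injective hom_tensor.
Proof. by move=> h h' e; apply: comod_hom_ext => u; rewrite -!hom_tensorK e. Qed.

(** The equalizer condition on [y] is colinearity of its evaluation, and evaluation is inverse to
    [hom_tensor]. *)
Lemma hom_tensorP (y : tensr N S') : 
  rtens S' (coact N) y =
    tassoc_inv (tmap (@id N) (lam : lside S' -> lside (tensb C S')) y) <->
  exists h, hom_tensor h = y.
Proof.
split=> [/eval_colinearP e|[h <-]].
  exists (@ComodHom A C S N (linear_of (context_eval_linear ctx y)) e).
  exact: context_evalK.
apply/eval_colinearP => u; rewrite hom_tensorK comod_hom_coact.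
by congr (tmap _ _ _); apply: funext => v; exact/esym/hom_tensorK.
Qed.

End Colinear.

(** Up to the associator, the cotensor product is the equalizer that describes the colinear maps
    from S to N. *)
Lemma hom_cotensor_iso (l : S' -> tensb C S') (lP : is_left_coaction l) :
  l =1 lam -> nat_iso (hom_functor S) (cotensor_functor (LComod lP)).
Proof.
move=> /funext e; subst l; set L := LComod lP.
have memP (N : comod C) (y : tensr N S') : y \in @cotensor_pred T A C L N <-> exists h :
  homf_ob S N, hom_tensor h = y.
  rewrite -hom_tensorP; split=> [/asboolP h|h].
    by apply: (can_inj (@tassocK _ _ _ _ _ _)); rewrite tassoc_invK; exact: h.
  by apply/asboolP; rewrite -[LHS]/(tassoc (rtens S' (coact N) y)) h tassoc_invK.
have mem (N : comod C) (h : homf_ob S N) : hom_tensor h \in @cotensor_pred T A C L N by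
  apply/memP; exists h.
pose a (N : comod C) (h : homf_ob S N) : cotensor_ob L N := Cotensor (mem N h).
have aL N : linear (a N) by move=> t h h'; apply: val_inj; exact: hom_tensor_linear.
exists (fun N => linear_of (aL N)); split=> [N N' f|N].
  apply: linear_ext => h; apply: val_inj; apply/esym.
  rewrite [LHS](morph_add_sum _ _
    (@linear_tmapD _ _ _ (lside S') (f : comod_hom N N'))).
  by apply: eq_bigr => p _; exact: (linear_tmapE (f : comod_hom N N')).
apply: rmod_is_iso; apply: bij_of_inj_surj => [h h' e|[y yP]].
  by apply: hom_tensor_inj; exact: (congr1 (@cotensor_val _ _ _ _ _) e).
by have /memP[h hE] := yP; exists h; apply: val_inj.
Qed.

Section Kappa.
Variable N : rmodType A.

(** Through this isomorphism, tensoring with C is tensoring with S' and then with S. *)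
Definition context_kappa (z : tensr (tensr N S') B) : tensr N C :=
  tmap (@id N) (chi : lside P -> lside C) (tassoc z).

Lemma context_kappaD : {morph context_kappa : y z / y + z}.
Proof.
by move=> y z; rewrite /context_kappa tassocD; exact: (bimap_tmapD chi_bimap).
Qed.

Lemma context_kappaE n (f : lside S') (u : lside B) :
  context_kappa ((n ⊗ f : tensr N S') ⊗ u) = n ⊗ (chit f u : lside C).
Proof. by rewrite /context_kappa tassocE; exact: (bimap_tmapE _ _ chi_bimap). Qed.

Lemma context_kappa_bij : bijective context_kappa.
Proof.
apply: bij_comp; last exact: tassoc_bij.
have [_ [c cK Kc] _ _] := chi_iso; have [_ chil chir] := chi_bimap.
have cb : bimap (c : C -> P).
  split=> [y z|a y|y a]; apply: (can_inj cK).
  - by rewrite Kc chiD !Kc.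
  - by rewrite Kc chil Kc.
  - by rewrite Kc chir Kc.
exists (tmap (@id N) (c : lside C -> lside P)).
  apply: (@tensor_ext _ _ _ _ (fun y => tmap (@id N) (c : lside C -> lside P)
    (tmap (@id N) (chi : lside P -> lside C) y)) id) => [y z|//|n y].
    by rewrite (bimap_tmapD chi_bimap) (bimap_tmapD cb).
  by rewrite (bimap_tmapE _ _ chi_bimap) (bimap_tmapE _ _ cb) cK.
apply: (@tensor_ext _ _ _ _ (fun y => tmap (@id N) (chi : lside P -> lside C)
    (tmap (@id N) (c : lside C -> lside P) y)) id) => [y z|//|n y].
  by rewrite (bimap_tmapD cb) (bimap_tmapD chi_bimap).
by rewrite (bimap_tmapE _ _ cb) (bimap_tmapE _ _ chi_bimap) Kc.
Qed.

End Kappa.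

Lemma context_kappa_natural (N N' : rmodType A) (f : {linear N -> N'}) z :
  context_kappa (tmap (rtens S' f) (@id (lside B)) z) = rtens C f (context_kappa z).
Proof.
by rewrite /context_kappa tassoc_rtens; apply/esym;
  exact: (tmap_exchange f _ chi_bimap).
Qed.

(** * Descent along a faithfully flat S *)

Section Descent.
Hypothesis S_ff : faithfully_flat (lside B).

(** By [context_kappa], tensoring with C is the composite of tensoring with S', exact by
    [context_flat], and with S, exact by hypothesis. *)
Lemma presentation_flat : flat (lside C).
Proof.
move=> N1 N2 N3 f g fg; apply: exact_at_tmap => // y gy.
have ex := proj1 S_ff _ _ _ (rtens S' f) (rtens S' g) (context_flat ctx fg).
have [z zE] := bij_surj y (context_kappa_bij N2).
have [|w wE] := proj1 (ex z).
  apply: (bij_inj (context_kappa_bij N3)); rewrite context_kappa_natural zE.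
  by rewrite (morph_add0 (@context_kappaD N3)).
by exists (context_kappa w); rewrite -zE -wE context_kappa_natural.
Qed.

Section Counit.
Variable N : comod C.

Let H := homf_ob S N.
Let iota : {linear H -> tensr N S'} := linear_of (@hom_tensor_linear N).

Let ins_fun (y : tensr N S') : tensr (tensr N C) S' :=
  tassoc_inv (tmap (@id N) (lam : lside S' -> lside (tensb C S')) y).
Let ins_linear : linear ins_fun.
Proof.
have tl := @tassoc_linear _ _ _ N C S'; have lb := context_coaction_bimap.
move=> t y z; apply: (can_inj (@tassocK _ _ _ _ _ _)).
by rewrite tl !tassoc_invK; exact: (bimap_tmap_linear lb).
Qed.
Let ins : {linear tensr N S' -> tensr (tensr N C) S'} := linear_of ins_linear.
(** The equalizer is written as a kernel, the form in which flatness applies. *)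
Let dif : {linear tensr N S' -> tensr (tensr N C) S'} := rtens S' (coact N) \- ins.

Let iota_dif : exact_at iota dif.
Proof.
move=> y; rewrite -(hom_tensorP y); split=> [/eqP|e].
  by rewrite subr_eq0 => /eqP.
by apply/eqP; rewrite subr_eq0; apply/eqP.
Qed.

(** As [h] is colinear and the coaction of S is given by [chi], both sides send [h] ⊗ [u] to [h](e)
    ⊗ [chit f u], where eta(1) = e ⊗ f. *)
Let kappa_counit (z : tensr H B) :
  context_kappa (tmap iota (@id (lside B)) z) = coact N (counit_map S N z).
Proof.
move: z; apply: (@tensor_ext _ _ _ _
  (fun z : tensr H B => context_kappa (tmap iota (@id (lside B)) z))
  (fun z : tensr H B => coact N (counit_map S N z))) => [y z|y z|h u].
- by rewrite linear_tmapD context_kappaD.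
- by rewrite !linearD.
rewrite linear_tmapE counit_mapE comod_hom_coact coact_chi.
rewrite (morph_add_sum _ _ (@linear_tmapD _ _ _ _ (h : comod_hom S N))).
rewrite tens_suml (morph_add_sum _ _ (@context_kappaD N)).
by apply: eq_bigr => p _; rewrite context_kappaE linear_tmapE.
Qed.

(** With eta(1) = e ⊗ e', both sides send ([n] ⊗ [f]) ⊗ [u] to ([n] ⊗ [chit f e]) ⊗ [chit e' u], by
    the formula for the comatrix comultiplication. *)
Let kappa_ins (w : tensr (tensr N S') B) :
  context_kappa (tmap ins (@id (lside B)) w) =
  tassoc_inv (tmap (@id N) (@cop A C : lside C -> lside (tensb C C)) (context_kappa w)).
Proof.
have cb := cop_bimap C; have lb := context_coaction_bimap.
move: w; apply: (@tensor_ext _ _ _ _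
  (fun w : tensr (tensr N S') B => context_kappa (tmap ins (@id (lside B)) w))
  (fun w : tensr (tensr N S') B => tassoc_inv (tmap _ _ (context_kappa w)))) =>
    [y z|y z|y u].
- by rewrite linear_tmapD context_kappaD.
- by rewrite context_kappaD bimap_tmapD // tassoc_invD.
rewrite linear_tmapE; move: y.
apply: (@tensor_ext _ _ _ _ (fun y : tensr N S' => context_kappa (ins y ⊗ u))
  (fun y : tensr N S' => tassoc_inv (tmap _ _ (context_kappa (y ⊗ u))))) =>
    [y z|y z|n f].
- by rewrite linearD (@tensDl _ (tensr (tensr N C) S')) context_kappaD.
- by rewrite (@tensDl _ (tensr N S')) context_kappaD bimap_tmapD // tassoc_invD.
rewrite context_kappaE (bimap_tmapE _ _ cb) cop_chit tens_sumr
  (morph_add_sum _ _ (@tassoc_invD _ _ _ _ _ _)).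
rewrite /= /ins_fun (bimap_tmapE _ _ lb) tens_sumr
  (morph_add_sum _ _ (@tassoc_invD _ _ _ _ _ _)).
rewrite (@tens_suml _ (tensr (tensr N C) S')) (morph_add_sum _ _ (@context_kappaD _)).
by apply: eq_bigr => p _; rewrite !tassoc_invE context_kappaE.
Qed.

(* The equalizer description of Hom^C(S, N), tensored with S and read through
   context_kappa : (N ⊗ S') ⊗ S -> N ⊗ C, says that the coaction identifies N
   with Hom^C(S, N) ⊗ S. *)
Lemma presentation_counit_bij : bijective (counit_map S N).
Proof.
have iota_inj : injective (tmap iota (@id (lside B))).
  by apply: flat_inj; [exact: (proj1 S_ff)|exact: hom_tensor_inj].
apply: bij_of_inj_surj => [y z e|n].
  apply: iota_inj; apply: (bij_inj (context_kappa_bij N)).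
  by rewrite !kappa_counit e.
have [w wE] := bij_surj (coact N n) (context_kappa_bij N).
(* Coassociativity of N puts [w] in the kernel of [dif] ⊗ S. *)
have [|z zE] := proj1 (proj1 S_ff _ _ _ _ _ iota_dif w).
  have e : tmap (rtens S' (coact N)) (@id (lside B)) w = tmap ins (@id (lside B)) w.
    apply: (bij_inj (context_kappa_bij _)).
    rewrite context_kappa_natural kappa_ins wE -coact_assoc.
    by rewrite tassocK.
  have tD : forall v, tmap dif (@id (lside B)) v =
      tmap (rtens S' (coact N)) (@id (lside B)) v - tmap ins (@id (lside B)) v.
    apply: (@tensor_ext _ _ _ _ (tmap dif (@id (lside B)))
      (fun v => tmap (rtens S' (coact N)) (@id (lside B)) v -
        tmap ins (@id (lside B)) v)) => [y z|y z|y u].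
    - exact: linear_tmapD.
    - by rewrite !linear_tmapD opprD addrACA.
    - rewrite !linear_tmapE; apply/eqP; rewrite eq_sym subr_eq -tensDl /=.
      by rewrite subrK.
  by rewrite tD e subrr.
exists (z : tensf_ob S H).
(* The counit of C recovers an element from its coaction, so it is enough to compare coactions. *)
by rewrite -[RHS](coact_counit n) -wE -zE kappa_counit coact_counit.
Qed.

End Counit.

(** If [m] and [m'] have the same image, the maps from T they define agree after tensoring with S,
    hence are equal. The counit is bijective and inverts the unit tensored with S, so the latter is
    onto. A map [q] killing the image of the unit thus vanishes after tensoring with S, hence is
    zero. *)
Lemma presentation_unit_counit : unit_counit_bijective S.
Proof.
split=> [M|N]; last exact: presentation_counit_bij.
apply: bij_of_inj_surj => [m m' e|].
  apply: point_inj; apply: linear_ext; apply: (proj2 S_ff).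
  apply: (@tensor_ext _ _ _ _ (tmap (point m) (@id (lside B)))
    (tmap (point m') (@id (lside B))))
    => [y z|y z|t u]; [exact: linear_tmapD|exact: linear_tmapD|].
  rewrite !linear_tmapE [_ ⊗ u]tens_mid [in RHS]tens_mid.
  exact: (congr1 (fun h : comod_hom S _ => h (lact (t : T) (u : B))) e).
apply: epi_surjective => Q q qu h.
have e : tmap q (@id (lside B)) =1 tmap (\0 : {linear _ -> Q}) (@id (lside B)).
  move=> z; rewrite [RHS]tmap0l //.
  have -> : z = tensf_mor S (unit_map S M) (counit_map S (tensf_ob S M) z).
    apply: (bij_inj (presentation_counit_bij (tensf_ob S M))).
    move: (counit_map S _ z).
    apply: (@tensor_ext _ _ _ _ id
      (fun y : tensr M B => counit_map S (tensf_ob S M) (tensf_mor S (unit_map S M) y)))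
        => [//|y y'|m u].
      by rewrite !linearD.
    by rewrite [tensf_mor _ _ _]linear_tmapE counit_mapE.
  rewrite -(linear_tmap_comp q (unit_map S M)).
  by apply: (tmap0l (f := lin_comp q (unit_map S M))) => m; exact: qu.
exact: (proj2 S_ff _ _ _ _ e h).
Qed.

End Descent.
End Presentation.

(** * The context of a dual basis and the canonical map *)

Section DualBasisContext.
Variables (T A : pzRingType) (B : bimod T A) (s : seq (B * dual B)).
Hypothesis sE : forall u : B, \sum_(p <- s) p.1 *> dual_fun p.2 u = u.

Let D := dual B.

Let dual_fun_sum (I : Type) (r : seq I) (F : I -> D) u :
  dual_fun (\sum_(i <- r) F i) u = \sum_(i <- r) dual_fun (F i) u.
Proof. exact: (morph_add_sum (f := fun g : D => dual_fun g u)). Qed.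

Lemma dual_basis_dual (f : D) : \sum_(p <- s) lact (dual_fun f p.1) (p.2 : D) = f.
Proof.
apply: dual_ext => u; rewrite dual_fun_sum -[in RHS](sE u).
rewrite [RHS](linear_sum (f : {linear B -> regr A})); apply: eq_bigr => p _.
by rewrite [RHS](linear_ract (f : {linear B -> regr A})).
Qed.

Let e0 : tensb B D := \sum_(p <- s) (p.1 ⊗ (p.2 : lside D)).

(** Expanding [t] e_i in the dual basis and exchanging the sums moves the coefficients onto the dual
    forms, where they add up to the forms u |-> f_j([t] u). *)
Let e0_central t : lact t e0 = e0 *> t.
Proof.
rewrite /e0 (morph_add_sum _ _ (@lactDr _ _ (tensb B D) t)) ract_suml.
transitivity (\sum_(p <- s) \sum_(q <- s)
  (q.1 ⊗ (dual_fun q.2 (lact t p.1) *: (p.2 : lside D)))).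
  apply: eq_bigr => p _; rewrite tens_lact -[lact t p.1 in LHS]sE tens_suml.
  by apply: eq_bigr => q _; rewrite tens_mid.
rewrite exchange_big; apply: eq_bigr => q _ /=.
rewrite tens_ract -tens_sumr; congr tens; exact: (dual_basis_dual ((q.2 : D) *> t)).
Qed.

Let sigma (t : T) : tensb B D := lact t e0.

Let sigma_bimap : bimap (sigma : regb T -> tensb B D).
Proof.
split=> [t t'|t t'|t t'].
- exact: lactDl.
- exact: lactA.
- transitivity (lact (t : T) (lact t' e0)); first exact: (@lactA _ _ (tensb B D)).
  by rewrite (e0_central t'); exact: lactC.
Qed.

Let tau_fun (f : D) (u : lside B) : A := dual_fun f u.

Let tau_balanced : balanced tau_fun.
Proof. by split=> // f u v; exact: (linearD (f : {linear B -> regr A})). Qed.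

Let tau (z : tensb D B) : A := tlift tau_fun z.

Let tau_bimap : bimap (tau : tensb D B -> regb A).
Proof.
have tD : {morph tau : x y / x + y} := tliftD tau_balanced.
have tE f u : tau (f ⊗ u) = dual_fun f u := tliftE _ _ tau_balanced.
split=> [y z|a z|z a]; first exact: tD.
- move: z; apply: (@tensor_ext _ _ _ _ (fun z : tensb D B => tau (lact a z))
    (fun z => a * tau z)) => [y z|y z|f u].
  + by rewrite lactDr tD.
  + by rewrite tD mulrDr.
  + by rewrite tens_lact !tE.
- move: z; apply: (@tensor_ext _ _ _ _ (fun z : tensb D B => tau (z *> a))
    (fun z => tau z * a)) => [y z|y z|f u].
  + by rewrite ractDl tD.
  + by rewrite tD mulrDl.
  + by rewrite tens_ract !tE; exact: (linear_ract (f : {linear B -> regr A})).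
Qed.

Let tauE f u : tau (f ⊗ u) = dual_fun f u.
Proof. exact: (tliftE _ _ tau_balanced). Qed.

Let sigma1 : sigma 1 = e0.
Proof. exact: lact1. Qed.

Let triangle (u : B) :
  tlift (fun (e : B) (f : lside D) => e *> tau ((f : D) ⊗ (u : lside B))) (sigma 1) = u.
Proof.
have b : balanced (fun (e : B) (f : lside D) => e *> tau ((f : D) ⊗ (u : lside B))).
  split=> [e e' f|e f f'|e a f]; first exact: ractDl.
  - by rewrite !tauE -ractDr.
  - by rewrite !tauE ractA.
rewrite sigma1 (morph_add_sum _ _ (tliftD b)) -[RHS]sE; apply: eq_bigr => p _.
by rewrite tliftE // tauE.
Qed.

Let triangle' (f : D) :
  tlift (fun (e : B) (g : lside D) => lact (tau (f ⊗ (e : lside B))) (g : D)) (sigma 1)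
    = f.
Proof.
have b : balanced (fun (e : B) (g : lside D) => lact (tau (f ⊗ (e : lside B))) (g : D)).
  split=> [e e' g|e g g'|e a g].
  - rewrite !tauE -lactDl; congr lact; exact: (linearD (f : {linear B -> regr A})).
  - exact: (@lactDr _ _ D).
  - rewrite !tauE -[a *: g]/(lact a (g : D)) -lactA; congr lact.
    exact: (linear_ract (f : {linear B -> regr A})).
rewrite sigma1 (morph_add_sum _ _ (tliftD b)) -[RHS]dual_basis_dual.
by apply: eq_bigr => p _; rewrite tliftE // tauE.
Qed.

Definition dual_basis_context : comatrix_context B D :=
  ComatrixContext sigma_bimap tau_bimap triangle triangle'.

Lemma dual_basis_context_eps (f : D) (u : lside B) :
  cc_eps dual_basis_context (f ⊗ u) = dual_fun f u.
Proof. exact: tauE. Qed.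

End DualBasisContext.

(** * The canonical map from the comatrix coring to C *)

Section CanonicalMap.
Variables (T A : pzRingType) (C : coring A) (S : tcomod T C).
Let B := tcomod_bimod S.
Let D := dual B.
Let R := regular_tcomod C.
Variable ctx : comatrix_context B D.
Hypothesis ctx_eps : forall (f : D) (u : lside B), cc_eps ctx (f ⊗ u) = dual_fun f u.
Hypothesis counit_bij : bijective (counit_map S R).
Let s := repr (cc_eta ctx 1).

Let om (f : D) : tensr S C -> C :=
  tlift (fun (u : S) (c : lside C) => lact (dual_fun f u) (c : C)).

Let om_balanced (f : D) : balanced
  (fun (u : S) (c : lside C) => lact (dual_fun f u) (c : C)).
Proof.
split=> [u v c|u c c'|u a c].
- rewrite -lactDl; congr lact; exact: (linearD (f : {linear B -> regr A})).
- exact: (@lactDr _ _ C).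
- rewrite -[a *: c]/(lact a (c : C)) -lactA; congr lact.
  exact: (linear_ract (f : {linear B -> regr A})).
Qed.
Let omE (f : D) u (c : lside C) : om f (u ⊗ c) = lact (dual_fun f u) (c : C).
Proof. exact: (tliftE _ _ (om_balanced f)). Qed.
Let omD (f : D) : {morph om f : y z / y + z}.
Proof. exact: (tliftD (om_balanced f)). Qed.
Let om_linear (f : D) : linear (om f).
Proof. by apply: (tlift_linear (om_balanced f)) => u c a; exact: lactC. Qed.

Let psi_linear (f : D) : linear ((fun u => om f (coact S u)) : S -> R).
Proof. by move=> a u v; rewrite linearP; exact: om_linear. Qed.

(** Contracting the factor S by [f] commutes with [cop], by its left linearity, and with the
    associator, so coassociativity of S gives the claim. *)
Let psi_coact (f : D) (u : S) : coact R (linear_of (psi_linear f) u) =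
  tmap (linear_of (psi_linear f)) (@id (lside C)) (coact S u).
Proof.
have cb := cop_bimap C; have [cD cl cr] := cb.
pose Om (z : tensr S (tensb C C)) : tensb C C :=
  tlift (fun (u : S) (y : lside (tensb C C)) => lact (dual_fun f u) (y : tensb C C)) z.
have b : balanced (fun (u : S) (y : lside (tensb C C)) => lact (dual_fun f u)
  (y : tensb C C)).
  split=> [v w y|v y y'|v a y].
  - rewrite -lactDl; congr lact; exact: (linearD (f : {linear B -> regr A})).
  - exact: (@lactDr _ _ (tensb C C)).
  - rewrite -[a *: y]/(lact a (y : tensb C C)) -lactA; congr lact.
    exact: (linear_ract (f : {linear B -> regr A})).
have e1 z : cop (om f z) = Om
  (tmap (@id S) (@cop A C : lside C -> lside (tensb C C)) z).
  move: z; apply: (@tensor_ext _ _ _ _ (fun z => cop (om f z))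
    (fun z => Om (tmap _ _ z))) => [y z|y z|v c].
  - by rewrite omD cD.
  - by rewrite bimap_tmapD //; exact: (tliftD b).
  - by rewrite omE cl bimap_tmapE //; apply/esym; exact: (tliftE _ _ b).
have e2 z : Om (tassoc z) = tmap (linear_of (om_linear f)) (@id (lside C)) z.
  move: z; apply: (@tensor_ext _ _ _ _ (fun z : tensr (tensr S C) C => Om (tassoc z))
    (fun z => tmap _ _ z)) => [y z|y z|y d].
  - by rewrite tassocD; exact: (tliftD b).
  - exact: linear_tmapD.
  rewrite linear_tmapE; move: y.
  apply: (@tensor_ext _ _ _ _ (fun y : tensr S C => Om (tassoc (y ⊗ d)))
    (fun y : tensr S C => om f y ⊗ d)) => [y z|y z|v c].
  - by rewrite (@tensDl _ (tensr S C)) tassocD; exact: (tliftD b).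
  - by rewrite omD tensDl.
  - by rewrite tassocE omE -tens_lact; exact: (tliftE _ _ b).
rewrite [LHS]e1 -coact_assoc e2 -(linear_tmap_comp (linear_of (om_linear f)) (coact S)).
by [].
Qed.

(** The colinear map u |-> [f](u_[0]) u_[1]. The assignment [psi] is inverse to composition with
    [cou]. *)
Let psi (f : D) : homf_ob S R := @ComodHom A C S R (linear_of (psi_linear f))
  (psi_coact f).

(** T-linearity of [psi] comes from T-linearity of the coaction of S. *)
Let psiP : linear (psi : (D : rmodType T) -> homf_ob S R).
Proof.
move=> t f g; apply: comod_hom_ext => u.
rewrite [LHS]/(om (t *: f + g) (coact S u)).
transitivity (om f (coact S (tact S t u)) + om g (coact S u)); last by [].
rewrite tact_coact; move: (coact S u).
apply: (@tensor_ext _ _ _ _ (om (t *: f + g))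
  (fun z => om f (tmap (tact S t) (@id (lside C)) z) + om g z)) => [y z|y z|v c].
- exact: omD.
- by rewrite linear_tmapD !omD addrACA.
- by rewrite linear_tmapE !omE -lactDl.
Qed.

Let cou_psi (f : D) u : cou (psi f u : C) = dual_fun f u.
Proof.
have [cD cZ _] := cou_bimap C.
rewrite -[in RHS](coact_counit u) [LHS]/(cou (om f (coact S u))).
move: (coact S u); apply: (@tensor_ext _ _ _ _ (fun z => cou (om f z))
  (fun z => dual_fun f (tlift (fun (m : S) (c : lside C) => m *> cou (c : C)) z))) =>
    [y z|y z|v c].
- by rewrite omD cD.
- by rewrite (tliftD (cou_balanced C S)); exact: (linearD (f : {linear B -> regr A})).
- rewrite omE (tliftE _ _ (cou_balanced C S)) cZ; apply/esym.
  exact: (linear_ract (f : {linear B -> regr A})).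
Qed.

(** Composing [psi f] with [cou] gives back [f]; conversely, colinearity of [h] and left counitality
    of C show that [h] is [psi] of its composite with [cou]. *)
Let psi_bij : bijective psi.
Proof.
apply: bij_of_inj_surj => [f g e|h].
  by apply: dual_ext => u; rewrite -!cou_psi e.
have [cD cZ cR] := cou_bimap C.
have hL : linear ((fun u => cou ((h : comod_hom S R) u : C)) : B -> regr A).
  by move=> a u v; rewrite linearP [LHS]cD; congr (_ + _); exact: cR.
exists (linear_of hL : {linear B -> regr A}); apply: comod_hom_ext => u.
rewrite -[RHS](cop_counitl ((h : comod_hom S R) u : C)).
rewrite -[cop _]/(coact R ((h : comod_hom S R) u)) comod_hom_coact.
have b : balanced (fun (c1 : C) (c2 : lside C) => lact (cou c1) (c2 : C)).
  split=> [c c' y|c y y'|c a y]; first by rewrite cD lactDl.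
  - exact: (@lactDr _ _ C).
  - by rewrite (cR c a) (@lactA _ _ C).
rewrite [LHS]/(om _ (coact S u)); move: (coact S u).
apply: (@tensor_ext _ _ _ _ (om _)
  (fun z => tlift (fun (c1 : C) (c2 : lside C) => lact (cou c1) (c2 : C))
    (tmap (h : comod_hom S R) (@id (lside C)) z))) => [y z|y z|v c].
- exact: omD.
- by rewrite linear_tmapD (tliftD b).
- by rewrite omE linear_tmapE (tliftE _ _ b).
Qed.

(** Written as the counit at C after [psi] ⊗ S, so that its bijectivity follows from that of
    both. *)
Let can (z : comatrix_coring ctx) : C :=
  counit_map S R (tmap (linear_of psiP) (@id (lside B)) z).

Let canE (f : D) (u : lside B) : can (f ⊗ u) = om f (coact S (u : S)).
Proof. by rewrite /can linear_tmapE counit_mapE. Qed.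

Let canD : {morph can : y z / y + z}.
Proof. by move=> y z; rewrite /can linear_tmapD linearD. Qed.

Let can_bij : bijective can.
Proof.
apply: (bij_comp counit_bij).
have [phi psiK phiK] := psi_bij.
have phiL : linear (phi : homf_ob S R -> (D : rmodType T)).
  by move=> t g h; apply: (can_inj psiK); rewrite phiK psiP !phiK.
exists (tmap (linear_of phiL) (@id (lside B))) => z;
  rewrite -[LHS]linear_tmap_comp -[RHS]tmap_id.
  by congr (tmap _ _ _); apply: funext => f; exact: psiK.
by congr (tmap _ _ _); apply: funext => f; exact: phiK.
Qed.

Let can_bimap : bimap (can : tensb D B -> C).
Proof.
split=> [|a z|z a]; first exact: canD.
- move: z; apply: (@tensor_ext _ _ _ _ (fun z : tensb D B => can (lact a z))
    (fun z => lact a (can z))) => [y z|y z|f u].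
  + by rewrite lactDr canD.
  + by rewrite canD lactDr.
  rewrite tens_lact !canE; move: (coact S (u : S)).
  apply: (@tensor_ext _ _ _ _ (om (lact a f)) (fun z => lact a (om f z))) =>
    [y z|y z|v c].
  + exact: omD.
  + by rewrite omD lactDr.
  + by rewrite !omE -lactA.
- move: z; apply: (@tensor_ext _ _ _ _ (fun z : tensb D B => can (z *> a))
    (fun z => can z *> a)) => [y z|y z|f u].
  + by rewrite ractDl canD.
  + by rewrite canD ractDl.
  rewrite tens_ract !canE; exact: (linear_ract (linear_of (psi_linear f)) u a).
Qed.

Let eta_sum (u : B) : \sum_(p <- s) p.1 *> dual_fun p.2 u = u.
Proof.
rewrite -[RHS](context_sumr ctx u); apply: eq_bigr => p _.
by congr (_ *> _); exact/esym/ctx_eps.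
Qed.

(** The first factor of u_[0] ⊗ u_[1] is expanded in the dual basis and the coefficients are moved
    across the tensor sign. *)
Let coact_can (u : S) : coact S u =
  \sum_(p <- s) (p.1 ⊗ (can ((p.2 : D) ⊗ (u : lside B)) : lside C)).
Proof.
transitivity (\sum_(p <- s) (p.1 ⊗ (om p.2 (coact S u) : lside C))); last first.
  by apply: eq_bigr => p _; rewrite canE.
move: (coact S u); apply:
  (@tensor_ext _ _ _ _ id (fun z => \sum_(p <- s) (p.1 ⊗ (om p.2 z : lside C)))) =>
    [//|y z|v c].
  by rewrite -big_split; apply: eq_bigr => p _; rewrite omD; exact: tensDr.
rewrite -[v in LHS](eta_sum v) tens_suml; apply: eq_bigr => p _.
by rewrite tens_mid omE.
Qed.

(** Since [can] sends [f] ⊗ [u] to [psi f u], its compatibility with [cop] follows from colinearity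
    of [psi f] and from [coact_can]; compatibility with the counits is [cou_psi]. *)
Let can_coring_iso : coring_iso can.
Proof.
have [cD cl cr] := can_bimap.
split; [exact: can_bimap|exact: can_bij| |] => z.
- have b : balanced (fun (y : tensb D B) (z : lside (tensb D B)) => can y ⊗
    (can z : lside C)).
    exact: tmap_balanced.
  have pD : {morph tmap (can : tensb D B -> C) (can : lside (tensb D B) -> lside C) :
      y z / y + z}.
    exact: (tliftD b).
  have pE y y' : tmap (can : tensb D B -> C) (can : lside (tensb D B) -> lside C)
    (y ⊗ y') = can y ⊗ (can y' : lside C).
    exact: (tliftE _ _ b).
  have [kD _ _] := comatrix_cop_bimap ctx; have [dD _ _] := cop_bimap C.
  move: z; apply: (@tensor_ext _ _ _ _ (fun z => cop (can z))
    (fun z : tensb D B => tmap (can : tensb D B -> C)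
      (can : lside (tensb D B) -> lside C) (comatrix_cop ctx z))) => [y z|y z|f u].
  + by rewrite canD dD.
  + by rewrite kD pD.
  rewrite comatrix_copE (morph_add_sum _ _ pD) canE.
  rewrite -[LHS]/(coact R (psi f u)) comod_hom_coact coact_can.
  rewrite (morph_add_sum _ _ (@linear_tmapD _ _ _ _ (psi f : comod_hom S R))).
  apply: eq_bigr => p _; rewrite pE linear_tmapE; congr tens.
  by apply/esym; exact: canE.
- have [kD _ _] := cc_eps_bimap ctx; have [dD _ _] := cou_bimap C.
  move: z; apply: (@tensor_ext _ _ _ _ (fun z => cou (can z)) (cc_eps ctx)) =>
    [y z|y z|f u].
  + by rewrite canD dD.
  + exact: kD.
  + by rewrite canE ctx_eps; exact: cou_psi.
Qed.

(** The last clause lets [hom_cotensor_iso] be applied to [dual_coaction]. *)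
Lemma canonical_presentation : exists chi : comatrix_coring ctx -> C,
  [/\ coring_iso chi,
      forall u : S, coact S u =
        \sum_(p <- s) (p.1 ⊗ (chi ((p.2 : D) ⊗ (u : lside B)) : lside C))
    & @dual_coaction T A C S ctx =1 context_coaction chi].
Proof.
exists can; split=> // f; apply: eq_bigr => p _; congr tens.
by apply/esym; exact: canE.
Qed.

End CanonicalMap.

Theorem corollary3p7 (T A : pzRingType) (C : coring A) :
  (forall (F : functor (rmod_cat T) (comod_cat C))
          (G : functor (comod_cat C) (rmod_cat T))
          (FG : inverse_equivalences F G),
     let Sigma : tcomod T C := equivalence_image FG in
     [/\ (* (i) *)
         finitely_generated Sigma /\ projective Sigma,
         (* (ii), (iii) *)
         nat_iso F (tensor_functor Sigma) /\
         exists ctx : comatrix_context (tcomod_bimod Sigma) (dual (tcomod_bimod Sigma)),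
           comatrix_presentation ctx /\
           exists coactP : is_left_coaction (@dual_coaction T A C Sigma ctx),
             nat_iso G (cotensor_functor (LComod coactP)),
         (* (iv) *)
         bijective (tcomod_j Sigma : {rmorphism T -> comod_end Sigma})
       & flat (lside C) ->
         (* (v) *)
         [/\ finitely_generated_object (Sigma : comod_cat C),
             projective_object (Sigma : comod_cat C)
           & generator (Sigma : comod_cat C)] /\
         (* (vi) *)
         faithfully_flat (lside (tcomod_bimod Sigma))])
  /\
  (forall Sigma : tcomod T C,
     (* (i) *)
     finitely_generated Sigma /\ projective Sigma ->
     (* (iii) *)
     (exists ctx : comatrix_context (tcomod_bimod Sigma) (dual (tcomod_bimod Sigma)),
        comatrix_presentation ctx) ->
     (* (vi) *)
     faithfully_flat (lside (tcomod_bimod Sigma)) ->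
     [/\ flat (lside C),
         inverse_equivalences (tensor_functor Sigma) (hom_functor Sigma)
       & bijective (tcomod_j Sigma : {rmorphism T -> comod_end Sigma})]).
Proof.
split=> [F G FG Sigma|Sigma _ [ctx [chi [chi_iso coact_chi]]] S_ff]; last first.
  have S_galois := presentation_unit_counit chi_iso coact_chi S_ff.
  split; [exact: presentation_flat chi_iso S_ff| |].
    exact: galois_inverse_equivalences.
  exact: galois_j_bijective.
have S_galois : unit_counit_bijective Sigma := equivalence_unit_counit FG.
have [s sE] := galois_dual_basis S_galois.
split; [|split; [exact: functor_tensor_iso|]|exact: galois_j_bijective|].
- split; [exact: dual_basis_finitely_generated sE|exact: dual_basis_projective sE].
- have [chi [chi_iso coact_chi dualE]] := canonical_presentation (dual_basis_context_eps sE)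
    (proj2 S_galois (regular_tcomod C)).
  exists (dual_basis_context sE); split; first by exists chi.
  have lP : is_left_coaction (@dual_coaction T A C Sigma (dual_basis_context sE)).
    by rewrite (funext dualE); exact: context_coaction_is_left.
  (* G is the functor of colinear maps out of S, which is the cotensor product with the dual. *)
  exists lP; apply: nat_iso_trans (functor_hom_iso FG) _.
  exact: (hom_cotensor_iso chi_iso coact_chi lP dualE).
- move=> C_flat; split; last exact: galois_faithfully_flat.
  split; [exact: galois_finitely_generated_object|exact: galois_projective_object|].
  exact: galois_generator.
Qed.
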